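(* Fix $T>0$ and, for $0<\delta\le T$, let $\Omega_\delta:=\mathbb{R}\times(0,\delta]$, $\overline{\Omega}_\delta=\mathbb{R}\times[0,\delta]$. Let $\gamma\in\mathbb{R}$ and let $k_L,k_U>0$ be constants. Assume: (i) $k:\Omega_T\to(0,\infty)$ satisfies $k\in C^{1/2}(\Omega_T)$, $k_x\in L^\infty([0,T],L^2(\mathbb{R}))$, and $k_L\le k(x,t)\le k_U$ for all $(x,t)\in\Omega_T$; (ii) $f:\overline{\Omega}_T\to\mathbb{R}$ satisfies $f\in L^\infty([0,T],L^2(\mathbb{R}))$; (iii) $G:\overline{\Omega}_T\to\mathbb{R}$ is given by $G(x,t)=\int_{-\infty}^x f^2(z,t)\,dz$ and satisfies $G\in L^\infty([0,T],C(\mathbb{R}))\cap L^\infty(\Omega_T)$ and $G_x\in L^\infty([0,T],L^1(\mathbb{R}))$. Let $\Gamma$ be the fundamental solution of $w_t-k(x,t)w_{xx}+\gamma w=0$ described in the context, and set $$W_f(x,t)=\int_0^t\!\int_{\mathbb{R}}\Gamma(x,t;\xi,\tau)f(\xi,\tau)\,d\xi\,d\tau,\qquad W_{f,x}(x,t)=\int_0^t\!\int_{\mathbb{R}}\Gamma_x(x,t;\xi,\tau)f(\xi,\tau)\,d\xi\,d\tau,$$ $$W_{G,x}(x,t)=\int_0^t\!\int_{\mathbb{R}}\Gamma_x(x,t;\xi,\tau)G(\xi,\tau)\,d\xi\,d\tau.$$ Then for any constant $K>0$ there exists a sufficiently small $\delta>0$, depending on $G$, $f$ and $k$, such that $$\|W_f\|_{L^2(\overline{\Omega}_\delta)}\le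 K,\qquad \|W_{f,x}\|_{L^2(\overline{\Omega}_\delta)}\le K,\qquad \|W_{G,x}\|_{L^2(\overline{\Omega}_\delta)}\le K.$$
   Context: $C^{\beta}$ denotes Hölder continuity with exponent $\beta$ with respect to both variables $(x,t)$ on the indicated set. Fundamental solution. For fixed $(\xi,\tau)$ let $$H^{\xi,\tau}(x-\xi,t-\tau)=\frac{1}{2\sqrt{\pi}\sqrt{k(\xi,\tau)}\sqrt{t-\tau}}\,e^{-\frac{(x-\xi)^2}{4k(\xi,\tau)(t-\tau)}},\qquad t>\tau,$$ the heat kernel with frozen coefficient, i.e. $H^{\xi,\tau}_t-k(\xi,\tau)H^{\xi,\tau}_{xx}=0$. The fundamental solution $\Gamma$ of $w_t-k(x,t)w_{xx}+\gamma w=0$ is $$\Gamma(x,t;\xi,\tau)=H^{\xi,\tau}(x-\xi,t-\tau)+\int_\tau^t\int_{\mathbb{R}}H^{y,s}(x-y,t-s)\,\Phi(y,s;\xi,\tau)\,dy\,ds,$$ where $\Phi$ is determined by the condition $\Gamma_t-k(x,t)\Gamma_{xx}+\gamma\Gamma=0$ (in $(x,t)$, for $t>\tau$). Such a $\Phi$ exists (Friedman's parametrix construction) and satisfies $|\Phi(y,s;\xi,\tau)|\le \frac{C}{(s-\tau)^{5/4}}e^{-\frac{d(y-\xi)^2}{4(s-\tau)}}$ with constants $C,d>0$. $\Gamma_x$ denotes the derivative of $\Gamma$ with respect to its first variable $x$. *)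

(* Defs.v *)
From HB Require Import structures.
From mathcomp Require Export all_boot all_order all_algebra.
From mathcomp Require Export all_classical all_reals all_analysis.
From mathcomp Require Export measurable_realfun.
Export Order.TTheory GRing.Theory Num.Theory.
Export numFieldNormedType.Exports.

Set Implicit Arguments.
Unset Strict Implicit.
Unset Printing Implicit Defensive.

Local Open Scope ring_scope.
Local Open Scope classical_set_scope.

(* A function on a strip R x [0, T] or R x (0, T] is represented by a total
   function of x and t; every definition below only uses its values on the
   strip. *)

Section defs.
Context {R : realType}.
Implicit Types (T x y t s xi tau gamma : R) (u v k : R -> R -> R).

Local Notation mu := (@lebesgue_measure R).

Definition Omega (T : R) : set (R * R) := setT `*` `]0, T].
Definition Omega_bar (T : R) : set (R * R) := setT `*` `[0, T].

Definition holder_on (D : set (R * R)) (beta : R) u : Prop :=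
  exists C : R, forall z w, D z -> D w ->
    `|u z.1 z.2 - u w.1 w.2|
      <= C * (`|z.1 - w.1| `^ beta + `|z.2 - w.2| `^ beta).

(* C_c^oo(R) *)
Definition test_function (phi : R -> R) : Prop :=
  (forall n x, derivable (derive1n n phi) x 1) /\
  (exists M : R, forall x, M <= `|x| -> phi x = 0).

(* b is the distributional derivative of a on the real line *)
Definition weak_derivative (a b : R -> R) : Prop :=
  [/\ locally_integrable setT a, locally_integrable setT b &
      forall phi, test_function phi ->
        \int[mu]_x (a x * derive1 phi x) = - \int[mu]_x (b x * phi x)].

Definition weak_derivative_x T u v : Prop :=
  {ae mu, forall t, t \in `[0, T] -> weak_derivative (u ^~ t) (v ^~ t)}.

(* u \in L^oo([0, T], L^p(R)) *)
Definition Linfty_Lp T (p : \bar R) u : Prop :=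
  measurable_fun (Omega_bar T) (fun z => u z.1 z.2) /\
  ('N[mu]_+oo [(fun t => 'N[mu]_p [EFin \o u ^~ t]) \_ `[0%R, T]] < +oo)%E.

(* u \in L^oo([0, T], C(R)), with the supremum norm on C(R) *)
Definition Linfty_C T u : Prop :=
  {ae mu, forall t, t \in `[0, T] -> continuous (u ^~ t)} /\
  ('N[mu]_+oo [(fun t => ereal_sup (range (fun x => `|u x t|%:E))) \_ `[0%R, T]]
     < +oo)%E.

(* u \in L^oo(D) *)
Definition Linfty_on (D : set (R * R)) u : Prop :=
  measurable_fun D (fun z => u z.1 z.2) /\
  ('N[(mu \x mu)%E]_+oo [(fun z => (u z.1 z.2)%:E) \_ D] < +oo)%E.

(* w \in L^2(D) and its norm is at most K; w may take infinite values, so that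
   a divergent integral in the definition of w cannot be mistaken for 0. *)
Definition L2_norm_le (D : set (R * R)) (w : R -> R -> \bar R) (K : R) : Prop :=
  measurable_fun D (fun z => w z.1 z.2) /\
  ('N[(mu \x mu)%E]_2%:E [(fun z => w z.1 z.2) \_ D] <= K%:E)%E.

(* H^{xi,tau}(x, t) for t > 0 *)
Definition frozen_heat k (xi tau x t : R) : R :=
  expR (- (x ^+ 2 / (4 * k xi tau * t)))
    / (2 * Num.sqrt pi * Num.sqrt (k xi tau) * Num.sqrt t).

Definition Gamma k (Phi : R -> R -> R -> R -> R) (x t xi tau : R) : R :=
  frozen_heat k xi tau (x - xi) (t - tau) +
  \int[mu]_(s in `]tau, t[)
    \int[mu]_y (frozen_heat k y s (x - y) (t - s) * Phi y s xi tau).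

Definition Gamma_x k Phi (x t xi tau : R) : R :=
  derive1 (fun z => Gamma k Phi z t xi tau) x.

(* derivative of g at t relative to A; one-sided at an end point of A *)
Definition derivative_within (A : set R) (g : R -> R) (t l : R) : Prop :=
  (g s - g t) / (s - t) @[s --> within A t^'] --> l.

(* Gamma_t - k Gamma_xx + gamma Gamma = 0 at all points of Omega_T with t > tau;
   at t = T the time derivative is the left one, k being given up to T only. *)
Definition solves_equation T gamma k (Gam : R -> R -> R -> R -> R) : Prop :=
  forall xi tau x t, 0 < tau -> tau < t -> t <= T ->
    [/\ derivable (fun z => Gam z t xi tau) x 1,
        derivable (derive1 (fun z => Gam z t xi tau)) x 1 &
        exists Gt : R,
          derivative_within `]tau, T] (fun s => Gam x s xi tau) t Gt /\
          Gt - k x t * derive1n 2 (fun z => Gam z t xi tau) x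
             + gamma * Gam x t xi tau = 0].

Definition times_ordered T : set ((R * R) * (R * R)) :=
  [set z | 0 < z.2.2 /\ z.2.2 < z.1.2 /\ z.1.2 <= T].

(* Phi = Phi(y, s; xi, tau) is a density of Friedman's parametrix construction.
   The joint measurability gives a meaning to the iterated integrals. *)
Definition parametrix_density T gamma k (Phi : R -> R -> R -> R -> R) : Prop :=
  [/\ measurable_fun (times_ordered T)
        (fun z : (R * R) * (R * R) => Phi z.1.1 z.1.2 z.2.1 z.2.2),
      exists C d : R, [/\ 0 < C, 0 < d &
        forall y s xi tau, 0 < tau -> tau < s -> s <= T ->
          `|Phi y s xi tau| <= C / (s - tau) `^ (5 / 4)
             * expR (- (d * (y - xi) ^+ 2 / (4 * (s - tau))))] &
      solves_equation T gamma k (Gamma k Phi)].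

(* (x, t) |-> int_0^t int_R N(x, t; xi, tau) g(xi, tau) dxi dtau *)
Definition potential (N : R -> R -> R -> R -> R) (g : R -> R -> R)
    (x t : R) : \bar R :=
  (\int[mu]_(tau in `]0%R, t[) \int[mu]_xi (N x t xi tau * g xi tau)%:E)%E.

End defs.

(* Main.v *)
From HB Require Import structures.
Require Import Defs.
From mathcomp Require Import ring lra ess_sup_inf.

(** The parametrix bound on [Phi] and the semigroup-type inequality for
    Gaussians give |Gamma| <= A L^(-1/2) g and |Gamma_x| <= A L^(-1) g, where
    L = t - tau and g is a Gaussian in x - xi at time L.  Since the integral
    over xi of L^(-1) g is of order L^(-1/2), which is integrable in tau, a
    Schur test bounds the L2 norm in x of W_f and W_(f,x) uniformly in t.  For
    W_(G,x) one needs cancellation, G being only bounded: the maximum principle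
    shows that the integral of Gamma over xi is exp(-gamma L), whatever x is,
    so that the integral of Gamma_x over xi vanishes; then G(xi) may be
    replaced by G(xi) - G(x), the integral of f^2 between x and xi, and
    W_(G,x) is bounded in L^oo and in L^1, uniformly in t.  Integrating over
    0 <= t <= delta makes the three norms small. *)

Set Implicit Arguments.
Unset Strict Implicit.
Unset Printing Implicit Defensive.
Local Open Scope ring_scope.
Local Open Scope classical_set_scope.

(** * Gaussian estimates *)

(** No integral is differentiated under the sign. The x-derivative of [Gamma] exists by
    [solves_equation] and is estimated only as a limit of difference quotients of step 1/(n+1):
    bounds on it are Lipschitz bounds on [Gamma], and its zero mass comes from the equality of two
    masses of [Gamma]. The power -5/4 in the bound on [Phi] is not integrable in time. Integrating
    one Gaussian over the line gains 1/2, and the resulting -3/4 is integrable; hence the powers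
    -3/4 and 1/4 that recur below. Polynomial factors are absorbed by fractions of the Gaussian
    exponent, which shrinks from 1/(4 kU) to fractions of [c]; in the end only its positivity
    matters. The initial value in the maximum principle rests on the Holder exponent 1/2 of [k]:
    freezing the coefficient at x instead of xi costs sqrt|x - xi|, that is (t - tau)^(1/4) after
    integration, which tends to 0. *)

Section gaussian.
Context {R : realType}.
Implicit Types (a b c p q r x y : R).
Local Notation mu := (@lebesgue_measure R).

(** Not normalised: [p] is a time, and the exponent [c] is left free because most estimates give up
    a fraction of it. *)
Definition gauss c r p : R := expR (- (c * r ^+ 2 / p)).

Lemma gauss_ge0 c r p : 0 <= gauss c r p.
Proof. exact: expR_ge0. Qed.

Lemma gauss_gt0 c r p : 0 < gauss c r p.
Proof. exact: expR_gt0. Qed.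

Lemma gaussN c r p : gauss c (- r) p = gauss c r p.
Proof. by rewrite /gauss sqrrN. Qed.

Lemma gaussB c x y p : gauss c (x - y) p = gauss c (y - x) p.
Proof. by rewrite -gaussN opprB. Qed.

Lemma gauss_le1 c r p : 0 <= c -> 0 < p -> gauss c r p <= 1.
Proof.
move=> c0 p0; rewrite -expR0 ler_expR oppr_le0.
exact: divr_ge0 (mulr_ge0 c0 (sqr_ge0 r)) (ltW p0).
Qed.

Lemma le_gauss c c' r p : 0 < p -> c' <= c -> gauss c r p <= gauss c' r p.
Proof.
move=> p0 cc; rewrite ler_expR lerN2 ler_wpM2r ?invr_ge0 ?(ltW p0)//.
by rewrite ler_wpM2r ?sqr_ge0.
Qed.

Lemma gaussM c c' r p : gauss c r p * gauss c' r p = gauss (c + c') r p.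
Proof. by rewrite /gauss -expRD; congr expR; rewrite -opprD -!mulrDl. Qed.

Lemma gauss_half c r p : gauss c r p = gauss (c / 2) r p * gauss (c / 2) r p.
Proof. by rewrite gaussM -splitr. Qed.

(** Pointwise substitute for the semigroup law: x^2/p + y^2/q exceeds (x + y)^2/(p + q) by the
    square (xq - yp)^2 / (pq(p + q)). *)
Lemma gauss_conv_le c x y p q : 0 <= c -> 0 < p -> 0 < q ->
  gauss c x p * gauss c y q <= gauss c (x + y) (p + q).
Proof.
move=> c0 p0 q0; rewrite /gauss -expRD ler_expR -opprD lerN2.
rewrite -subr_ge0.
have pq0 : 0 < p + q by rewrite addr_gt0.
have -> : c * x ^+ 2 / p + c * y ^+ 2 / q - c * (x + y) ^+ 2 / (p + q) =
  c * (x * q - y * p) ^+ 2 / (p * q * (p + q)).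
  by field; rewrite !gt_eqF.
apply: divr_ge0; first by apply: mulr_ge0 => //; exact: sqr_ge0.
by rewrite !mulr_ge0 // ltW.
Qed.

(** The Gaussian is a multiple of the density of the normal law of mean [x] and variance p/(2c). *)
Lemma integral_gauss c x p : 0 < c -> 0 < p ->
  (\int[mu]_y (gauss c (y - x) p)%:E = (Num.sqrt (pi * p / c))%:E)%E.
Proof.
move=> c0 p0; pose s := Num.sqrt (p / (2 * c)).
have s2 : s ^+ 2 = p / (2 * c).
  by rewrite sqr_sqrtr // divr_ge0 ?mulr_ge0 ?(ltW c0) ?(ltW p0).
have s0 : s != 0 by rewrite -(sqrf_eq0 s) s2 gt_eqF // divr_gt0 ?mulr_gt0.
have pk : normal_peak s = (Num.sqrt (pi * p / c))^-1.
  rewrite /normal_peak s2; congr (Num.sqrt _)^-1.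
  by field; rewrite gt_eqF.
have E y : gauss c (y - x) p = Num.sqrt (pi * p / c) * normal_pdf x s y.
  rewrite normal_pdfE // pk mulrA divff ?mul1r; last first.
    by rewrite gt_eqF // sqrtr_gt0 divr_gt0 ?mulr_gt0 ?pi_gt0.
  rewrite /gauss /normal_fun s2; congr expR.
  by field; rewrite !gt_eqF.
under eq_integral do rewrite E EFinM.
rewrite ge0_integralZl ?lee_fin ?sqrtr_ge0 //.
- by rewrite integral_normal_pdf mule1.
- by apply/measurable_EFinP; exact: measurable_normal_pdf.
- by move=> y _; rewrite lee_fin normal_pdf_ge0.
Qed.

Lemma integral_gaussC c x p : 0 < c -> 0 < p ->
  (\int[mu]_y (gauss c (x - y) p)%:E = (Num.sqrt (pi * p / c))%:E)%E.
Proof.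
by move=> c0 p0; rewrite -(integral_gauss x c0 p0); apply: eq_integral => y _; rewrite gaussB.
Qed.

(* From [expR u >= 1 + u >= 2 sqrt u]. *)
Lemma norm_gauss_le c r p : 0 < c -> 0 < p ->
  `|r| * gauss c r p <= Num.sqrt (p / c).
Proof.
move=> c0 p0; set w := Num.sqrt (p / c).
have w0 : 0 < w by rewrite sqrtr_gt0 divr_gt0.
have w2 : w ^+ 2 = p / c by rewrite sqr_sqrtr // divr_ge0 // ltW.
have -> : gauss c r p = expR (- (`|r| / w) ^+ 2).
  rewrite /gauss exprMn real_normK ?num_real // exprVn w2; congr expR.
  by field; rewrite !gt_eqF.
rewrite expRN ler_pdivrMr ?expR_gt0 //.
have h := expR_ge1Dx ((`|r| / w) ^+ 2).
rewrite -ler_pdivrMl // mulrC.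
apply: le_trans h; set z := `|r| / w.
have := sqr_ge0 (z - 1); have := sqr_ge0 z; nra.
Qed.

(** If |x - y| >= sqrt p the larger Gaussian alone suffices, and the + 1 in the constant is for this
    case. Otherwise exp(-v) >= 1 - v with v = c(y^2 - x^2)/p, and half of the Gaussian absorbs the
    factor |x|, which produces the term 4 sqrt c + c. *)
Lemma gauss_diff_le c x y p : 0 < c -> 0 < p ->
  `|gauss c x p - gauss c y p| <=
    (4 * (c + Num.sqrt c) + 1) * (`|x - y| / Num.sqrt p)
      * (gauss (c / 2) x p + gauss (c / 2) y p).
Proof.
move=> c0 p0.
wlog xy : x y / `|x| <= `|y|.
  move=> H; case: (leP `|x| `|y|) => [|/ltW] /H //.
  by rewrite (distrC (gauss c y p)) (distrC y) (addrC (gauss (c / 2) y p)).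
have p0' : 0 < Num.sqrt p by rewrite sqrtr_gt0.
have sp : Num.sqrt p ^+ 2 = p by rewrite sqr_sqrtr // ltW.
have sc : Num.sqrt c ^+ 2 = c by rewrite sqr_sqrtr // ltW.
have sc0 : 0 < Num.sqrt c by rewrite sqrtr_gt0.
have gxy : gauss c y p <= gauss c x p.
  rewrite ler_expR lerN2 ler_wpM2r ?invr_ge0 ?(ltW p0)// ler_wpM2l ?(ltW c0) //.
  by rewrite -(real_normK (num_real x)) -(real_normK (num_real y)) lerXn2r ?nnegrE.
rewrite ger0_norm ?subr_ge0 //.
set d : R := `|x - y|; set K := 4 * _ + 1.
have K1 : 1 <= K by rewrite /K; nra.
have d0 : 0 <= d by exact: normr_ge0.
have g2 : gauss c x p <= gauss (c/2) x p.
  by apply: le_gauss => //; rewrite ler_pdivrMr // ler_peMr ?(ltW c0) // ler1n.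
have gx := gauss_ge0 (c/2) x p; have gy := gauss_ge0 (c/2) y p.
have gcy := gauss_ge0 c y p.
suff : gauss c x p - gauss c y p <= K * (d / Num.sqrt p) * gauss (c / 2) x p.
  move=> h; apply: le_trans h _; rewrite ler_wpM2l ?lerDl //.
  by rewrite mulr_ge0 ?divr_ge0 ?(ltW p0') //; lra.
case: (leP (Num.sqrt p) d) => dp.
  have d1 : 1 <= d / Num.sqrt p by rewrite ler_pdivlMr // mul1r.
  have Kd : 1 <= K * (d / Num.sqrt p) by rewrite -[1]mulr1; apply: ler_pM.
  apply: (@le_trans _ _ (gauss (c/2) x p)); first lra.
  by rewrite ler_peMl.
have hd : `|y| <= `|x| + d.
  by rewrite -{1}[y](subKr x) (le_trans (ler_normB _ _)).
have e1 : gauss c x p - gauss c y p <= gauss c x p * (c * (y ^+ 2 - x ^+ 2) / p).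
  have -> : gauss c y p = gauss c x p * expR (- (c * (y ^+ 2 - x ^+ 2) / p)).
    by rewrite /gauss -expRD; congr expR; field; rewrite gt_eqF.
  have := expR_ge1Dx (- (c * (y ^+ 2 - x ^+ 2) / p)); set u := expR _; set v := c * _ / p.
  have := gauss_ge0 c x p; nra.
apply: le_trans e1 _.
(* Factor as (|y| - |x|)(|y| + |x|), with |y| <= |x| + d and d < sqrt p. *)
have yx2 : y ^+ 2 - x ^+ 2 <= d * (2 * `|x| + Num.sqrt p).
  rewrite -(real_normK (num_real y)) -(real_normK (num_real x)).
  have := normr_ge0 x; nra.
rewrite gauss_half.
have k1 := @norm_gauss_le (c/2) x p ltac:(by rewrite divr_gt0) p0.
have k2 : Num.sqrt (p / (c / 2)) <= 2 * Num.sqrt p / Num.sqrt c.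
  have -> : 2 * Num.sqrt p / Num.sqrt c = Num.sqrt (4 * p / c).
    rewrite sqrtrM ?sqrtrV ?(ltW c0) ?mulr_ge0 ?(ltW p0) // sqrtrM //.
    by congr (_ * _ / _); rewrite -[4]/((2 * 2)%:R) natrM -expr2 sqrtr_sqr ger0_norm.
  apply: ler_wsqrtr; rewrite invf_div mulrA (mulrC p) ler_wpM2r ?invr_ge0 ?(ltW c0) //.
  by rewrite ler_wpM2r ?(ltW p0) // ler_nat.
have g1 := @gauss_le1 (c/2) x p ltac:(by rewrite ltW // divr_gt0) p0.
set g := gauss _ x p in gx g1 k1 g2 |- *.
have step : g * (c * (y ^+ 2 - x ^+ 2) / p) <= K * (d / Num.sqrt p).
  have -> : K * (d / Num.sqrt p) = K * d * Num.sqrt p / p.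
    by rewrite -{3}sp; field; rewrite gt_eqF.
  rewrite mulrA ler_wpM2r ?invr_ge0 ?(ltW p0) //.
  have gs : g * `|x| <= 2 * Num.sqrt p / Num.sqrt c.
    by rewrite mulrC (le_trans k1).
  have : g * (y ^+ 2 - x ^+ 2) <= d * (4 * Num.sqrt p / Num.sqrt c + Num.sqrt p).
    apply: le_trans (ler_wpM2l gx yx2) _.
    rewrite mulrCA ler_wpM2l // mulrDr mulrCA.
    rewrite lerD //; last by rewrite ler_piMl // ltW.
    by rewrite -[4]/((2 * 2)%:R) natrM -!mulrA ler_wpM2l // mulrA.
  move/(ler_wpM2l (ltW c0)).
  have -> : c * (d * (4 * Num.sqrt p / Num.sqrt c + Num.sqrt p)) =
     (4 * Num.sqrt c + c) * d * Num.sqrt p.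
    by rewrite -{1 4}sc; field; rewrite gt_eqF.
  rewrite mulrCA => /le_trans; apply; rewrite -!mulrA ler_wpM2r ?mulr_ge0 ?(ltW p0') //.
  by rewrite /K; lra.
by rewrite -[g * g * _]mulrA mulrC ler_wpM2r.
Qed.

End gaussian.

(** * Integrals of singular powers of time *)

Section time_integrals.
Context {R : realType}.
Implicit Types (a b c p q r x y s t m M : R).
Local Notation mu := (@lebesgue_measure R).

(** An improper integral: [f] may blow up at both ends, and only bounds on the primitive are used.
    The fundamental theorem holds on the compact intervals [A n], and monotone convergence exhausts
    the open one. *)
Lemma ge0_integral_oo_le (f F : R -> R) a b m M :
  a < b ->
  (forall x, a < x < b -> {for x, continuous f}) ->
  (forall x, a < x < b -> 0 <= f x) ->
  (forall x, a < x < b -> is_derive x 1 F (f x)) ->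
  (forall x, a < x < b -> m <= F x <= M) ->
  (\int[mu]_(x in `]a, b[) (f x)%:E <= (M - m)%:E)%E.
Proof.
move=> ab cf f0 dF bF.
pose e n : R := (b - a) / 2 * n.+1%:R^-1.
have ba0 : 0 < (b - a) / 2 by rewrite divr_gt0 ?subr_gt0.
have e0 n : 0 < e n by rewrite mulr_gt0 ?invr_gt0.
have e1 n : e n <= (b - a) / 2.
  by rewrite ler_piMr ?(ltW ba0)// invf_le1 // ler1n.
pose A n := `[a + e n, b - e n]%classic : set R.
have inA n x : A n x -> a < x < b.
  by rewrite /A /= in_itv /= => /andP[h1 h2]; have := e0 n; lra.
have bigA : `]a, b[%classic = \bigcup_n A n.
  apply/seteqP; split=> [x /=|x [n _ /inA]]; last by rewrite /= in_itv.
  rewrite in_itv /= => /andP[ax xb].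
  have h0 : 0 < Num.min (x - a) (b - x) / ((b - a) / 2).
    by rewrite divr_gt0 // lt_min !subr_gt0 ax xb.
  have [n _ /(_ n (leqnn n)) hn] := near_infty_natSinv_lt (PosNum h0).
  exists n => //; rewrite /A /= in_itv /=.
  have : e n <= Num.min (x - a) (b - x).
    by move: hn; rewrite /= ltr_pdivlMr // mulrC => /ltW.
  by rewrite le_min => /andP[h1 h2]; lra.
have mA n : measurable (A n) by exact: measurable_itv.
have mf : measurable_fun `]a, b[ f.
  apply: open_continuous_measurable_fun; first exact: interval_open.
  by move=> x; rewrite inE /= in_itv /= => /cf.
have h : (\int[mu]_(x in A i) (f x)%:E @[i --> \oo] -->
    \int[mu]_(x in \bigcup_i A i) (f x)%:E)%E.
  apply: ge0_nondecreasing_set_cvg_integral => //.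
  - move=> i j ij; apply/subsetPset => x; rewrite /A /= !in_itv /= => /andP[h1 h2].
    have : e j <= e i by rewrite ler_wpM2l ?(ltW ba0)// lef_pV2 ?posrE // ler_nat ltnS.
    by lra.
  - move=> n; apply/measurable_EFinP; apply: measurable_funS mf => //.
    by move=> x /inA; rewrite /= in_itv.
  - by move=> n x /inA /f0; rewrite lee_fin.
rewrite bigA -(cvg_lim _ h) //; apply: lime_le; first exact: (cvgP _ h).
apply: nearW => n.
(* For n = 0 the interval [A n] shrinks to the midpoint, [e 0] being half the length; the integral
   is then 0 and m <= M is read off at that point. *)
have [xe|xe] := ltP (a + e n) (b - e n); last first.
  have le1 : A n `<=` [set a + e n].
    by move=> x; rewrite /A /= in_itv /= => /andP[h1 h2]; apply/eqP; rewrite eq_le h1 andbT; lra.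
  rewrite (integral_Sset1 _ le1) lee_fin subr_ge0.
  have /bF/andP[h1 h2] : a < (a + b) / 2 < b by lra.
  exact: le_trans h1 h2.
have cF x : a < x < b -> {for x, continuous F}.
  move=> /dF [dFx _]; apply: differentiable_continuous; exact/derivable1_diffP.
have inab x : a + e n <= x <= b - e n -> a < x < b by have := e0 n; lra.
rewrite (continuous_FTC2 (F := F) xe).
- rewrite -EFinB lee_fin.
  have /bF/andP[_ h1] : a < b - e n < b by apply: inab; rewrite lexx andbT ltW.
  have /bF/andP[h2 _] : a < a + e n < b by apply: inab; rewrite lexx ltW.
  lra.
- apply: continuous_in_subspaceT => x; rewrite inE /= in_itv /= => hx.
  exact/cf/inab.
- split.
  + move=> x; rewrite in_itv /= => /andP[h1 h2].
    by have /inab/dF[] : a + e n <= x <= b - e n by rewrite !ltW.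
  + by apply: cvg_at_right_filter; apply: cF; apply: inab; rewrite lexx ltW.
  + by apply: cvg_at_left_filter; apply: cF; apply: inab; rewrite lexx ltW.
- move=> x; rewrite in_itv /= => /andP[h1 h2].
  have /inab/dF[? <-] : a + e n <= x <= b - e n by rewrite !ltW.
  by rewrite derive1E.
Qed.

Lemma is_derive_subl_powR a r x : a < x ->
  is_derive x 1 (fun s => (s - a) `^ r) (r * (x - a) `^ (r - 1)).
Proof.
rewrite -subr_gt0 => xa0.
have d2 : is_derive x 1 (fun s : R => s - a) 1.
  by apply: is_derive_eq; rewrite subr0.
by have := @is_derive1_comp _ (fun s : R => s `^ r) (fun s : R => s - a) _ _ _ (is_derive1_powR r xa0) d2; rewrite mulr1.
Qed.

Lemma is_derive_subr_powR b r x : x < b ->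
  is_derive x 1 (fun s => (b - s) `^ r) (- (r * (b - x) `^ (r - 1))).
Proof.
rewrite -subr_gt0 => xb0.
have d2 : is_derive x 1 (fun s : R => b - s) (-1).
  by apply: is_derive_eq; rewrite add0r mul1r.
by have := @is_derive1_comp _ (fun s : R => s `^ r) (fun s : R => b - s) _ _ _ (is_derive1_powR r xb0) d2; rewrite mulrN1.
Qed.

Lemma continuous_subl_powR a r x : a < x -> {for x, continuous (fun s => (s - a) `^ r)}.
Proof.
move=> /(is_derive_subl_powR r)[d _].
by apply: differentiable_continuous; apply/derivable1_diffP.
Qed.

Lemma continuous_subr_powR b r x : x < b -> {for x, continuous (fun s => (b - s) `^ r)}.
Proof.
move=> /(is_derive_subr_powR r)[d _].
by apply: differentiable_continuous; apply/derivable1_diffP.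
Qed.

Let powR4 (r : R) : (1 / 4 * r `^ (1 / 4 - 1)) * 4 = r `^ (- (3 / 4)).
Proof.
rewrite mulrAC; have -> : 1 / 4 * 4 = 1 :> R by field.
by rewrite [LHS]mul1r; congr (_ `^ _); field.
Qed.

Lemma integral_subl_powR a b : a < b ->
  (\int[mu]_(s in `]a, b[) ((s - a) `^ (- (3 / 4)))%:E <= (4 * (b - a) `^ (1 / 4))%:E)%E.
Proof.
move=> ab; rewrite -[X in (_ <= X%:E)%E]subr0.
apply: (@ge0_integral_oo_le (fun s => (s - a) `^ (- (3 / 4)))
  (fun s => (s - a) `^ (1 / 4) * 4) a b 0 (4 * (b - a) `^ (1 / 4)) ab).
- by move=> x /andP[ax _]; exact: continuous_subl_powR.
- by move=> x _; exact: powR_ge0.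
- move=> x /andP[ax _]; rewrite -powR4.
  have d3 := is_derive_subl_powR (1 / 4) ax.
  have d4 := is_deriveM d3 (is_derive_cst (4 : R^o) x (1 : R)).
  apply: is_derive_eq d4 _.
  by rewrite scaler0 add0r [RHS]mulrC.
- move=> x /andP[ax xb]; rewrite mulr_ge0 ?powR_ge0 // mulrC ler_wpM2l //.
  by rewrite ge0_ler_powR // ?nnegrE ?subr_ge0 ?(ltW ax) ?(ltW ab) // lerB // ltW.
Qed.

Lemma integral_subr_powR a b : a < b ->
  (\int[mu]_(s in `]a, b[) ((b - s) `^ (- (3 / 4)))%:E <= (4 * (b - a) `^ (1 / 4))%:E)%E.
Proof.
move=> ab; rewrite -[X in (_ <= X%:E)%E]subr0.
(* The primitive -4(b - s)^(1/4) is shifted by a constant so as to lie between 0 and the bound. *)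
apply: (@ge0_integral_oo_le (fun s => (b - s) `^ (- (3 / 4)))
  (fun s => (4 * (b - a) `^ (1 / 4)) - (b - s) `^ (1 / 4) * 4) a b 0
  (4 * (b - a) `^ (1 / 4)) ab).
- by move=> x /andP[_ xb]; exact: continuous_subr_powR.
- by move=> x _; exact: powR_ge0.
- move=> x /andP[_ xb]; rewrite -powR4.
  have d3 := is_derive_subr_powR (1 / 4) xb.
  have d4 := is_deriveM d3 (is_derive_cst (4 : R^o) x (1 : R)).
  have d5 := is_deriveB (is_derive_cst (4 * (b - a) `^ (1 / 4) : R^o) x (1 : R)) d4.
  apply: is_derive_eq d5 _.
  by rewrite scaler0 !add0r [RHS]mulrC scalerN opprK.
- move=> x /andP[ax xb]; rewrite subr_ge0 lerBlDr lerDl mulr_ge0 ?powR_ge0 // andbT.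
  rewrite mulrC ler_wpM2l //.
  by rewrite ge0_ler_powR // ?nnegrE ?subr_ge0 ?(ltW xb) ?(ltW ab) // lerB // ltW.
Qed.

End time_integrals.

(** * Measurability of elementary functions and of parametric integrals *)

Section measurability.
Context {R : realType}.
Local Notation mu := (@lebesgue_measure R).

Lemma measurable_invr : measurable_fun [set: R] (@GRing.inv R).
Proof.
rewrite -(setvU [set (0 : R)]); apply/measurable_funU => //.
- exact: measurableC.
- split; last exact: measurable_fun_set1.
  apply: open_continuous_measurable_fun; first exact/closed_openC/accessible_closed_set1/hausdorff_accessible/Rhausdorff.
  move=> x; rewrite inE /= => /eqP x0; exact: inv_continuous.
Qed.

Lemma measurable_sqrtr : measurable_fun [set: R] (@Num.sqrt R).
Proof. by apply: continuous_measurable_fun; exact: sqrt_continuous. Qed.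

Lemma measurable_gaussT d (T : measurableType d) (c : R) (f g : T -> R) :
  measurable_fun [set: T] f -> measurable_fun [set: T] g ->
  measurable_fun [set: T] (fun z => gauss c (f z) (g z)).
Proof.
move=> mf mg; apply: measurableT_comp => //; apply: measurableT_comp => //.
apply: measurable_funM; last exact: measurableT_comp measurable_invr mg.
by apply: measurable_funM => //; exact: measurable_funX.
Qed.

(** No integrability is asked: the integral is the difference of those of the positive and negative
    parts, each measurable by Tonelli. *)
Lemma measurable_fun_integral d1 d2 (T1 : measurableType d1) (T2 : measurableType d2)
    (m2 : {sigma_finite_measure set T2 -> \bar R}) (f : T1 * T2 -> \bar R) :
  measurable_fun [set: T1 * T2] f ->
  measurable_fun [set: T1] (fun x => \int[m2]_y f (x, y))%E.
Proof.
move=> mf.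
have mp := measurable_fun_fubini_tonelli_F (m2 := m2) f^\+%E (measurable_funepos mf) (fun=> funepos_ge0 _ _).
have mn := measurable_fun_fubini_tonelli_F (m2 := m2) f^\-%E (measurable_funeneg mf) (fun=> funeneg_ge0 _ _).
apply: eq_measurable_fun (emeasurable_funB mp mn) => x _.
rewrite [RHS]integralE /fubini_F; congr (_ - _)%E; apply: eq_integral => y _; by rewrite ?funeposE ?funenegE.
Qed.

End measurability.

(** * Space-time convolution of two singular Gaussians *)

Section convolution.
Context {R : realType}.
Implicit Types (a b c p q r x y s t m M : R).
Local Notation mu := (@lebesgue_measure R).

Lemma powR_quarter p n : 0 <= p -> p `^ (n%:R / 4) = (p `^ (1 / 4)) ^+ n.
Proof.
by move=> p0; rewrite -powR_mulrn ?powR_ge0 // -powRrM; congr (_ `^ _); field.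
Qed.

Lemma powR_quarterK p : 0 <= p -> (p `^ (1 / 4)) ^+ 4 = p.
Proof. by move=> p0; rewrite -powR_quarter // divff // powRr1. Qed.

Lemma sqrt_quarter p : 0 <= p -> Num.sqrt p = (p `^ (1 / 4)) ^+ 2.
Proof.
by move=> p0; rewrite -powR_quarter // -powR12_sqrt //; congr (_ `^ _); field.
Qed.

(** In terms of a = p^(1/4) and b = q^(1/4) this is the polynomial inequality m(a^4 + b^4) <= (a^3 +
    b^3) a b^2 with m = min(a^2, b^2). It separates the factor 1/(p + q), constant when p + q = t -
    tau, from powers integrable in time. *)
Lemma parametrix_weight p q : 0 < p -> 0 < q ->
  p^-1 * q `^ (- (5 / 4)) * Num.min (Num.sqrt p) (Num.sqrt q) <=
  (p + q)^-1 * (q `^ (- (3 / 4)) + p `^ (- (3 / 4))).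
Proof.
move=> p0 q0.
have a0 : 0 < p `^ (1 / 4) by exact: powR_gt0.
have b0 : 0 < q `^ (1 / 4) by exact: powR_gt0.
rewrite !powRN !(@powR_quarter p) ?(ltW p0) // !(@powR_quarter q) ?(ltW q0) //.
rewrite (sqrt_quarter (ltW p0)) (sqrt_quarter (ltW q0)).
have -> : p^-1 = (p `^ (1 / 4) ^+ 4)^-1 by rewrite powR_quarterK // ltW.
have -> : p + q = p `^ (1 / 4) ^+ 4 + q `^ (1 / 4) ^+ 4 by rewrite !powR_quarterK // ltW.
move: (p `^ _) (q `^ _) a0 b0 => a b a0 b0.
have ab0 : 0 < a ^+ 4 + b ^+ 4 by rewrite addr_gt0 // exprn_gt0.
rewrite -subr_ge0.
set m := Num.min _ _.
have -> : (a ^+ 4 + b ^+ 4)^-1 * ((b ^+ 3)^-1 + (a ^+ 3)^-1) - (a ^+ 4)^-1 * (b ^+ 5)^-1 * m =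
  ((a ^+ 3 + b ^+ 3) * (a * b ^+ 2) - m * (a ^+ 4 + b ^+ 4))
     / (a ^+ 4 * b ^+ 5 * (a ^+ 4 + b ^+ 4)).
  by field; rewrite !gt_eqF.
apply: divr_ge0; last by rewrite !mulr_ge0 ?exprn_ge0 // ltW.
rewrite subr_ge0.
case: (leP a b) => ab.
- apply: (@le_trans _ _ (a ^+ 2 * (a ^+ 4 + b ^+ 4))).
    by rewrite ler_wpM2r ?(ltW ab0) // ge_min lexx.
  have -> : (a ^+ 3 + b ^+ 3) * (a * b ^+ 2) = a ^+ 2 * (a ^+ 2 * b ^+ 2) + a * b ^+ 5 by ring.
  have -> : a ^+ 2 * (a ^+ 4 + b ^+ 4) = a ^+ 2 * (a ^+ 2 * a ^+ 2) + a * (a * b ^+ 4) by ring.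
  rewrite lerD // ler_wpM2l ?(ltW a0) ?exprn_ge0 ?(ltW a0) //.
    by rewrite ler_wpM2l ?exprn_ge0 ?(ltW a0) // lerXn2r ?nnegrE // ltW.
  by rewrite (exprS b 4) ler_wpM2r ?exprn_ge0 // ltW.
- apply: (@le_trans _ _ (b ^+ 2 * (a ^+ 4 + b ^+ 4))).
    by rewrite ler_wpM2r ?(ltW ab0) // ge_min lexx orbT.
  rewrite [leRHS](_ : _ = b ^+ 2 * (a ^+ 4 + a * b ^+ 3)); last by ring.
  rewrite ler_wpM2l ?exprn_ge0 ?(ltW b0) // lerD2l (exprS b 3).
  by rewrite ler_wpM2r ?exprn_ge0 // ltW.
Qed.

(** Majorant of the integrand in the x-derivative of the correction term: the derivative of the heat
    kernel has size 1/(t - s) times a Gaussian, and the second line is the bound on [Phi]. *)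
Definition parametrix_kernel c x t xi tau s y :=
  (t - s)^-1 * gauss c (x - y) (t - s) *
    ((s - tau) `^ (- (5 / 4)) * gauss c (y - xi) (s - tau)).

Lemma measurable_parametrix_kernel c x t xi tau :
  measurable_fun [set: R * R] (fun z => parametrix_kernel c x t xi tau z.1 z.2).
Proof.
apply: measurable_funM; apply: measurable_funM.
- by apply: measurableT_comp; [exact: measurable_invr|exact: measurable_funB].
- by apply: measurable_gaussT; exact: measurable_funB.
- apply: (@measurableT_comp _ _ _ _ _ _ (fun r : R => r `^ (- (5 / 4)))).
    exact: measurable_powR.
  exact: measurable_funB.
- by apply: measurable_gaussT; exact: measurable_funB.
Qed.

Lemma parametrix_kernel_ge0 c x t xi tau s y : s <= t -> 0 <= parametrix_kernel c x t xi tau s y.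
Proof.
by move=> st; rewrite !mulr_ge0 ?gauss_ge0 ?powR_ge0 ?invr_ge0 ?subr_ge0.
Qed.

(** Half of each exponent yields, by [gauss_conv_le], the Gaussian in x - xi, which leaves the
    integral. Of the two remaining halves either one may be integrated in y, whence [i1] and [i2];
    their minimum tames both singularities, s = t and s = tau. *)
Lemma integral_parametrix_kernel_le c x t xi tau s : 0 < c -> tau < s < t ->
  (\int[mu]_y (parametrix_kernel c x t xi tau s y)%:E <=
   (Num.sqrt (2 * pi / c) * (t - tau)^-1 * gauss (c / 2) (x - xi) (t - tau) *
     ((s - tau) `^ (- (3 / 4)) + (t - s) `^ (- (3 / 4))))%:E)%E.
Proof.
move=> c0 /andP[ts st].
have p0 : 0 < t - s by rewrite subr_gt0.
have q0 : 0 < s - tau by rewrite subr_gt0.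
have c20 : 0 < c / 2 by rewrite divr_gt0.
have pq : t - tau = (t - s) + (s - tau) by ring.
pose A := (t - s)^-1 * (s - tau) `^ (- (5 / 4)) * gauss (c / 2) (x - xi) (t - tau).
have A0 : 0 <= A by rewrite !mulr_ge0 ?powR_ge0 ?gauss_ge0 ?invr_ge0 ?(ltW p0).
have mk : measurable_fun [set: R] (fun y => parametrix_kernel c x t xi tau s y).
  exact: (@measurableT_comp _ _ _ _ _ _ (fun z : R * R => parametrix_kernel c x t xi tau z.1 z.2)
    _ (pair s) (measurable_parametrix_kernel c x t xi tau) (pair1_measurable s)).
have bnd y : parametrix_kernel c x t xi tau s y <=
    A * gauss (c / 2) (x - y) (t - s) /\
  parametrix_kernel c x t xi tau s y <= A * gauss (c / 2) (y - xi) (s - tau).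
  have g1 := @gauss_conv_le _ (c / 2) (x - y) (y - xi) _ _ (ltW c20) p0 q0.
  rewrite -pq (_ : x - y + (y - xi) = x - xi) in g1; last by ring.
  have h1 := @gauss_le1 _ (c / 2) (y - xi) _ (ltW c20) q0.
  have h2 := @gauss_le1 _ (c / 2) (x - y) _ (ltW c20) p0.
  have k1 := gauss_ge0 (c / 2) (y - xi) (s - tau).
  have k2 := gauss_ge0 (c / 2) (x - y) (t - s).
  rewrite /parametrix_kernel /A (gauss_half c (x - y)) (gauss_half c (y - xi)).
  move: (gauss _ (x - y) _) (gauss _ (y - xi) _) (gauss _ (x - xi) _) g1 h1 h2 k1 k2.
  move=> u v w uvw v1 u1 v0 u0.
  set B := (t - s)^-1; set C := _ `^ _.
  have BC : 0 <= B * C by rewrite mulr_ge0 ?powR_ge0 ?invr_ge0 ?(ltW p0).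
  have -> : B * (u * u) * (C * (v * v)) = B * C * (u * v * (u * v)) by ring.
  rewrite -!(mulrA (B * C)); split; rewrite ler_wpM2l //.
    have : u * v <= u by rewrite ler_piMr.
    have : 0 <= u * v by rewrite mulr_ge0.
    by move: uvw u0; nra.
  have : u * v <= v by rewrite ler_piMl.
  have : 0 <= u * v by rewrite mulr_ge0.
  by move: uvw v0; nra.
have i1 : (\int[mu]_y (parametrix_kernel c x t xi tau s y)%:E <=
    (A * Num.sqrt (2 * pi / c * (t - s)))%:E)%E.
  apply: (@le_trans _ _ (\int[mu]_y (A * gauss (c / 2) (x - y) (t - s))%:E)%E).
    apply: ge0_le_integral => //.
    - by move=> y _; rewrite lee_fin parametrix_kernel_ge0 // ltW.
    - exact/measurable_EFinP.
    - apply/measurable_EFinP; apply: measurable_funM => //.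
      by apply: measurable_gaussT => //; exact: measurable_funB.
    - by move=> y _; rewrite lee_fin; have [] := bnd y.
  under eq_integral do rewrite EFinM.
  rewrite ge0_integralZl ?lee_fin //.
  - rewrite integral_gaussC // -EFinM lee_fin ler_wpM2l //.
    by rewrite le_eqVlt; apply/orP; left; apply/eqP; congr Num.sqrt; field; rewrite gt_eqF.
  - apply/measurable_EFinP.
    by apply: measurable_gaussT => //; exact: measurable_funB.
  - by move=> y _; rewrite lee_fin gauss_ge0.
have i2 : (\int[mu]_y (parametrix_kernel c x t xi tau s y)%:E <=
    (A * Num.sqrt (2 * pi / c * (s - tau)))%:E)%E.
  apply: (@le_trans _ _ (\int[mu]_y (A * gauss (c / 2) (y - xi) (s - tau))%:E)%E).
    apply: ge0_le_integral => //.
    - by move=> y _; rewrite lee_fin parametrix_kernel_ge0 // ltW.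
    - exact/measurable_EFinP.
    - apply/measurable_EFinP; apply: measurable_funM => //.
      by apply: measurable_gaussT => //; exact: measurable_funB.
    - by move=> y _; rewrite lee_fin; have [] := bnd y.
  under eq_integral do rewrite EFinM.
  rewrite ge0_integralZl ?lee_fin //.
  - rewrite integral_gauss // -EFinM lee_fin ler_wpM2l //.
    by rewrite le_eqVlt; apply/orP; left; apply/eqP; congr Num.sqrt; field; rewrite gt_eqF.
  - apply/measurable_EFinP.
    by apply: measurable_gaussT => //; exact: measurable_funB.
  - by move=> y _; rewrite lee_fin gauss_ge0.
have pc0 : 0 <= 2 * pi / c :> R by rewrite divr_ge0 ?mulr_ge0 ?pi_ge0 // ltW.
have : (\int[mu]_y (parametrix_kernel c x t xi tau s y)%:E <=
    (A * (Num.sqrt (2 * pi / c) * Num.min (Num.sqrt (t - s)) (Num.sqrt (s - tau))))%:E)%E.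
  by case: (leP (Num.sqrt (t - s)) (Num.sqrt (s - tau))) => _; rewrite -sqrtrM.
move=> /le_trans; apply; rewrite lee_fin.
have := parametrix_weight p0 q0; rewrite -pq.
set m := Num.min _ _; rewrite /A.
set C := (s - tau) `^ (- (5 / 4)); set D := (s - tau) `^ (- (3 / 4)) + _.
set g := gauss _ _ _; set K := Num.sqrt _ => h.
have -> : (t - s)^-1 * C * g * (K * m) = K * g * ((t - s)^-1 * C * m) by ring.
have -> : K * (t - tau)^-1 * g * D = K * g * ((t - tau)^-1 * D) by ring.
by rewrite ler_wpM2l // mulr_ge0 ?gauss_ge0 ?sqrtr_ge0.
Qed.

(** 8 = 4 + 4, from the time integrals of the two powers -3/4. *)
Definition conv_const c : R := 8 * Num.sqrt (2 * pi / c).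

Lemma conv_const_ge0 c : 0 <= conv_const c.
Proof. by rewrite mulr_ge0 // sqrtr_ge0. Qed.

Lemma integral2_parametrix_kernel_le c x t xi tau : 0 < c -> tau < t ->
  (\int[mu]_(s in `]tau, t[) \int[mu]_y (parametrix_kernel c x t xi tau s y)%:E <=
   (conv_const c * (t - tau) `^ (- (3 / 4)) * gauss (c / 2) (x - xi) (t - tau))%:E)%E.
Proof.
move=> c0 taut; have L0 : 0 < t - tau by rewrite subr_gt0.
pose B := Num.sqrt (2 * pi / c) * (t - tau)^-1 * gauss (c / 2) (x - xi) (t - tau).
have B0 : 0 <= B by rewrite !mulr_ge0 ?gauss_ge0 ?sqrtr_ge0 ?invr_ge0 ?(ltW L0).
have m1 : measurable_fun [set: R] (fun s => (s - tau) `^ (- (3 / 4))).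
  apply: (@measurableT_comp _ _ _ _ _ _ (fun r : R => r `^ (- (3 / 4)))).
    exact: measurable_powR.
  exact: measurable_funB.
have m2 : measurable_fun [set: R] (fun s => (t - s) `^ (- (3 / 4))).
  apply: (@measurableT_comp _ _ _ _ _ _ (fun r : R => r `^ (- (3 / 4)))).
    exact: measurable_powR.
  exact: measurable_funB.
apply: (@le_trans _ _ (\int[mu]_(s in `]tau, t[)
    (B%:E * ((s - tau) `^ (- (3 / 4)))%:E + B%:E * ((t - s) `^ (- (3 / 4)))%:E))%E).
  apply: ge0_le_integral => //.
  - move=> s; rewrite /= in_itv /= => /andP[_ st]; apply: integral_ge0 => y _.
    by rewrite lee_fin parametrix_kernel_ge0 // ltW.
  - apply: measurable_funTS.
    apply: (@measurable_fun_integral R _ _ _ _ lebesgue_measure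
      (fun z => (parametrix_kernel c x t xi tau z.1 z.2)%:E)).
    by apply/measurable_EFinP; exact: measurable_parametrix_kernel.
  - apply: measurable_funTS; apply: emeasurable_funD;
      by apply: measurable_funeM; exact/measurable_EFinP.
  - move=> s; rewrite /= in_itv /= => st.
    rewrite -!EFinM -EFinD -mulrDr; exact: integral_parametrix_kernel_le.
rewrite ge0_integralD //; last 4 first.
- by move=> s _; rewrite -EFinM lee_fin mulr_ge0 ?powR_ge0.
- by apply: measurable_funTS; apply: measurable_funeM; exact/measurable_EFinP.
- by move=> s _; rewrite -EFinM lee_fin mulr_ge0 ?powR_ge0.
- by apply: measurable_funTS; apply: measurable_funeM; exact/measurable_EFinP.
rewrite !ge0_integralZl ?lee_fin //; last 4 first.
- by apply: measurable_funTS; exact/measurable_EFinP.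
- by move=> s _; rewrite lee_fin powR_ge0.
- by apply: measurable_funTS; exact/measurable_EFinP.
- by move=> s _; rewrite lee_fin powR_ge0.
apply: (@le_trans _ _ (B%:E * (4 * (t - tau) `^ (1 / 4))%:E + B%:E * (4 * (t - tau) `^ (1 / 4))%:E)%E).
  apply: leeD; apply: lee_wpmul2l; rewrite ?lee_fin //.
  - exact: integral_subl_powR.
  - exact: integral_subr_powR.
rewrite -!EFinM -EFinD lee_fin /B /conv_const.
have -> : (t - tau) `^ (- (3 / 4)) = (t - tau)^-1 * (t - tau) `^ (1 / 4).
  rewrite -(powR_inv1 (ltW L0)) -powRD; last by apply/implyP => _; rewrite gt_eqF.
  by congr (_ `^ _); field.
by rewrite le_eqVlt; apply/orP; left; apply/eqP; ring.
Qed.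

End convolution.

(** * The heat kernel with constant coefficient *)

Section heat_kernel.
Context {R : realType}.
Implicit Types (c p r x y K kL kU : R).
Local Notation mu := (@lebesgue_measure R).

(** [frozen_heat] with the value of the coefficient as a number, so that it can be compared for two
    coefficients; the two are convertible. *)
Definition heat K r p : R :=
  expR (- (r ^+ 2 / (4 * K * p))) / (2 * Num.sqrt pi * Num.sqrt K * Num.sqrt p).

Lemma heatE K r p : heat K r p =
  (2 * Num.sqrt pi)^-1 * (Num.sqrt K)^-1 * (Num.sqrt p)^-1 * gauss (4 * K)^-1 r p.
Proof.
rewrite /heat /gauss !invfM mulrC; congr (_ * expR (- _)).
by ring.
Qed.

Lemma heat_ge0 K r p : 0 <= heat K r p.
Proof. by rewrite heatE !mulr_ge0 ?gauss_ge0 ?invr_ge0 ?mulr_ge0 ?sqrtr_ge0. Qed.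

Lemma measurable_heat d (T : measurableType d) (f g h : T -> R) :
  measurable_fun [set: T] f -> measurable_fun [set: T] g -> measurable_fun [set: T] h ->
  measurable_fun [set: T] (fun z => heat (f z) (g z) (h z)).
Proof.
move=> mf mg mh; apply: measurable_funM.
  apply: measurableT_comp => //; apply: measurableT_comp => //.
  apply: measurable_funM; first exact: measurable_funX.
  apply: measurableT_comp measurable_invr _.
  by apply: measurable_funM => //; exact: measurable_funM.
apply: measurableT_comp measurable_invr _.
apply: measurable_funM; last exact: measurableT_comp measurable_sqrtr mh.
by apply: measurable_funM => //; exact: measurableT_comp measurable_sqrtr mf.
Qed.

Lemma integral_heat K x p : 0 < K -> 0 < p ->
  (\int[mu]_y (heat K (x - y) p)%:E = 1)%E.
Proof.
move=> K0 p0; under eq_integral do rewrite heatE EFinM.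
have K40 : 0 < (4 * K)^-1 by rewrite invr_gt0 mulr_gt0.
rewrite ge0_integralZl ?lee_fin ?mulr_ge0 ?invr_ge0 ?mulr_ge0 ?sqrtr_ge0 //.
- rewrite integral_gaussC // -EFinM.
  have -> : pi * p / (4 * K)^-1 = 4 * (pi * (K * p)) by rewrite invrK; ring.
  rewrite sqrtrM // (sqrtrM _ (pi_ge0 R)) (sqrtrM _ (ltW K0)).
  have -> : Num.sqrt 4 = 2 :> R.
    by rewrite -[4]/((2 * 2)%:R) natrM -expr2 sqrtr_sqr ger0_norm.
  congr (_%:E); field.
  by rewrite !gt_eqF ?sqrtr_gt0 ?pi_gt0.
- by apply/measurable_EFinP; apply: measurable_gaussT => //; exact: measurable_funB.
- by move=> y _; rewrite lee_fin gauss_ge0.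
Qed.

(** (8 kU)^-1 is half of the smallest exponent of a heat kernel; the other half is what the two
    difference bounds below spend, and a common exponent is kept for all three. *)
Lemma heat_le kL kU : 0 < kL -> exists2 A : R, 0 <= A &
  forall K r p c, kL <= K <= kU -> 0 < p -> c <= (8 * kU)^-1 ->
    heat K r p <= A / Num.sqrt p * gauss c r p.
Proof.
move=> kL0; exists ((2 * Num.sqrt pi)^-1 * (Num.sqrt kL)^-1).
  by rewrite mulr_ge0 ?invr_ge0 ?mulr_ge0 ?sqrtr_ge0.
move=> K r p c /andP[kLK KkU] p0 cU; rewrite heatE.
have K0 : 0 < K by exact: lt_le_trans kLK.
apply: ler_pM; rewrite ?gauss_ge0 ?mulr_ge0 ?invr_ge0 ?mulr_ge0 ?sqrtr_ge0 //.
  rewrite ler_wpM2r ?invr_ge0 ?sqrtr_ge0 // ler_wpM2l ?invr_ge0 ?mulr_ge0 ?sqrtr_ge0 //.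
  by rewrite lef_pV2 ?posrE ?sqrtr_gt0 // ler_wsqrtr.
apply: le_gauss => //; apply: le_trans cU _.
rewrite lef_pV2 ?posrE ?mulr_gt0 //; last by exact: lt_le_trans KkU.
by lra.
Qed.

Lemma heat_diff_le kL kU : 0 < kL -> exists2 A : R, 0 <= A &
  forall K r r' p c, kL <= K <= kU -> 0 < p -> c <= (8 * kU)^-1 ->
    `|heat K r p - heat K r' p| <= A * `|r - r'| / p * (gauss c r p + gauss c r' p).
Proof.
move=> kL0.
(* [a] is the largest exponent (4K)^-1, so [B] dominates the constant of [gauss_diff_le] for every K
   in [kL, kU]. *)
pose a : R := (4 * kL)^-1.
pose B : R := 4 * (a + Num.sqrt a) + 1.
have a0 : 0 <= a by rewrite invr_ge0 mulr_ge0 // ltW.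
have B0 : 0 <= B by rewrite /B addr_ge0 // mulr_ge0 // addr_ge0 // sqrtr_ge0.
exists ((2 * Num.sqrt pi)^-1 * (Num.sqrt kL)^-1 * B).
  by rewrite !mulr_ge0 ?invr_ge0 ?mulr_ge0 ?sqrtr_ge0.
move=> K r r' p c /andP[kLK KkU] p0 cU; rewrite !heatE -mulrBr normrM.
have K0 : 0 < K by exact: lt_le_trans kLK.
have kU0 : 0 < kU by exact: lt_le_trans KkU.
have b0 : 0 < (4 * K)^-1 by rewrite invr_gt0 mulr_gt0.
have ba : (4 * K)^-1 <= a by rewrite lef_pV2 ?posrE ?mulr_gt0 // ler_wpM2l.
have p0' : 0 < Num.sqrt p by rewrite sqrtr_gt0.
rewrite ger0_norm; last by rewrite !mulr_ge0 ?invr_ge0 ?mulr_ge0 ?sqrtr_ge0.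
have e1 := gauss_diff_le r r' b0 p0.
have e2 : 4 * ((4 * K)^-1 + Num.sqrt (4 * K)^-1) + 1 <= B.
  by rewrite lerD2r ler_wpM2l // lerD // ler_wsqrtr.
have e3 s : gauss ((4 * K)^-1 / 2) s p <= gauss c s p.
  apply: le_gauss => //; apply: le_trans cU _.
  rewrite -invfM lef_pV2 ?posrE ?mulr_gt0 //; lra.
set D := `|_ - gauss _ _ _| in e1 |- *.
have e4 : D <= B * (`|r - r'| / Num.sqrt p) * (gauss c r p + gauss c r' p).
  apply: le_trans e1 _; apply: ler_pM.
  - rewrite mulr_ge0 ?divr_ge0 ?(ltW p0') //.
    by rewrite addr_ge0 // mulr_ge0 // addr_ge0 ?sqrtr_ge0 // ltW.
  - by rewrite addr_ge0 ?gauss_ge0.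
  - by rewrite ler_wpM2r // divr_ge0 // ltW.
  - by rewrite lerD.
have -> : (2 * Num.sqrt pi)^-1 * (Num.sqrt kL)^-1 * B * `|r - r'| / p *
    (gauss c r p + gauss c r' p) =
  (2 * Num.sqrt pi)^-1 * (Num.sqrt kL)^-1 * (Num.sqrt p)^-1 *
    (B * (`|r - r'| / Num.sqrt p) * (gauss c r p + gauss c r' p)).
  have -> : p^-1 = (Num.sqrt p)^-1 * (Num.sqrt p)^-1.
    by rewrite -invfM -expr2 sqr_sqrtr // ltW.
  by ring.
apply: ler_pM; [by rewrite !mulr_ge0 ?invr_ge0 ?mulr_ge0 ?sqrtr_ge0|by rewrite /D normr_ge0| |exact: e4].
rewrite ler_wpM2r ?invr_ge0 ?sqrtr_ge0 // ler_wpM2l ?invr_ge0 ?mulr_ge0 ?sqrtr_ge0 //.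
by rewrite lef_pV2 ?posrE ?sqrtr_gt0 // ler_wsqrtr.
Qed.

(** Convexity of the exponential gives the factor |a - b| r^2/p, and half of the Gaussian of
    exponent [m] absorbs r^2/p at the price 2/m. *)
Lemma gauss_diff_const_le m a b r p : 0 < m -> m <= a -> m <= b -> 0 < p ->
  `|gauss a r p - gauss b r p| <= `|a - b| * (2 / m) * gauss (m / 2) r p.
Proof.
move=> m0; wlog ab : a b / a <= b.
  move=> H ma mb p0; case: (leP a b) => [|/ltW] h; first exact: H.
  by rewrite distrC (distrC a); exact: H.
move=> ma mb p0; rewrite (distrC a) ger0_norm; last by rewrite subr_ge0 le_gauss.
rewrite (ger0_norm (x := b - a)) ?subr_ge0 //.
set X := r ^+ 2 / p.
have X0 : 0 <= X by apply: divr_ge0; [exact: sqr_ge0|exact: ltW].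
have gE c : gauss c r p = expR (- (c * X)) by rewrite /gauss /X mulrA.
have h1 : gauss a r p - gauss b r p <= gauss a r p * ((b - a) * X).
  have -> : gauss b r p = gauss a r p * expR (- ((b - a) * X)).
    by rewrite !gE -expRD; congr expR; ring.
  have := expR_ge1Dx (- ((b - a) * X)); set u := expR _.
  by have := gauss_ge0 a r p; nra.
apply: le_trans h1 _.
have h2 : gauss a r p <= gauss m r p by exact: le_gauss.
apply: (@le_trans _ _ (gauss m r p * ((b - a) * X))).
  by rewrite ler_wpM2r // mulr_ge0 // subr_ge0.
rewrite (gauss_half m).
have h3 : gauss (m / 2) r p * (m / 2 * X) <= 1.
  rewrite gE expRN mulrC ler_pdivrMr ?expR_gt0 // mul1r.
  by have := expR_ge1Dx (m / 2 * X); lra.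
have := gauss_ge0 (m / 2) r p; set g := gauss _ _ _ in h3 *; move=> g0.
have -> : g * g * ((b - a) * X) = (b - a) * (2 / m) * g * (g * (m / 2 * X)).
  by field; rewrite gt_eqF.
by rewrite ler_piMr // !mulr_ge0 ?subr_ge0 // invr_ge0 ltW.
Qed.

(** For replacing a coefficient frozen at xi by one frozen at x. *)
Lemma heat_diff_const_le kL kU : 0 < kL -> kL <= kU -> exists2 A : R, 0 <= A &
  forall K K' r p c, kL <= K <= kU -> kL <= K' <= kU -> 0 < p -> c <= (8 * kU)^-1 ->
    `|heat K r p - heat K' r p| <= A * `|K - K'| / Num.sqrt p * gauss c r p.
Proof.
move=> kL0 kLU.
have kU0 : 0 < kU by exact: lt_le_trans kLU.
pose sL := Num.sqrt kL; have sL0 : 0 < sL by rewrite sqrtr_gt0.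
(* First the Lipschitz constant of K^(-1/2) above kL; then, times the bound on K^(-1/2), that of
   (4K)^-1 and the factor 2/m of [gauss_diff_const_le] for m = (4 kU)^-1. *)
pose B := (2 * sL * kL)^-1 + sL^-1 * ((4 * kL ^+ 2)^-1 * (8 * kU)).
have B0 : 0 <= B.
  rewrite addr_ge0 ?invr_ge0 ?mulr_ge0 ?invr_ge0 ?mulr_ge0 ?exprn_ge0 ?(ltW sL0) ?(ltW kL0) //.
  exact: ltW.
exists ((2 * Num.sqrt pi)^-1 * B); first by rewrite mulr_ge0 // invr_ge0 mulr_ge0 ?sqrtr_ge0.
move=> K K' r p c /andP[kLK KkU] /andP[kLK' K'kU] p0 cU; rewrite !heatE.
have K0 : 0 < K by exact: lt_le_trans kLK.
have K'0 : 0 < K' by exact: lt_le_trans kLK'.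
set P := (2 * _)^-1; set q := (Num.sqrt p)^-1.
have P0 : 0 <= P by rewrite invr_ge0 mulr_ge0 ?sqrtr_ge0.
have q0 : 0 <= q by rewrite invr_ge0 sqrtr_ge0.
set s := Num.sqrt K; set s' := Num.sqrt K'.
have sLs : sL <= s by rewrite ler_wsqrtr.
have sLs' : sL <= s' by rewrite ler_wsqrtr.
have s0 : 0 < s by exact: lt_le_trans sLs.
have s'0 : 0 < s' by exact: lt_le_trans sLs'.
have sL2 : sL ^+ 2 = kL by rewrite sqr_sqrtr // ltW.
have s2 : s ^+ 2 = K by rewrite sqr_sqrtr // ltW.
have s'2 : s' ^+ 2 = K' by rewrite sqr_sqrtr // ltW.
set g := gauss _ r p; set g' := gauss _ r p.
have hU : (8 * kU)^-1 = (4 * kU)^-1 / 2 by rewrite -invfM; congr (_^-1); ring.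
have gc : gauss ((4 * kU)^-1 / 2) r p <= gauss c r p by apply: le_gauss => //; rewrite -hU.
have i4 k' : kL <= k' -> k' <= kU -> (4 * kU)^-1 <= (4 * k')^-1.
  move=> h1 h2; have k'0 : 0 < k' by exact: lt_le_trans h1.
  by rewrite lef_pV2 ?posrE ?mulr_gt0 // ler_wpM2l.
have d1 : `|s^-1 - s'^-1| <= (2 * sL * kL)^-1 * `|K - K'|.
  have -> : s^-1 - s'^-1 = (s * s' * (s + s'))^-1 * (K' - K).
    by rewrite -s2 -s'2; field; rewrite !gt_eqF // addr_gt0.
  rewrite normrM distrC ler_wpM2r // ger0_norm ?invr_ge0 ?mulr_ge0 ?addr_ge0 ?(ltW s0) ?(ltW s'0) //.
  rewrite lef_pV2 ?posrE ?mulr_gt0 ?addr_gt0 // -sL2.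
  have -> : 2 * sL * sL ^+ 2 = sL * sL * (sL + sL) by ring.
  apply: ler_pM; rewrite ?mulr_ge0 ?addr_ge0 ?(ltW sL0) //; last by rewrite lerD.
  by apply: ler_pM; rewrite ?(ltW sL0).
have d2 : `|g - g'| <= `|K - K'| * ((4 * kL ^+ 2)^-1 * (8 * kU)) * gauss c r p.
  have m0 : 0 < (4 * kU)^-1 by rewrite invr_gt0 mulr_gt0.
  apply: le_trans (gauss_diff_const_le _ m0 (i4 _ kLK KkU) (i4 _ kLK' K'kU) p0) _.
  apply: ler_pM => //; rewrite ?gauss_ge0 ?mulr_ge0 ?invr_ge0 ?invrK ?mulr_ge0 ?(ltW kU0) //.
  have -> : (4 * K)^-1 - (4 * K')^-1 = (4 * (K * K'))^-1 * (K' - K).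
    by field; rewrite !gt_eqF.
  rewrite normrM (distrC K') mulrC mulrA mulrAC (mulrC (2 * _)) -mulrA mulrCA.
  rewrite [leLHS](_ : _ = `|K - K'| * (`|(4 * (K * K'))^-1| * (8 * kU))); last by ring.
  rewrite ler_wpM2l // ler_wpM2r ?mulr_ge0 ?(ltW kU0) //.
  rewrite ger0_norm ?invr_ge0 ?mulr_ge0 ?(ltW K0) ?(ltW K'0) //.
  rewrite lef_pV2 ?posrE ?mulr_gt0 ?exprn_gt0 // ler_wpM2l // expr2.
  by apply: ler_pM; rewrite ?(ltW kL0).
have -> : P * s^-1 * q * g - P * s'^-1 * q * g' =
    P * q * ((s^-1 - s'^-1) * g + s'^-1 * (g - g')) by ring.
rewrite normrM ger0_norm ?mulr_ge0 //.
rewrite [leRHS](_ : _ = P * q * (B * `|K - K'| * gauss c r p)); last first.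
  by rewrite -/q; ring.
rewrite ler_wpM2l ?mulr_ge0 // (le_trans (ler_normD _ _)) // !normrM.
rewrite /B mulrDl mulrDl; apply: lerD.
  apply: ler_pM => //; rewrite /g ger0_norm ?gauss_ge0 //.
  apply: le_gauss => //; apply: le_trans cU _; rewrite hU.
  apply: le_trans (i4 _ kLK KkU); rewrite ler_pdivrMr // ler_peMr ?ler1n //.
  by rewrite invr_ge0 mulr_ge0 // ltW.
rewrite -!mulrA; apply: ler_pM => //.
  by rewrite ger0_norm ?invr_ge0 ?(ltW s'0) // lef_pV2 ?posrE.
apply: le_trans d2 _; rewrite le_eqVlt; apply/orP; left; apply/eqP; ring.
Qed.

End heat_kernel.

Section measurable_uncurried.
Context d (U : measurableType d) {R : realType}.

Lemma measurable_fun2 (f : R -> R -> R) (g1 g2 : U -> R) :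
  measurable_fun [set: R * R] (fun z => f z.1 z.2) ->
  measurable_fun [set: U] g1 -> measurable_fun [set: U] g2 ->
  measurable_fun [set: U] (fun u => f (g1 u) (g2 u)).
Proof.
move=> mf m1 m2.
exact: (@measurableT_comp _ _ _ _ _ _ (fun z : R * R => f z.1 z.2) _
  (fun u => (g1 u, g2 u)) mf (measurable_fun_pair m1 m2)).
Qed.

Lemma measurable_fun4 (f : R -> R -> R -> R -> R) (g1 g2 g3 g4 : U -> R) :
  measurable_fun [set: (R * R) * (R * R)] (fun z => f z.1.1 z.1.2 z.2.1 z.2.2) ->
  measurable_fun [set: U] g1 -> measurable_fun [set: U] g2 ->
  measurable_fun [set: U] g3 -> measurable_fun [set: U] g4 ->
  measurable_fun [set: U] (fun u => f (g1 u) (g2 u) (g3 u) (g4 u)).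
Proof.
move=> mf m1 m2 m3 m4.
exact: (@measurableT_comp _ _ _ _ _ _
  (fun z : (R * R) * (R * R) => f z.1.1 z.1.2 z.2.1 z.2.2) _
  (fun u => ((g1 u, g2 u), (g3 u, g4 u))) mf
  (measurable_fun_pair (measurable_fun_pair m1 m2) (measurable_fun_pair m3 m4))).
Qed.

End measurable_uncurried.

(** * Real-valued iterated integrals under a majorant *)

Section iterated_Rintegral.
Context {R : realType}.
Local Notation mu := (@lebesgue_measure R).

Lemma measurable_sectionr (N : R -> R -> R) s :
  measurable_fun [set: R * R] (fun z => N z.1 z.2) -> measurable_fun [set: R] (N s).
Proof.
move=> mN.
exact: (@measurableT_comp _ _ _ _ _ _ (fun z : R * R => N z.1 z.2) _ (pair s) mN (pair1_measurable s)).
Qed.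

(** A real-valued integral carries no information when it diverges, so the integrability of both
    stages is returned with the bound; linearity of the iterated integral needs it. *)
Lemma Rintegral2_le (D : set R) (N G : R -> R -> R) (M : R) :
  measurable D ->
  measurable_fun [set: R * R] (fun z => N z.1 z.2) ->
  measurable_fun [set: R * R] (fun z => G z.1 z.2) ->
  (forall s, D s -> forall y, `|N s y| <= G s y) ->
  (forall s, D s -> (\int[mu]_y (G s y)%:E < +oo)%E) ->
  (\int[mu]_(s in D) \int[mu]_y (G s y)%:E <= M%:E)%E ->
  [/\ forall s, D s -> mu.-integrable setT (EFin \o N s),
      mu.-integrable D (EFin \o (fun s => \int[mu]_y N s y)) &
      `|\int[mu]_(s in D) \int[mu]_y N s y| <= M].
Proof.
move=> mD mN mG NG Gfin GM.
have G0 s y : D s -> 0 <= G s y by move=> Ds; apply: le_trans (NG s Ds y).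
have iN s : D s -> mu.-integrable setT (EFin \o N s).
  move=> Ds; apply/integrableP; split.
    by apply/measurable_EFinP; exact: measurable_sectionr.
  apply: le_lt_trans (Gfin s Ds); apply: ge0_le_integral => //.
  - apply: measurableT_comp => //; apply/measurable_EFinP; exact: measurable_sectionr.
  - by apply/measurable_EFinP; exact: measurable_sectionr.
  - by move=> y _; rewrite /= lee_fin NG.
have mI : measurable_fun [set: R] (fun s => \int[mu]_y (N s y)%:E)%E.
  apply: (@measurable_fun_integral R _ _ _ _ lebesgue_measure (fun z => (N z.1 z.2)%:E)).
  exact/measurable_EFinP.
have mJ : measurable_fun [set: R] (fun s => \int[mu]_y (G s y)%:E)%E.
  apply: (@measurable_fun_integral R _ _ _ _ lebesgue_measure (fun z => (G z.1 z.2)%:E)).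
  exact/measurable_EFinP.
have IJ s : D s -> (`|(\int[mu]_y N s y)%:E| <= \int[mu]_y (G s y)%:E)%E.
  move=> Ds; rewrite /= EFin_normr_Rintegral //; last exact: iN.
  apply: le_trans (le_abse_integral _ _ _) _ => //.
    by apply/measurable_EFinP; exact: measurable_sectionr.
  apply: ge0_le_integral => //.
  - apply: measurableT_comp => //; apply/measurable_EFinP; exact: measurable_sectionr.
  - by apply/measurable_EFinP; exact: measurable_sectionr.
  - by move=> y _; rewrite /= lee_fin NG.
have mF : measurable_fun D (EFin \o (fun s => \int[mu]_y N s y)).
  apply/measurable_EFinP; apply: measurable_funTS.
  exact: measurableT_comp (fine_measurable measurableT) mI.
have intle : (\int[mu]_(s in D) `|(\int[mu]_y N s y)%:E| <= M%:E)%E.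
  apply: le_trans GM; apply: ge0_le_integral => //.
  - by apply: measurableT_comp.
  - exact: measurable_funTS.
have iF : mu.-integrable D (EFin \o (fun s => \int[mu]_y N s y)).
  by apply/integrableP; split => //; apply: le_lt_trans intle _; rewrite ltry.
split => //.
rewrite -lee_fin EFin_normr_Rintegral //.
by apply: le_trans intle; apply: le_abse_integral.
Qed.

End iterated_Rintegral.

(** * Bounds on the fundamental solution *)

Section fundamental_solution_bounds.
Context {R : realType} (T kL kU C c : R) (k : R -> R -> R) (Phi : R -> R -> R -> R -> R).
Local Notation mu := (@lebesgue_measure R).

(* The data extended from the strip to all points and times, so that every
   integrand is globally measurable and bounded; see [admissible_extend]. *)
Definition admissible : Prop :=
  [/\ measurable_fun [set: R * R] (fun z => k z.1 z.2) /\
      measurable_fun [set: (R * R) * (R * R)] (fun z => Phi z.1.1 z.1.2 z.2.1 z.2.2),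
      0 < T, 0 < kL /\ (forall x t, kL <= k x t <= kU),
      [/\ 0 < c, c <= (8 * kU)^-1 & 0 <= C] &
      forall y s xi tau, tau < s ->
        `|Phi y s xi tau| <= C * (s - tau) `^ (- (5 / 4)) * gauss c (y - xi) (s - tau)].

Context (adm : admissible).

Definition correction x t xi tau : R :=
  \int[mu]_(s in `]tau, t[) \int[mu]_y (heat (k y s) (x - y) (t - s) * Phi y s xi tau).

Lemma GammaE x t xi tau :
  Gamma k Phi x t xi tau = heat (k xi tau) (x - xi) (t - tau) + correction x t xi tau.
Proof. by []. Qed.

Lemma measurable_Gamma :
  measurable_fun [set: (R * R) * (R * R)] (fun z => Gamma k Phi z.1.1 z.1.2 z.2.1 z.2.2).
Proof.
case: adm => -[mk mPhi] _ _ _ _.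
have m11 : measurable_fun [set: (R * R) * (R * R)] (fun z => z.1.1) by exact: measurableT_comp.
have m12 : measurable_fun [set: (R * R) * (R * R)] (fun z => z.1.2) by exact: measurableT_comp.
have m21 : measurable_fun [set: (R * R) * (R * R)] (fun z => z.2.1) by exact: measurableT_comp.
have m22 : measurable_fun [set: (R * R) * (R * R)] (fun z => z.2.2) by exact: measurableT_comp.
apply: measurable_funD.
  by apply: measurable_heat; [exact: measurable_fun2|exact: measurable_funB|exact: measurable_funB].
pose S := (((R * R) * (R * R)) * R)%type.
pose N (w : S * R) : R :=
  heat (k w.2 w.1.2) (w.1.1.1.1 - w.2) (w.1.1.1.2 - w.1.2) * Phi w.2 w.1.2 w.1.1.2.1 w.1.1.2.2.
have mN : measurable_fun [set: S * R] N.
  have n1 : measurable_fun [set: S * R] (fun w => w.1.1) by exact: measurableT_comp.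
  have n2 : measurable_fun [set: S * R] (fun w => w.1.2) by exact: measurableT_comp.
  have n11 : measurable_fun [set: S * R] (fun w => w.1.1.1.1) by exact: measurableT_comp m11 n1.
  have n12 : measurable_fun [set: S * R] (fun w => w.1.1.1.2) by exact: measurableT_comp m12 n1.
  have n21 : measurable_fun [set: S * R] (fun w => w.1.1.2.1) by exact: measurableT_comp m21 n1.
  have n22 : measurable_fun [set: S * R] (fun w => w.1.1.2.2) by exact: measurableT_comp m22 n1.
  apply: measurable_funM.
    by apply: measurable_heat; [exact: measurable_fun2|exact: measurable_funB|exact: measurable_funB].
  exact: measurable_fun4.
pose I (w : S) : R := (fine (\int[mu]_y (N (w, y))%:E)%E).
have mI : measurable_fun [set: S] I.
  apply: measurableT_comp (fine_measurable measurableT) _.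
  apply: (@measurable_fun_integral R _ _ _ _ lebesgue_measure (fun z => (N z)%:E)).
  exact/measurable_EFinP.
(* The interval ]tau, t[ of the integral in s moves with the point; it becomes a restriction to the
   measurable set [E], the integral then being over the whole line. *)
pose E := [set w : S | w.1.2.2 < w.2 < w.1.1.2].
have mE : measurable E.
  have h : measurable_fun [set: S] (fun w : S => (w.1.2.2 < w.2) && (w.2 < w.1.1.2)).
    apply: measurable_and; apply: measurable_fun_ltr => //.
    - exact: measurableT_comp m22 measurable_fst.
    - exact: measurableT_comp m12 measurable_fst.
  have := h measurableT [set true] _; rewrite setTI; apply => //.
have mIE : measurable_fun [set: S] (I \_ E).
  exact: (iffLR (measurable_restrictT I mE) (measurable_funTS mI)).
have := @measurable_fun_integral R _ _ _ _ lebesgue_measure (fun z : S => ((I \_ E) z)%:E).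
move=> /(_ (proj2 (measurable_EFinP _ _) mIE)).
move=> /(measurableT_comp (fine_measurable measurableT)).
apply: eq_measurable_fun => z _ /=.
rewrite /correction /Rintegral [in RHS]integral_mkcond; congr fine.
apply: eq_integral => s _; rewrite !patchE /E /=.
case: ifPn; rewrite ?inE ?notin_setE /= => h; case: ifPn; rewrite ?inE ?notin_setE /= ?in_itv //.
Qed.

Let cPos : 0 < c. Proof. by case: adm => _ _ _ []. Qed.

Lemma measurable_integrand x t xi tau :
  measurable_fun [set: R * R]
    (fun z => heat (k z.2 z.1) (x - z.2) (t - z.1) * Phi z.2 z.1 xi tau).
Proof.
case: adm => -[mk mPhi] _ _ _ _.
apply: measurable_funM.
  by apply: measurable_heat; [exact: measurable_fun2|exact: measurable_funB|exact: measurable_funB].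
by apply: measurable_fun4.
Qed.

(** Two base points, so that one lemma serves the correction term (with x = x') and its
    increments. *)
Lemma majorized_Rintegral2 (N : R -> R -> R) B x x' t xi tau :
  tau < t -> 0 <= B ->
  measurable_fun [set: R * R] (fun z => N z.1 z.2) ->
  (forall s, tau < s < t -> forall y, `|N s y| <=
    B * (parametrix_kernel c x t xi tau s y + parametrix_kernel c x' t xi tau s y)) ->
  [/\ forall s, `]tau, t[%classic s -> mu.-integrable setT (EFin \o N s),
      mu.-integrable `]tau, t[ (EFin \o (fun s => \int[mu]_y N s y)) &
      `|\int[mu]_(s in `]tau, t[) \int[mu]_y N s y| <=
        B * conv_const c * (t - tau) `^ (- (3 / 4)) *
          (gauss (c / 2) (x - xi) (t - tau) + gauss (c / 2) (x' - xi) (t - tau))].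
Proof.
move=> taut B0 mN NB.
have mK z : measurable_fun [set: R * R] (fun w => (parametrix_kernel c z t xi tau w.1 w.2)%:E).
  by apply/measurable_EFinP; exact: measurable_parametrix_kernel.
have mKs z s : measurable_fun [set: R] (fun y => (parametrix_kernel c z t xi tau s y)%:E).
  apply/measurable_EFinP; apply: (@measurable_sectionr _ (parametrix_kernel c z t xi tau)).
  exact: measurable_parametrix_kernel.
have mKi z : measurable_fun [set: R] (fun s => \int[mu]_y (parametrix_kernel c z t xi tau s y)%:E)%E.
  exact: (@measurable_fun_integral R _ _ _ _ lebesgue_measure
           (fun w => (parametrix_kernel c z t xi tau w.1 w.2)%:E) (mK z)).
have K0 z s y : s < t -> (0 <= (parametrix_kernel c z t xi tau s y)%:E)%E.
  by move=> st; rewrite lee_fin parametrix_kernel_ge0 // ltW.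
pose G s y := B * (parametrix_kernel c x t xi tau s y + parametrix_kernel c x' t xi tau s y).
have GE s : s < t -> (\int[mu]_y (G s y)%:E =
    B%:E * (\int[mu]_y (parametrix_kernel c x t xi tau s y)%:E +
            \int[mu]_y (parametrix_kernel c x' t xi tau s y)%:E))%E.
  move=> st; under eq_integral do rewrite EFinM EFinD.
  rewrite ge0_integralZl ?lee_fin //.
  - by rewrite ge0_integralD //; first [exact: mKs|move=> y _; exact: K0].
  - exact: (emeasurable_funD (mKs x s) (mKs x' s)).
  - by move=> y _; rewrite adde_ge0 ?K0.
apply: (Rintegral2_le _ mN (G := G)) => //.
- apply: measurable_funM => //; apply: measurable_funD; exact: measurable_parametrix_kernel.
- move=> s; rewrite /= in_itv /= => /andP[ts st]; rewrite GE //.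
  have h z := integral_parametrix_kernel_le z xi cPos (introT andP (conj ts st)).
  by rewrite ltey_eq fin_numM // fin_numD !ge0_fin_numE ?integral_ge0 ?(le_lt_trans (h _)) ?ltry // => y _; exact: K0.
- apply: (@le_trans _ _ (\int[mu]_(s in `]tau, t[)
    (B%:E * (\int[mu]_y (parametrix_kernel c x t xi tau s y)%:E +
            \int[mu]_y (parametrix_kernel c x' t xi tau s y)%:E)))%E).
    rewrite le_eqVlt; apply/orP; left; apply/eqP; apply: eq_integral => s.
    by rewrite inE /= in_itv /= => /andP[_ st]; exact: GE.
  have I0 z s : `]tau, t[%classic s -> (0 <= \int[mu]_y (parametrix_kernel c z t xi tau s y)%:E)%E.
    by rewrite /= in_itv /= => /andP[_ st]; apply: integral_ge0 => y _; exact: K0.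
  rewrite ge0_integralZl ?lee_fin //.
  - rewrite ge0_integralD //; try exact: I0; try exact: (measurable_funTS (mKi _)).
    set g := gauss _ _ _; set g' := gauss _ _ _; set w := _ `^ _.
    have -> : B * conv_const c * w * (g + g') = B * (conv_const c * w * g + conv_const c * w * g') by ring.
    rewrite EFinM lee_wpmul2l ?lee_fin // EFinD.
    by apply: leeD; exact: integral2_parametrix_kernel_le.
  - exact: (measurable_funTS (emeasurable_funD (mKi x) (mKi x'))).
  - by move=> s Ds; rewrite adde_ge0 ?I0.
Qed.

(** The heat kernel has only the singularity (t - s)^(-1/2); the factor sqrt(t - tau) pays for using
    the kernel with 1/(t - s) here too. *)
Lemma integrand_majorized : exists2 A : R, 0 <= A & forall x t xi tau s y, tau < s < t ->
  `|heat (k y s) (x - y) (t - s) * Phi y s xi tau| <=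
    A * Num.sqrt (t - tau) * parametrix_kernel c x t xi tau s y.
Proof.
case: adm => _ T0 [kL0 kb] [c0 ckU C0] bPhi.
have [A A0 hA] := heat_le kU kL0; exists (A * C); first exact: mulr_ge0.
move=> x t xi tau s y /andP[ts st].
have p0 : 0 < t - s by rewrite subr_gt0.
have sp0 : 0 < Num.sqrt (t - s) by rewrite sqrtr_gt0.
rewrite normrM (ger0_norm (heat_ge0 _ _ _)).
apply: le_trans (ler_pM (heat_ge0 _ _ _) (normr_ge0 _) (hA _ (x - y) _ c (kb y s) p0 ckU) (bPhi _ _ _ _ ts)) _.
rewrite /parametrix_kernel; set g := gauss _ _ _; set g' := gauss _ _ _; set w := _ `^ _.
have -> : A / Num.sqrt (t - s) * g * (C * w * g') = A * C * (g * (w * g')) * (Num.sqrt (t - s))^-1 by ring.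
have -> : A * C * Num.sqrt (t - tau) * ((t - s)^-1 * g * (w * g')) =
  A * C * (g * (w * g')) * (Num.sqrt (t - tau) / (t - s)) by ring.
rewrite ler_wpM2l ?mulr_ge0 ?gauss_ge0 ?powR_ge0 //.
rewrite ler_pdivlMr //.
have -> : (Num.sqrt (t - s))^-1 * (t - s) = Num.sqrt (t - s).
  by rewrite -{2}(sqr_sqrtr (ltW p0)); field; rewrite gt_eqF.
by rewrite ler_wsqrtr // lerD2l lerN2 ltW.
Qed.

Lemma integrand_diff_majorized : exists2 A : R, 0 <= A & forall x x' t xi tau s y, tau < s < t ->
  `|heat (k y s) (x - y) (t - s) * Phi y s xi tau - heat (k y s) (x' - y) (t - s) * Phi y s xi tau| <=
    A * `|x - x'| *
      (parametrix_kernel c x t xi tau s y + parametrix_kernel c x' t xi tau s y).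
Proof.
case: adm => _ T0 [kL0 kb] [c0 ckU C0] bPhi.
have [A A0 hA] := heat_diff_le kU kL0; exists (A * C); first exact: mulr_ge0.
move=> x x' t xi tau s y /andP[ts st].
have p0 : 0 < t - s by rewrite subr_gt0.
rewrite -mulrBl normrM.
apply: le_trans (ler_pM (normr_ge0 _) (normr_ge0 _)
  (hA _ (x - y) (x' - y) _ c (kb y s) p0 ckU) (bPhi _ _ _ _ ts)) _.
rewrite (_ : x - y - (x' - y) = x - x'); last by ring.
by rewrite /parametrix_kernel le_eqVlt; apply/orP; left; apply/eqP; ring.
Qed.

Lemma correction_le : exists2 A : R, 0 <= A & forall x t xi tau, tau < t ->
  `|correction x t xi tau| <=
    A * (t - tau) `^ (- (1 / 4)) * gauss (c / 2) (x - xi) (t - tau).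
Proof.
have [A A0 hA] := integrand_majorized.
exists (A * conv_const c); first by rewrite mulr_ge0 // conv_const_ge0.
move=> x t xi tau taut.
have L0 : 0 < t - tau by rewrite subr_gt0.
(* The constant is halved because the two base points coincide and the majorant is counted twice. *)
have [||_ _ h] := @majorized_Rintegral2
  (fun s y => heat (k y s) (x - y) (t - s) * Phi y s xi tau) (A * Num.sqrt (t - tau) / 2) x x t xi tau taut _
  (measurable_integrand x t xi tau).
- by rewrite !mulr_ge0 ?sqrtr_ge0.
- move=> s ts y; apply: le_trans (hA _ _ _ _ _ _ ts) _.
  by rewrite le_eqVlt; apply/orP; left; apply/eqP; field.
- apply: le_trans h _.
  have -> : (t - tau) `^ (- (1 / 4)) = Num.sqrt (t - tau) * (t - tau) `^ (- (3 / 4)).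
    rewrite -powR12_sqrt ?(ltW L0) // -powRD; last by apply/implyP => _; rewrite gt_eqF.
    by congr (_ `^ _); field.
  by rewrite le_eqVlt; apply/orP; left; apply/eqP; field.
Qed.

Lemma correction_diff_le : exists2 A : R, 0 <= A & forall x x' t xi tau, tau < t ->
  `|correction x t xi tau - correction x' t xi tau| <=
    A * `|x - x'| * (t - tau) `^ (- (3 / 4)) *
      (gauss (c / 2) (x - xi) (t - tau) + gauss (c / 2) (x' - xi) (t - tau)).
Proof.
have [A A0 hA] := integrand_diff_majorized.
have [A1 A10 hA1] := integrand_majorized.
exists (A * conv_const c); first by rewrite mulr_ge0 // conv_const_ge0.
move=> x x' t xi tau taut.
(* Integrability in y and then in s, for each base point, turns the difference of the two
   corrections into one iterated integral. *)
have i1 z : [/\ forall s, `]tau, t[%classic s ->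
      mu.-integrable setT (EFin \o (fun y => heat (k y s) (z - y) (t - s) * Phi y s xi tau)) &
    mu.-integrable `]tau, t[ (EFin \o (fun s =>
      \int[mu]_y (heat (k y s) (z - y) (t - s) * Phi y s xi tau)))].
  have [||j1 j2 _] := @majorized_Rintegral2
    (fun s y => heat (k y s) (z - y) (t - s) * Phi y s xi tau) (A1 * Num.sqrt (t - tau) / 2) z z t xi tau taut _
    (measurable_integrand z t xi tau); last by split.
  - by rewrite !mulr_ge0 ?sqrtr_ge0.
  - move=> s ts y; apply: le_trans (hA1 _ _ _ _ _ _ ts) _.
    by rewrite le_eqVlt; apply/orP; left; apply/eqP; field.
have [ix jx] := i1 x; have [ix' jx'] := i1 x'.
have [|||_ _] := @majorized_Rintegral2
  (fun s y => heat (k y s) (x - y) (t - s) * Phi y s xi tau -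
     heat (k y s) (x' - y) (t - s) * Phi y s xi tau) (A * `|x - x'|) x x' t xi tau taut _ _.
- by rewrite mulr_ge0.
- by apply: measurable_funB; exact: measurable_integrand.
- by move=> s ts y; exact: hA.
rewrite (_ : \int[mu]_(s in _) _ = correction x t xi tau - correction x' t xi tau).
  move=> h; apply: le_trans h _.
  by rewrite le_eqVlt; apply/orP; left; apply/eqP; ring.
rewrite -RintegralB //; apply: eq_Rintegral => s; rewrite inE => Ds.
by rewrite RintegralB //; [exact: ix|exact: ix'].
Qed.

End fundamental_solution_bounds.

(** * Maximum principle and conservation of mass *)

Section derivative_tests.
Context {R : realType}.
Implicit Types (A : set R) (f g : R -> R) (x y z s t l a m r : R).

Lemma derivative_withinP A g t l : derivative_within A g t l ->
  forall e, 0 < e -> exists2 del, 0 < del &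
    forall s, A s -> s != t -> `|s - t| < del -> `|(g s - g t) / (s - t) - l| < e.
Proof.
move=> h e e0; have /cvgrPdist_lt/(_ e e0) := h.
rewrite /within /dnbhs /within /= => /nbhs_ballP[del /= del0 hd].
exists del => // s As st sd; rewrite distrC; apply: hd => //=.
by rewrite /ball /= distrC.
Qed.

Lemma is_derive1P f x l : is_derive x 1 f l ->
  forall e, 0 < e -> exists2 del, 0 < del &
    forall z, z != x -> `|z - x| < del -> `|(f z - f x) / (z - x) - l| < e.
Proof.
move=> [df <-] e e0.
have /cvgrPdist_lt/(_ e e0) : h^-1 *: (f (h *: (1 : R) + x) - f x) @[h --> 0^'] --> 'D_1 f x.
  exact: df.
rewrite /dnbhs /within /= => /nbhs_ballP[del /= del0 hd].
exists del => // z zx zd; rewrite distrC.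
have := hd (z - x); rewrite /ball /= sub0r normrN => /(_ zd).
rewrite subr_eq0 => /(_ zx); rewrite /GRing.scale /= mulr1 subrK.
by rewrite (mulrC (z - x)^-1).
Qed.

(** [g] vanishes at x; if its derivative there were positive, [g] would be positive just to the
    right of x, and the mean value theorem would give a larger value of [f]. *)
Lemma second_derivative_at_max f g x l r : 0 < r ->
  (forall z, is_derive z 1 f (g z)) -> is_derive x 1 g l ->
  (forall z, `|z - x| < r -> f z <= f x) -> l <= 0.
Proof.
move=> r0 df dg fx; rewrite leNgt; apply/negP => l0.
have gx0 : g x = 0.
  have [_ <-] := df x.
  suff [_ ->] : is_derive x 1 f 0 by [].
  apply: (@derive1_at_max _ _ (x - r) (x + r)); first by lra.
  - by move=> z _; have [] := df z.
  - by rewrite in_itv /=; lra.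
  - by move=> z; rewrite in_itv /= => /andP[h1 h2]; apply: fx; rewrite ltr_norml; lra.
have l20 : 0 < l / 2 by rewrite divr_gt0.
have [del del0 hd] := is_derive1P dg l20.
pose h := Num.min r del / 2.
have h0 : 0 < h by rewrite divr_gt0 // lt_min r0.
have [hr hdel] : h < r /\ h < del.
  have m0 : 0 < Num.min r del by rewrite lt_min r0.
  have h1 : Num.min r del <= r by rewrite ge_min lexx.
  have h2 : Num.min r del <= del by rewrite ge_min lexx orbT.
  by rewrite /h; lra.
have [c cx fc] : exists2 c, c \in `]x, x + h[%R & f (x + h) - f x = g c * (x + h - x).
  apply: (@MVT _ f g); first by rewrite ltrDl.
  apply: continuous_in_subspaceT => z _.
  by apply: differentiable_continuous; apply/derivable1_diffP; have [] := df z.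
move: cx; rewrite in_itv /= => /andP[xc cxh].
have : `|(g c - g x) / (c - x) - l| < l / 2.
  apply: hd; first by rewrite gt_eqF.
  by rewrite ger0_norm; lra.
rewrite gx0 subr0 ltr_norml => /andP[+ _] => hgc.
have {}hgc : 0 < g c / (c - x) by lra.
have gc0 : 0 < g c by rewrite -(pmulr_lgt0 _ (_ : 0 < (c - x)^-1)) // invr_gt0 subr_gt0.
have : f (x + h) <= f x by apply: fx; rewrite addrAC subrr add0r ger0_norm // ltW.
rewrite -subr_le0 fc addrAC subrr add0r leNgt => /negP; apply.
exact: mulr_gt0.
Qed.

(** Only times before t are tested, so the lemma applies at the final time, where the derivative is
    one-sided. *)
Lemma derivative_within_ge A g t l a m : a < t ->
  (forall s, a <= s < t -> A s) ->
  (forall s, a <= s < t -> g s <= g t - m * (t - s)) ->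
  derivative_within A g t l -> m <= l.
Proof.
move=> at_ As gs dg; rewrite leNgt; apply/negP => lm.
have lm0 : 0 < m - l by rewrite subr_gt0.
have [del del0 hd] := derivative_withinP dg lm0.
pose h := Num.min (t - a) del / 2.
have m0 : 0 < Num.min (t - a) del by rewrite lt_min del0 subr_gt0 at_.
have h1 : Num.min (t - a) del <= t - a by rewrite ge_min lexx.
have h2 : Num.min (t - a) del <= del by rewrite ge_min lexx orbT.
have h0 : 0 < h by rewrite /h; lra.
have ha : a <= t - h < t by rewrite /h; lra.
have th : t - h - t = - h by ring.
have th' : `|t - h - t| < del by rewrite th normrN ger0_norm ?(ltW h0) // /h; lra.
have th0 : t - h != t by rewrite lt_eqF //; lra.
have := hd _ (As _ ha) th0 th'; rewrite th.
have := gs _ ha; have -> : t - (t - h) = h by ring.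
move=> gh.
have -> : (g (t - h) - g t) / - h = (g t - g (t - h)) / h by field; rewrite gt_eqF.
have : m <= (g t - g (t - h)) / h by rewrite ler_pdivlMr //; lra.
by set q := _ / h; rewrite ltr_norml => mq /andP[_]; lra.
Qed.

(** Gives the continuity in time from which the maximum principle builds joint continuity. *)
Lemma derivative_within_lip A g t l : derivative_within A g t l ->
  exists2 del, 0 < del &
    forall s, A s -> `|s - t| < del -> `|g s - g t| <= (`|l| + 1) * `|s - t|.
Proof.
move=> /derivative_withinP/(_ 1 ltr01)[del del0 hd]; exists del => // s As sd.
have [->|st] := eqVneq s t; first by rewrite !subrr normr0 mulr0.
have st0 : 0 < `|s - t| by rewrite normr_gt0 subr_eq0.
rewrite -ler_pdivrMr // -normf_div.
have := hd s As st sd; set q := _ / _ => hq.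
by rewrite -(subrK l q) (le_trans (ler_normD _ _)) // addrC lerD2l ltW.
Qed.

End derivative_tests.

Section maximum_principle.
Context {R : realType}.
Implicit Types (A : set R) (k u v : R -> R -> R) (x y z s t : R).

(** [g] is u_x, [l] is u_xx and the last clause reads u_t = k u_xx. There is no term in gamma: a
    factor exp(gamma (t - tau)) removes it, so that constants are solutions. *)
Definition caloric_at A k u x t : Prop :=
  exists (g : R -> R) (l : R),
    [/\ forall z, is_derive z 1 (u ^~ t) (g z), is_derive x 1 g l &
        derivative_within A (u x) t (k x t * l)].

Lemma caloric_at_cst A k c x t : caloric_at A k (fun=> fun=> c) x t.
Proof.
exists (fun=> 0), 0; split=> [z||]; [exact: is_derive_cst|exact: is_derive_cst|].
rewrite mulr0 /derivative_within.
under eq_fun do rewrite subrr mul0r; exact: cvg_cst.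
Qed.

Lemma caloric_atD A k u v c x t : caloric_at A k u x t -> caloric_at A k v x t ->
  caloric_at A k (fun y s => u y s + c * v y s) x t.
Proof.
move=> [g [l [h1 h2 h3]]] [g' [l' [h1' h2' h3']]].
exists (fun z => g z + c * g' z), (l + c * l'); split=> [z||].
- exact: (is_deriveD (h1 z) (is_deriveZ c (h1' z))).
- exact: (is_deriveD h2 (is_deriveZ c h2')).
- rewrite /derivative_within.
  have -> : (fun s => (u x s + c * v x s - (u x t + c * v x t)) / (s - t)) =
      (fun s => (u x s - u x t) / (s - t) + c * ((v x s - v x t) / (s - t))).
    by apply/funext => s; ring.
  have -> : k x t * (l + c * l') = k x t * l + c * (k x t * l') by ring.
  by apply: cvgD => //; apply: cvgM; [exact: cvg_cst|exact: h3'].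
Qed.

Lemma caloric_at_sum (I : eqType) (r : seq I) A k (w : I -> R) (u : I -> R -> R -> R) x t :
  (forall i, i \in r -> caloric_at A k (u i) x t) ->
  caloric_at A k (fun y s => \sum_(i <- r) w i * u i y s) x t.
Proof.
elim: r => [|i r IH] hu.
  have -> : (fun y s => \sum_(i <- [::]) w i * u i y s) = (fun=> fun=> 0).
    by apply/funext => y; apply/funext => s; rewrite big_nil.
  exact: caloric_at_cst.
have -> : (fun y s => \sum_(i <- i :: r) w i * u i y s) =
    (fun y s => \sum_(i <- r) w i * u i y s + w i * u i y s).
  by apply/funext => y; apply/funext => s; rewrite big_cons addrC.
apply: caloric_atD; last by apply: hu; rewrite mem_head.
by apply: IH => j jr; apply: hu; rewrite in_cons jr orbT.
Qed.

(* The barrier [eps (x^2 + (2 kU + 1) (t - a))] confines the maximum to a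
   compact rectangle, whatever the behaviour of the bounded function [u] at
   infinity. *)
Lemma maximum_principle A k u (a b kU B Lip m eps X : R) :
  0 < X -> 0 < eps ->
  (forall s, a <= s <= b -> A s) ->
  (forall x t, a <= t <= b -> 0 <= k x t <= kU) ->
  (forall x t, a <= t <= b -> caloric_at A k u x t) ->
  (forall x t, a <= t <= b -> u x t <= B) ->
  (forall x y t, a <= t <= b -> `|u x t - u y t| <= Lip * `|x - y|) ->
  (forall x, `|x| <= X -> u x a <= m) ->
  B <= m + eps * X ^+ 2 ->
  forall x t, a <= t <= b -> u x t <= m + eps * (x ^+ 2 + (2 * kU + 1) * (t - a)).
Proof.
move=> X0 eps0 Aab kb cal uB ulip ua BX x1 t1 t1ab.
rewrite leNgt; apply/negP => bad.
have [at1 t1b] := andP t1ab.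
have ab : a <= b by exact: le_trans at1 t1b.
have kU0 : 0 <= kU by have /andP[/le_trans] := kb 0 a (introT andP (conj (lexx a) ab)); apply.
pose v (z : R * R) := u z.1 z.2 - m - eps * (z.1 ^+ 2 + (2 * kU + 1) * (z.2 - a)).
have v1 : 0 < v (x1, t1) by rewrite /v /=; lra.
(* By B <= m + eps X^2, the barrier beats [u] where |x| >= X; a positive maximum of [v] on the
   rectangle is therefore interior in x. *)
have out x t : a <= t <= b -> X <= `|x| -> v (x, t) <= 0.
  move=> tab Xx; rewrite /v /=; have := uB x t tab.
  have : X ^+ 2 <= x ^+ 2.
    by rewrite -(real_normK (num_real x)) lerXn2r ?nnegrE // ltW.
  move=> /(ler_wpM2l (ltW eps0)) h1 h2.
  have [at_ _] := andP tab.
  have : 0 <= eps * ((2 * kU + 1) * (t - a)).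
    by rewrite !mulr_ge0 ?(ltW eps0) ?subr_ge0 // addr_ge0 ?mulr_ge0.
  by rewrite mulrDr; lra.
pose D : set (R * R) := `[- X, X] `*` `[a, b].
have DP (z : R * R) : D z -> (- X <= z.1 <= X) /\ (a <= z.2 <= b).
  by rewrite /D /= !in_itv.
have x1X : `|x1| < X.
  by rewrite ltNge; apply/negP => /(out x1 t1 t1ab); rewrite leNgt v1.
have D1 : D (x1, t1).
  by rewrite /D /= !in_itv /= t1ab; split => //; move: x1X; rewrite ltr_norml; lra.
have cD : compact D by apply: compact_setX; exact: segment_compact.
(* Joint continuity: move first in x at time t', by the Lipschitz bound uniform in time, then in
   time at the fixed point x. *)
have cu : {within D, continuous (fun z : R * R => u z.1 z.2)}.
  apply/subspace_continuousP => -[x t] Dxt.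
  have [_ /= tab] := DP _ Dxt.
  have [g [l [_ _ dt]]] := cal x t tab.
  have [del del0 hd] := derivative_within_lip dt.
  apply/cvgrPdist_le => e e0 /=.
  pose M := `|Lip| + `|k x t * l| + 1.
  have M0 : 0 < M by rewrite ltr_wpDl // addr_ge0.
  have e' : 0 < Num.min del (e / (2 * M)) by rewrite lt_min del0 divr_gt0 // mulr_gt0.
  rewrite /within /=; apply/nbhs_ballP; exists (Num.min del (e / (2 * M))) => //=.
  move=> -[x' t'] [] /=; rewrite /ball /= => hx ht Dz.
  have [_ /= t'ab] := DP _ Dz.
  move: hx ht; rewrite !lt_min => /andP[_ hx] /andP[htd ht].
  rewrite distrC.
  have -> : u x' t' - u x t = (u x' t' - u x t') + (u x t' - u x t) by ring.
  apply: le_trans (ler_normD _ _) _.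
  have e1 := ulip x' x t' t'ab.
  have e2 := hd t' (Aab _ t'ab); rewrite distrC in htd; move/(_ htd) in e2.
  apply: le_trans (lerD e1 e2) _.
  rewrite (distrC x') (distrC t').
  have f1 : Lip * `|x - x'| <= M * (e / (2 * M)).
    apply: (@le_trans _ _ (M * `|x - x'|)); last by rewrite ler_wpM2l // ltW.
    rewrite ler_wpM2r // /M; have := ler_norm Lip.
    have := normr_ge0 (k x t * l); lra.
  have f2 : (`|k x t * l| + 1) * `|t - t'| <= M * (e / (2 * M)).
    apply: (@le_trans _ _ (M * `|t - t'|)); last by rewrite ler_wpM2l // ltW.
    by rewrite ler_wpM2r // /M; have := normr_ge0 Lip; lra.
  have f3 : M * (e / (2 * M)) = e / 2 by field; rewrite gt_eqF.
  by lra.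
have cv : {within D, continuous v}.
  move=> z; apply: cvgB; first by apply: cvgB; [exact: cu|exact: cvg_cst].
  move: z; apply: continuous_subspaceT => z.
  apply: cvgM; first exact: cvg_cst.
  apply: cvgD.
    by apply: cvgM; exact: cvg_fst.
  apply: cvgM; first exact: cvg_cst.
  by apply: cvgB; [exact: cvg_snd|exact: cvg_cst].
have [[x t] Dc maxv] := compact_EVT_max (ex_intro _ _ D1) cD cv.
have [xX tab] := DP _ (set_mem Dc); rewrite /= in xX tab.
have vc0 : 0 < v (x, t) by apply: lt_le_trans v1 _; apply: maxv; exact: mem_set.
have xX' : `|x| < X by rewrite ltNge; apply/negP => /(out x t tab); rewrite leNgt vc0.
have [at_ tb] := andP tab.
have ta : a < t.
  rewrite lt_neqAle at_ andbT; apply/eqP => ta; move: vc0; apply/negP; rewrite -leNgt.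
  rewrite /v /= -ta subrr mulr0 addr0.
  have := ua x (ltW xX').
  have : 0 <= eps * x ^+ 2 by apply: mulr_ge0; [exact: ltW|exact: sqr_ge0].
  lra.
have [g [l [dg dl dt]]] := cal x t tab.
have l2 : l <= 2 * eps.
  suff : l - 2 * eps <= 0 by rewrite subr_le0.
  have sq z : is_derive z 1 (fun z : R => eps * z ^+ 2) (2 * eps * z).
    apply: is_derive_eq. rewrite /GRing.scale /=; ring.
  apply: (@second_derivative_at_max _ (fun z => u z t - eps * z ^+ 2)
    (fun z => g z - 2 * eps * z) x _ (X - `|x|)); first by rewrite subr_gt0.
  - have lin : is_derive x 1 (fun z : R => 2 * eps * z) (2 * eps).
      by apply: is_derive_eq; rewrite /GRing.scale /=; ring.
    exact: (is_deriveB dl lin).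
  - move=> z zx; have Dz : D (z, t).
      rewrite /D /= !in_itv /= tab; split => //.
      have : `|z| <= X.
        by rewrite -(subrK x z) (le_trans (ler_normD _ _)) // -lerBrDr ltW.
      by rewrite ler_norml.
    by have := maxv _ (mem_set Dz); rewrite /v /=; lra.
(* Maximality against earlier times bounds u_t below by eps (2 kU + 1), while u_t = k u_xx <= 2 eps
   kU: the contradiction is the + 1 of the barrier. *)
have : eps * (2 * kU + 1) <= k x t * l.
  apply: (@derivative_within_ge _ A (u x) t _ a) => //.
  - by move=> s /andP[as_ st]; apply: Aab; lra.
  - move=> s /andP[as_ st].
    have Ds : D (x, s).
      by rewrite /D /= !in_itv /=; split; [exact: xX|lra].
    by have := maxv _ (mem_set Ds); rewrite /v /=; lra.
apply/negP; rewrite -ltNge.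
have /andP[k0 kk] := kb x t tab.
apply: (@le_lt_trans _ _ (kU * (2 * eps))); last by lra.
apply: (@le_trans _ _ (k x t * (2 * eps))); first exact: ler_wpM2l.
by rewrite ler_wpM2r // mulr_ge0 // ltW.
Qed.

End maximum_principle.

(** * Approximation of integrals by weighted samples *)

Section finite_sampling.
Context d (U : measurableType d) {R : realType} (m : {measure set U -> \bar R}).
Implicit Types (D : set U).

Lemma bounded_integrable D (f : U -> R) B : measurable D -> (m D < +oo)%E ->
  measurable_fun D f -> (forall x, D x -> `|f x| <= B) -> m.-integrable D (EFin \o f).
Proof.
move=> mD Dfin mf fB; apply: measurable_bounded_integrable => //.
by exists B; split; [exact: num_real|move=> M BM x Dx; exact: le_trans (fB x Dx) (ltW BM)].
Qed.

Lemma Rintegral_finite_range (I : finType) (idx : U -> I) D (c : I -> R) :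
  measurable D -> (m D < +oo)%E ->
  (forall v, measurable (D `&` idx @^-1` [set v])) ->
  \int[m]_(x in D) c (idx x) = \sum_v c v * fine (m (D `&` idx @^-1` [set v])).
Proof.
move=> mD Dfin mA.
have fA v : m (D `&` idx @^-1` [set v]) \is a fin_num.
  rewrite ge0_fin_numE //; apply: le_lt_trans Dfin.
  by apply: le_measure; rewrite ?inE //; exact: subIsetl.
have ci v : m.-integrable D (EFin \o (fun x => c v * \1_(D `&` idx @^-1` [set v]) x)).
  apply: (@bounded_integrable _ _ `|c v|) => //.
    by apply: measurable_funM => //; exact: measurable_indic.
  move=> x _; rewrite normrM ler_piMr // indicE; case: (_ \in _); rewrite ?normr1 ?normr0 //.
rewrite /Rintegral.
rewrite (eq_integral (fun x => \sum_v (c v * \1_(D `&` idx @^-1` [set v]) x)%:E)%E); last first.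
  move=> x /set_mem Dx; rewrite sumEFin (bigD1 (idx x)) //= big1 => [|v vx].
    by rewrite addr0 indicE mem_set ?mulr1.
  rewrite indicE memNset ?mulr0 // => -[_ /= /eqP xv]; move: vx.
  by rewrite eq_sym xv.
rewrite integral_sum //.
have -> : (\sum_v \int[m]_(x in D) (c v * \1_(D `&` idx @^-1` [set v]) x)%:E)%E =
    (\sum_v (c v * fine (m (D `&` idx @^-1` [set v])))%:E)%E.
  apply: eq_bigr => v _; under eq_integral do rewrite EFinM.
  rewrite integralZl //; last first.
    apply: (@bounded_integrable _ _ 1) => //.
    by move=> x _; rewrite indicE; case: (_ \in _); rewrite ?normr1 ?normr0.
  rewrite integral_indic // setIAC setIid EFinM fineK //.
by rewrite sumEFin.
Qed.

(* Cut [D] into the level sets of the [h j] rounded to multiples of [e]. *)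
Lemma finite_sampling (J : finType) (h : J -> U -> R) D (x0 : U) (B e : R) :
  measurable D -> (m D < +oo)%E -> D x0 ->
  (forall j, measurable_fun [set: U] (h j)) ->
  (forall j x, D x -> `|h j x| <= B) -> 0 < e ->
  exists (I : finType) (w : I -> R) (z : I -> U),
    [/\ forall i, 0 <= w i, forall i, D (z i), \sum_i w i = fine (m D) &
        forall j, `|\int[m]_(x in D) h j x - \sum_i w i * h j (z i)| <= e * fine (m D)].
Proof.
move=> mD Dfin Dx0 mh hB e0.
(* The values shifted by B lie in [0, 2B], so N + 1 levels of width e are enough. *)
pose N := Num.truncn ((B + B) / e).
pose Cell := {ffun J -> 'I_N.+1}.
pose cell j x := Num.truncn ((h j x + B) / e).
pose idx x : Cell := [ffun j => inord (cell j x)].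
have hB0 j x : D x -> 0 <= (h j x + B) / e.
  by move=> /(hB j); rewrite ler_norml => /andP[h1 _]; apply: divr_ge0; [lra|exact: ltW].
have cellN j x : D x -> (cell j x < N.+1)%N.
  move=> Dx; rewrite ltnS; apply: le_truncn.
  rewrite ler_wpM2r ?invr_ge0 ?(ltW e0) // lerD2r.
  by have := hB j x Dx; rewrite ler_norml => /andP[].
have cellE j x : D x -> (cell j x)%:R * e <= h j x + B < (cell j x).+1%:R * e.
  by move=> Dx; have := truncn_itv (hB0 j x Dx); rewrite ler_pdivlMr // ltr_pdivrMr.
pose A (v : Cell) := D `&` idx @^-1` [set v].
have AE v : A v = D `&` \bigcap_(j in [set: J])
    [set x | (v j)%:R * e <= h j x + B < (v j).+1%:R * e].
  apply/seteqP; split=> x [Dx /= hx]; split=> //.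
    move=> j _ /=; rewrite -hx ffunE inordK; last exact: cellN.
    exact: cellE.
  apply/ffunP => j; rewrite ffunE; apply/val_inj; rewrite /= inordK; last exact: cellN.
  apply: truncn_def; rewrite ler_pdivlMr // ltr_pdivrMr //; exact: hx.
have mA v : measurable (A v).
  rewrite AE; apply: measurableI => //; apply: fin_bigcap_measurable; first exact: finite_finset.
  move=> j _.
  have hm : measurable_fun [set: U]
      (fun x => ((v j)%:R * e <= h j x + B) && (h j x + B < (v j).+1%:R * e)).
    apply: measurable_and.
      by apply: measurable_fun_ler => //; exact: measurable_funD.
    by apply: measurable_fun_ltr => //; exact: measurable_funD.
  by have := hm measurableT [set true]; rewrite setTI; exact.
pose w v := fine (m (A v)).
(* An empty cell has weight 0; its sample defaults to [x0], which stays in [D]. *)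
pose z v := xget x0 (A v).
have Dz v : D (z v).
  rewrite /z; case: xgetP => [y -> [] //|_]; exact: Dx0.
exists Cell, w, z; split=> //.
- by move=> v; rewrite /w fine_ge0.
- have := @Rintegral_finite_range _ idx D (fun=> 1) mD Dfin mA.
  rewrite Rintegral_cst // mul1r => ->.
  by apply: eq_bigr => v _; rewrite mul1r.
move=> j.
have -> : \sum_i w i * h j (z i) = \int[m]_(x in D) h j (z (idx x)).
  rewrite (@Rintegral_finite_range _ idx D (fun v => h j (z v)) mD Dfin mA).
  by apply: eq_bigr => v _; rewrite mulrC.
have mz : measurable_fun D (fun x => h j (z (idx x))).
  have : measurable_fun D (fun x => \sum_v h j (z v) * \1_(A v) x).
    apply: measurable_sum => v; apply: measurable_funM => //.
  apply: eq_measurable_fun => x /set_mem Dx; rewrite (bigD1 (idx x)) //= big1 => [|v vx].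
    by rewrite addr0 indicE mem_set ?mulr1.
  rewrite indicE memNset ?mulr0 // => -[_ /= /eqP xv]; move: vx.
  by rewrite eq_sym xv.
have i1 : m.-integrable D (EFin \o h j).
  apply: (@bounded_integrable _ _ B) => //; first exact: measurable_funTS.
  by move=> x; exact: hB.
have i2 : m.-integrable D (EFin \o (fun x => h j (z (idx x)))).
  by apply: (@bounded_integrable _ _ B) => // x _; apply: hB; exact: Dz.
rewrite -RintegralB //.
have i3 : m.-integrable D (EFin \o (fun x => h j x - h j (z (idx x)))).
  apply: (@bounded_integrable _ _ (B + B)) => //.
    by apply: measurable_funB => //; exact: measurable_funTS.
  move=> x Dx; apply: le_trans (ler_normB _ _) _; apply: lerD; first exact: hB.
  exact: hB.
apply: le_trans (le_normr_Rintegral mD i3) _.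
rewrite -Rintegral_cst //; apply: le_Rintegral => //.
- exact: integrable_norm i3.
- by apply: (@bounded_integrable _ _ `|e|).
move=> x Dx.
have zA : A (idx x) (z (idx x)).
  by apply: xgetPex; exists x; split.
have Ax : A (idx x) x by split.
move: zA Ax; rewrite AE => -[_ /(_ j I)/= /andP[z1 z2]] [_ /(_ j I)/= /andP[x1 x2]].
rewrite -natr1 mulrDl mul1r in z2 x2.
by rewrite ler_norml; apply/andP; split; lra.
Qed.

End finite_sampling.

(** * Bounds on the fundamental solution and its mass at short times *)

Section mass.
Context {R : realType} (T kL kU C c : R) (k : R -> R -> R) (Phi : R -> R -> R -> R -> R).
Local Notation mu := (@lebesgue_measure R).
Context (adm : admissible T kL kU C c k Phi).

Let c0 : 0 < c. Proof. by case: adm => _ _ _ []. Qed.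
Let ckU : c / 2 <= (8 * kU)^-1.
Proof. by case: adm => _ _ _ [cp h _] _; apply: le_trans h; lra. Qed.
Let T0 : 0 < T. Proof. by case: adm. Qed.
Let kL0 : 0 < kL. Proof. by case: adm => _ _ []. Qed.
Let kb x t : kL <= k x t <= kU. Proof. by case: adm => _ _ []. Qed.
Let c20 : 0 < c / 2. Proof. by rewrite divr_gt0. Qed.

Lemma powR_quarterN (L : R) : 0 < L -> L `^ (- (1 / 4)) = L `^ (1 / 4) / Num.sqrt L.
Proof.
move=> L0; rewrite -powR12_sqrt ?(ltW L0) // -powRN -powRD; last by apply/implyP => _; rewrite gt_eqF.
by congr (_ `^ _); field.
Qed.

Lemma powR_3quarterN (L : R) : 0 < L -> L `^ (- (3 / 4)) = L `^ (1 / 4) / L.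
Proof.
move=> L0; rewrite -(powR_inv1 (ltW L0)) -powRD; last by apply/implyP => _; rewrite gt_eqF.
by congr (_ `^ _); field.
Qed.

Lemma powR_quarter_le (L : R) : 0 < L -> L <= T -> L `^ (1 / 4) <= T `^ (1 / 4).
Proof. by move=> L0 LT; rewrite ge0_ler_powR // nnegrE // ltW. Qed.

(** The correction is smaller than the heat kernel by a factor (t - tau)^(1/4), which goes into the
    constant since t - tau <= T. *)
Lemma Gamma_le : exists2 A : R, 0 <= A & forall x t xi tau, tau < t -> t - tau <= T ->
  `|Gamma k Phi x t xi tau| <= A / Num.sqrt (t - tau) * gauss (c / 2) (x - xi) (t - tau).
Proof.
have [A1 A10 h1] := heat_le kU kL0.
have [A2 A20 h2] := correction_le adm.
exists (A1 + A2 * T `^ (1 / 4)); first by rewrite addr_ge0 ?mulr_ge0 ?powR_ge0.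
move=> x t xi tau taut LT; have L0 : 0 < t - tau by rewrite subr_gt0.
rewrite GammaE; apply: le_trans (ler_normD _ _) _.
rewrite (ger0_norm (heat_ge0 _ _ _)) mulrDl mulrDl; apply: lerD; first exact: h1.
apply: le_trans (h2 _ _ _ _ taut) _; rewrite ler_wpM2r ?gauss_ge0 //.
rewrite powR_quarterN // -mulrA ler_wpM2l // ler_wpM2r ?invr_ge0 ?sqrtr_ge0 //.
exact: powR_quarter_le.
Qed.

(** Used twice: for the Lipschitz hypothesis of the maximum principle, and to bound the quotients
    that converge to [Gamma_x]. *)
Lemma Gamma_lip : exists2 A : R, 0 <= A & forall x x' t xi tau, tau < t -> t - tau <= T ->
  `|Gamma k Phi x t xi tau - Gamma k Phi x' t xi tau| <=
    A * `|x - x'| / (t - tau) *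
      (gauss (c / 2) (x - xi) (t - tau) + gauss (c / 2) (x' - xi) (t - tau)).
Proof.
have [A1 A10 h1] := heat_diff_le kU kL0.
have [A2 A20 h2] := correction_diff_le adm.
exists (A1 + A2 * T `^ (1 / 4)); first by rewrite addr_ge0 ?mulr_ge0 ?powR_ge0.
move=> x x' t xi tau taut LT; have L0 : 0 < t - tau by rewrite subr_gt0.
rewrite !GammaE opprD addrACA; apply: le_trans (ler_normD _ _) _.
set g := (X in _ * X).
have g0 : 0 <= g by rewrite addr_ge0 ?gauss_ge0.
have -> : (A1 + A2 * T `^ (1 / 4)) * `|x - x'| / (t - tau) * g =
   A1 * `|x - x'| / (t - tau) * g + A2 * `|x - x'| * (T `^ (1 / 4) / (t - tau)) * g by ring.
apply: lerD.
  have := h1 _ (x - xi) (x' - xi) _ _ (kb xi tau) L0 ckU.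
  by rewrite (_ : x - xi - (x' - xi) = x - x') //; ring.
apply: le_trans (h2 _ _ _ _ _ taut) _; rewrite ler_wpM2r //.
rewrite powR_3quarterN // ler_wpM2l ?mulr_ge0 // ler_wpM2r ?invr_ge0 ?(ltW L0) //.
exact: powR_quarter_le.
Qed.

Lemma measurable_Gamma_xi x t tau : measurable_fun [set: R] (fun xi => Gamma k Phi x t xi tau).
Proof. by apply: measurable_fun4 => //; exact: measurable_Gamma adm. Qed.

Lemma gauss_dominated (f : R -> R) (B x p e : R) : 0 < e -> 0 < p ->
  measurable_fun [set: R] f -> (forall xi, `|f xi| <= B * gauss e (x - xi) p) ->
  mu.-integrable setT (EFin \o f) /\
  `|\int[mu]_xi f xi| <= B * Num.sqrt (pi * p / e).
Proof.
move=> e0 p0 mf fB.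
have B0 : 0 <= B.
  by have := le_trans (normr_ge0 _) (fB 0); rewrite pmulr_lge0 // gauss_gt0.
have mg : measurable_fun [set: R] (fun xi => (gauss e (x - xi) p)%:E).
  by apply/measurable_EFinP; apply: measurable_gaussT => //; exact: measurable_funB.
have le1 : (\int[mu]_xi `|(f xi)%:E| <= (B * Num.sqrt (pi * p / e))%:E)%E.
  apply: (@le_trans _ _ (\int[mu]_xi (B%:E * (gauss e (x - xi) p)%:E))%E).
    apply: ge0_le_integral => //.
    - by apply: measurableT_comp => //; exact/measurable_EFinP.
    - exact: measurable_funeM.
    - by move=> xi _; rewrite /= -EFinM lee_fin.
  rewrite ge0_integralZl ?lee_fin //; last by move=> xi _; rewrite lee_fin gauss_ge0.
  by rewrite integral_gaussC.
have i1 : mu.-integrable setT (EFin \o f).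
  apply/integrableP; split; first exact/measurable_EFinP.
  by apply: le_lt_trans le1 _; rewrite ltry.
split => //; rewrite -lee_fin EFin_normr_Rintegral //.
by apply: le_trans le1; apply: le_abse_integral => //; exact/measurable_EFinP.
Qed.

Lemma integrable_Gamma x t tau : tau < t -> t - tau <= T ->
  mu.-integrable setT (EFin \o (fun xi => Gamma k Phi x t xi tau)).
Proof.
move=> taut LT; have [A A0 h] := Gamma_le.
have [||//] := @gauss_dominated _ (A / Num.sqrt (t - tau)) x (t - tau) (c / 2) c20 _
  (measurable_Gamma_xi x t tau).
- by rewrite subr_gt0.
- by move=> xi; exact: h.
Qed.

Lemma integrable_heat x t tau : tau < t ->
  mu.-integrable setT (EFin \o (fun xi => heat (k xi tau) (x - xi) (t - tau))).
Proof.
move=> taut; have L0 : 0 < t - tau by rewrite subr_gt0.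
have [A A0 h] := heat_le kU kL0.
have [||//] := @gauss_dominated (fun xi => heat (k xi tau) (x - xi) (t - tau))
   (A / Num.sqrt (t - tau)) x (t - tau) (c / 2) c20 L0.
- apply: measurable_heat => //; last exact: measurable_funB.
  by apply: measurable_fun2 => //; case: adm => -[].
- by move=> xi; rewrite (ger0_norm (heat_ge0 _ _ _)); exact: h.
Qed.

(** sqrt|r| <= a + |r|/a with a = p^(1/4), the scale at which the two terms balance; half of the
    Gaussian then absorbs |r|. *)
Lemma sqrt_gauss_le (r p : R) : 0 < p ->
  `|r| `^ (1 / 2) * gauss (c / 2) r p <=
    (1 + Num.sqrt (4 / c)) * p `^ (1 / 4) * gauss (c / 4) r p.
Proof.
move=> p0.
have a0 : 0 < p `^ (1 / 4) by exact: powR_gt0.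
have c40 : 0 < c / 4 by rewrite divr_gt0.
have c24 : c / 2 = c / 4 + c / 4 by field.
rewrite c24 -gaussM mulrA ler_wpM2r ?gauss_ge0 //.
have e1 : `|r| `^ (1 / 2) <= p `^ (1 / 4) + `|r| / p `^ (1 / 4).
  rewrite (_ : 1 / 2 = 2^-1); last by field.
  rewrite powR12_sqrt //; set w := Num.sqrt _; have w0 : 0 <= w by exact: sqrtr_ge0.
  have -> : `|r| = w ^+ 2 by rewrite sqr_sqrtr.
  move: (p `^ _) a0 => a a0.
  rewrite -(ler_pM2r a0) mulrDl -mulrA mulVf ?gt_eqF // mulr1.
  by have := sqr_ge0 (a - w); nra.
apply: le_trans (ler_wpM2r (gauss_ge0 _ _ _) e1) _.
rewrite [leRHS](_ : _ = p `^ (1 / 4) + Num.sqrt (4 / c) * p `^ (1 / 4)); last by ring.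
rewrite mulrDl.
apply: lerD; first by rewrite ler_piMr ?(ltW a0) // gauss_le1 // ltW.
rewrite mulrAC ler_pdivrMr //.
apply: le_trans (norm_gauss_le r c40 p0) _.
have -> : p / (c / 4) = 4 / c * p by field; rewrite gt_eqF.
rewrite sqrtrM; last by rewrite divr_ge0 // ltW.
by rewrite (sqrt_quarter (ltW p0)) expr2 mulrA.
Qed.

Context (Ch : R) (hk : forall x y t, 0 < t -> t <= T -> `|k x t - k y t| <= Ch * `|x - y| `^ (1 / 2)).

(** With the coefficient frozen at x the mass is exactly 1. The integration variable is xi, where
    the kernel is really frozen, and the exchange costs |k xi - k x| <= Ch sqrt|x - xi|. *)
Lemma heat_mass : exists2 A : R, 0 <= A & forall x t tau, 0 < tau -> tau < t -> t <= T ->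
  `|\int[mu]_xi heat (k xi tau) (x - xi) (t - tau) - 1| <= A * (t - tau) `^ (1 / 4).
Proof.
have Ch0 : 0 <= Ch.
  have := le_trans (normr_ge0 _) (hk 1 0 T0 (lexx T)).
  by rewrite subr0 normr1 powR1 mulr1.
have kLU : kL <= kU by have /andP[/le_trans] := kb 0 0; apply.
have [A A0 h] := heat_diff_const_le kL0 kLU.
exists (A * Ch * (1 + Num.sqrt (4 / c)) * Num.sqrt (4 * pi / c)).
  by rewrite !mulr_ge0 ?sqrtr_ge0 // addr_ge0 ?sqrtr_ge0.
move=> x t tau tau0 taut tT.
have L0 : 0 < t - tau by rewrite subr_gt0.
have tauT : tau <= T by apply: le_trans tT; exact: ltW.
have c40 : 0 < c / 4 by rewrite divr_gt0.
have kx0 : 0 < k x tau by have /andP[/(lt_le_trans kL0)] := kb x tau.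
have one : \int[mu]_xi heat (k x tau) (x - xi) (t - tau) = 1.
  by rewrite /Rintegral integral_heat.
have mH (K : R -> R) : measurable_fun [set: R] K ->
    measurable_fun [set: R] (fun xi => heat (K xi) (x - xi) (t - tau)).
  by move=> mK; apply: measurable_heat => //; exact: measurable_funB.
have mk1 : measurable_fun [set: R] (fun xi => k xi tau).
  by apply: measurable_fun2 => //; case: adm => -[].
have i2 : mu.-integrable setT (EFin \o (fun xi => heat (k x tau) (x - xi) (t - tau))).
  apply/integrableP; split; first by apply/measurable_EFinP; exact: (mH (fun=> k x tau) (measurable_cst _)).
  under eq_integral do rewrite /= (ger0_norm (heat_ge0 _ _ _)).
  by rewrite integral_heat // ltry.
rewrite -{1}one -RintegralB //; last exact: integrable_heat.
have [||_] := @gauss_dominated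
  (fun xi => heat (k xi tau) (x - xi) (t - tau) - heat (k x tau) (x - xi) (t - tau))
  (A * Ch * (1 + Num.sqrt (4 / c)) * ((t - tau) `^ (1 / 4) / Num.sqrt (t - tau))) x _ _ c40 L0.
- by apply: measurable_funB; apply: mH.
- move=> xi; apply: le_trans (h _ _ (x - xi) _ _ (kb xi tau) (kb x tau) L0 ckU) _.
  have := hk xi x tau0 tauT; rewrite (distrC xi).
  move=> /(ler_wpM2l A0) e1.
  set s := (Num.sqrt _)^-1; have s0 : 0 <= s by rewrite invr_ge0 sqrtr_ge0.
  have e2 := sqrt_gauss_le (x - xi) L0.
  rewrite -/s in e1 e2 *; set g := gauss (c / 2) _ _ in e2 *; have g0 : 0 <= g by exact: gauss_ge0.
  apply: le_trans (ler_wpM2r g0 (ler_wpM2r s0 e1)) _.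
  set w := _ `^ (1 / 2) in e2 *.
  have -> : A * (Ch * w) * s * g = A * Ch * s * (w * g) by ring.
  apply: le_trans (ler_wpM2l (_ : 0 <= A * Ch * s) e2) _; first by rewrite !mulr_ge0.
  by rewrite le_eqVlt; apply/orP; left; apply/eqP; ring.
- move=> H; apply: le_trans H _.
  have -> : pi * (t - tau) / (c / 4) = 4 * pi / c * (t - tau) by field; rewrite gt_eqF.
  rewrite (@sqrtrM _ (4 * pi / c)); last by rewrite divr_ge0 ?mulr_ge0 ?pi_ge0 // ltW.
  rewrite le_eqVlt; apply/orP; left; apply/eqP; field.
  by rewrite gt_eqF // sqrtr_gt0.
Qed.

(** The correction contributes (t - tau)^(-1/4) times the mass of a Gaussian, of order (t -
    tau)^(1/2): the same order as the error in [heat_mass]. *)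
Lemma Gamma_mass_init : exists2 A : R, 0 <= A & forall x t tau, 0 < tau -> tau < t -> t <= T ->
  `|\int[mu]_xi Gamma k Phi x t xi tau - 1| <= A * (t - tau) `^ (1 / 4).
Proof.
have [A1 A10 h1] := heat_mass.
have [A2 A20 h2] := correction_le adm.
exists (A1 + A2 * Num.sqrt (2 * pi / c)); first by rewrite addr_ge0 ?mulr_ge0 ?sqrtr_ge0.
move=> x t tau tau0 taut tT; have L0 : 0 < t - tau by rewrite subr_gt0.
have LT : t - tau <= T by lra.
have iG := integrable_Gamma x taut LT; have iH := integrable_heat x taut.
have E : \int[mu]_xi Gamma k Phi x t xi tau - 1 =
  (\int[mu]_xi heat (k xi tau) (x - xi) (t - tau) - 1) + \int[mu]_xi correction k Phi x t xi tau.
  rewrite (_ : \int[mu]_xi correction k Phi x t xi tau =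
     \int[mu]_xi (Gamma k Phi x t xi tau - heat (k xi tau) (x - xi) (t - tau))).
    by rewrite RintegralB //; ring.
  by apply: eq_Rintegral => xi _; rewrite GammaE addrAC subrr add0r.
rewrite E; apply: le_trans (ler_normD _ _) _; rewrite mulrDl; apply: lerD; first exact: h1.
have mC : measurable_fun [set: R] (fun xi => correction k Phi x t xi tau).
  have -> : (fun xi => correction k Phi x t xi tau) =
    (fun xi => Gamma k Phi x t xi tau - heat (k xi tau) (x - xi) (t - tau)).
    by apply/funext => xi; rewrite GammaE addrAC subrr add0r.
  apply: measurable_funB; first exact: measurable_Gamma_xi.
  apply: measurable_heat => //; last exact: measurable_funB.
  by apply: measurable_fun2 => //; case: adm => -[].
have [|_] := @gauss_dominated _ (A2 * (t - tau) `^ (- (1 / 4))) x _ _ c20 L0 mC.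
  by move=> xi; exact: h2.
move=> H; apply: le_trans H _.
have -> : pi * (t - tau) / (c / 2) = 2 * pi / c * (t - tau) by field; rewrite gt_eqF.
rewrite (@sqrtrM _ (2 * pi / c)); last by rewrite divr_ge0 ?mulr_ge0 ?pi_ge0 // ltW.
rewrite powR_quarterN // le_eqVlt; apply/orP; left; apply/eqP; field.
by rewrite gt_eqF // sqrtr_gt0.
Qed.

(** Outside [-M, M] the distance to x exceeds M/2, so half of the Gaussian gains a factor O(1/M) by
    [norm_gauss_le], uniformly in t. This slow rate is enough. *)
Lemma Gamma_tail : exists2 A : R, 0 <= A & forall x t tau M, 0 < M -> `|x| <= M / 2 ->
  tau < t -> t - tau <= T ->
  `|\int[mu]_xi Gamma k Phi x t xi tau - \int[mu]_(xi in `[- M, M]) Gamma k Phi x t xi tau| <= A / M.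
Proof.
have [A A0 h] := Gamma_le.
exists (A * Num.sqrt (4 * pi / c) * (2 * Num.sqrt (4 * T / c))).
  by rewrite !mulr_ge0 ?sqrtr_ge0.
move=> x t tau M M0 xM taut LT; have L0 : 0 < t - tau by rewrite subr_gt0.
have c40 : 0 < c / 4 by rewrite divr_gt0.
have c24 : c / 2 = c / 4 + c / 4 by field.
pose f xi := Gamma k Phi x t xi tau.
have mI : measurable (`[- M, M]%classic : set (measurableTypeR R)) by exact: measurable_itv.
have mf : measurable_fun [set: R] f by exact: measurable_Gamma_xi.
have i1 : mu.-integrable setT (EFin \o f) by exact: integrable_Gamma.
have mfI : measurable_fun [set: R] (f \_ `[- M, M]).
  exact: (iffLR (measurable_restrictT f mI) (measurable_funTS mf)).
rewrite [X in _ - X]Rintegral_mkcond -RintegralB //; last first.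
  rewrite -restrict_EFin.
  have i2 := integrableS measurableT mI (@subsetT _ _) i1.
  exact: (iffLR (integrable_mkcond _ mI) i2).
have [||_ H] := @gauss_dominated (fun xi => f xi - (f \_ `[- M, M]) xi)
  (A / Num.sqrt (t - tau) * gauss (c / 4) (M / 2) (t - tau)) x (t - tau) (c / 4) c40 L0.
- exact: measurable_funB.
- move=> xi; rewrite patchE; case: ifPn => hxi.
    rewrite subrr normr0 !mulr_ge0 ?invr_ge0 ?sqrtr_ge0 ?gauss_ge0 //.
  rewrite subr0; apply: le_trans (h _ _ _ _ taut LT) _.
  rewrite c24 -gaussM mulrA ler_wpM2r ?gauss_ge0 // ler_wpM2l ?divr_ge0 ?sqrtr_ge0 //.
  rewrite ler_expR lerN2 ler_wpM2r ?invr_ge0 ?(ltW L0) // ler_wpM2l ?(ltW c40) //.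
  rewrite -(real_normK (num_real (x - xi))) lerXn2r ?nnegrE ?(ltW M0) //; first by rewrite divr_ge0 // ltW.
  have : M < `|xi|.
    rewrite ltNge; apply/negP => hh; move: hxi; rewrite notin_setE /= in_itv /=; apply.
    by rewrite -ler_norml.
  have := lerB_dist xi x; rewrite (distrC xi); lra.
- apply: le_trans H _.
  have -> : pi * (t - tau) / (c / 4) = 4 * pi / c * (t - tau) by field; rewrite gt_eqF.
  rewrite (@sqrtrM _ (4 * pi / c)); last by rewrite divr_ge0 ?mulr_ge0 ?pi_ge0 // ltW.
  set P := Num.sqrt (4 * pi / c).
  have -> : A / Num.sqrt (t - tau) * gauss (c / 4) (M / 2) (t - tau) * (P * Num.sqrt (t - tau)) =
    A * P * gauss (c / 4) (M / 2) (t - tau) by field; rewrite gt_eqF // sqrtr_gt0.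
  set S := Num.sqrt (4 * T / c); have P0 : 0 <= P by exact: sqrtr_ge0.
  have -> : A * P * (2 * S) / M = A * P * (2 * S / M) by ring.
  rewrite ler_wpM2l ?mulr_ge0 // ler_pdivlMr //.
  have := norm_gauss_le (M / 2) c40 L0; rewrite ger0_norm; last by rewrite divr_ge0 // ltW.
  have : Num.sqrt ((t - tau) / (c / 4)) <= S.
    apply: ler_wsqrtr; rewrite invf_div mulrA (mulrC 4) ler_wpM2r ?invr_ge0 ?(ltW c0) //.
    by rewrite ler_wpM2r.
  move=> e1 e2; have := le_trans e2 e1; lra.
Qed.

End mass.

(** * Conservation of mass at all times *)

Section conservation.
Context {R : realType}.
Local Notation mu := (@lebesgue_measure R).

Lemma derivative_withinM (A : set R) (e g : R -> R) (t de l : R) :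
  is_derive t 1 e de -> derivative_within A g t l ->
  derivative_within A (fun s => e s * g s) t (e t * l + de * g t).
Proof.
move=> He Hg; rewrite /derivative_within.
have -> : (fun s => (e s * g s - e t * g t) / (s - t)) =
   (fun s => e s * ((g s - g t) / (s - t)) + (e s - e t) / (s - t) * g t).
  by apply/funext => s; ring.
have ce : e s @[s --> within A t^'] --> e t.
  apply: cvg_within_filter; apply: cvg_within_filter.
  by apply: differentiable_continuous; apply/derivable1_diffP; case: He.
have qe : (e s - e t) / (s - t) @[s --> within A t^'] --> de.
  apply: cvg_within_filter; apply/cvgrPdist_lt => eps eps0.
  have [del del0 hd] := is_derive1P He eps0.
  rewrite /dnbhs /within /=; apply/nbhs_ballP; exists del => //= s.
  by rewrite /ball /= distrC => sd st; rewrite distrC; exact: hd.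
apply: cvgD; first exact: cvgM.
by apply: cvgM; [exact: qe|exact: cvg_cst].
Qed.

Lemma dist_chain4 (a b c d e x : R) : `|a - b| <= e -> `|c - b| <= e ->
  `|d - c| <= e -> `|d - x| <= e -> `|a - x| <= 4 * e.
Proof.
rewrite !ler_norml => /andP[? ?] /andP[? ?] /andP[? ?] /andP[? ?].
by apply/andP; split; lra.
Qed.

Lemma dist_chain7 (a b d e x : R) : `|b - a| <= e -> `|d - b| <= e ->
  a - x <= 5 * e -> x - a <= 5 * e -> `|d - x| <= 7 * e.
Proof.
rewrite !ler_norml => /andP[? ?] /andP[? ?] ? ?.
by apply/andP; split; lra.
Qed.

(** A finite net: sampling controls the sum at finitely many points only, and a Lipschitz bound
    covers the points in between. *)
Lemma grid (X rho : R) : 0 < X -> 0 < rho -> exists (n : nat) (g : 'I_n -> R),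
  (forall j, `|g j| <= X) /\ forall x, `|x| <= X -> exists j, `|x - g j| <= rho.
Proof.
move=> X0 rho0; pose N := Num.truncn ((X + X) / rho).
pose g (j : 'I_N.+1) : R := - X + j%:R * rho.
have N0 : 0 <= (X + X) / rho by rewrite divr_ge0 ?addr_ge0 // ltW.
exists N.+1, g; split.
  move=> j; have := truncn_itv N0; rewrite -/N => /andP[h _].
  have : (j : nat)%:R <= N%:R :> R by rewrite ler_nat -ltnS.
  move: h; rewrite ler_pdivlMr // => h /(ler_wpM2r (ltW rho0)) h2.
  have : 0 <= (j : nat)%:R * rho by rewrite mulr_ge0 // ltW.
  by rewrite /g ler_norml => h3; apply/andP; split; lra.
move=> x; rewrite ler_norml => /andP[h1 h2].
have x0 : 0 <= (x + X) / rho by apply: divr_ge0; [lra|exact: ltW].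
have jN : (Num.truncn ((x + X) / rho) < N.+1)%N.
  by rewrite ltnS; apply: le_truncn; rewrite ler_wpM2r ?invr_ge0 ?(ltW rho0) //; lra.
exists (Ordinal jN); rewrite /g /=.
have := truncn_itv x0; set j := Num.truncn _; rewrite ler_pdivlMr // ltr_pdivrMr //.
rewrite -natr1 mulrDl mul1r => /andP[h3 h4].
by rewrite ler_norml; apply/andP; split; lra.
Qed.

Context (T kL kU C c gamma : R) (k : R -> R -> R) (Phi : R -> R -> R -> R -> R).
Context (adm : admissible T kL kU C c k Phi).
Context (Ch : R) (hk : forall x y t, 0 < t -> t <= T -> `|k x t - k y t| <= Ch * `|x - y| `^ (1 / 2)).
Context (eqn : solves_equation T gamma k (Gamma k Phi)).

Let kL0 : 0 < kL. Proof. by case: adm => _ _ []. Qed.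
Let kb x t : kL <= k x t <= kU. Proof. by case: adm => _ _ []. Qed.
Let cpos : 0 < c. Proof. by case: adm => _ _ _ []. Qed.

(** The factor cancels the term in gamma; the claim becomes that [u] has mass 1. *)
Let u tau xi x t := expR (gamma * (t - tau)) * Gamma k Phi x t xi tau.

Let is_derive_exp (tau t : R) : is_derive t 1 (fun s : R => expR (gamma * (s - tau)))
  (gamma * expR (gamma * (t - tau))).
Proof.
have d2 : is_derive t 1 (fun s : R => gamma * (s - tau)) gamma.
  by apply: is_derive_eq; rewrite /GRing.scale /=; ring.
have := @is_derive1_comp _ expR (fun s : R => gamma * (s - tau)) t _ _ (is_derive_expR _) d2.
by rewrite mulrC.
Qed.

Lemma caloric_Gamma tau xi x t : 0 < tau -> tau < t -> t <= T ->
  caloric_at `]tau, T] k (u tau xi) x t.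
Proof.
move=> tau0 taut tT.
pose G := fun z => Gamma k Phi z t xi tau.
pose e := expR (gamma * (t - tau)).
have [_ d2 [Gt [dt E]]] := eqn xi x tau0 taut tT.
exists (fun z => e * derive1 G z), (e * derive1n 2 G x); split.
- move=> z; have [d1 _ _] := eqn xi z tau0 taut tT.
  have dz : is_derive z 1 G (derive1 G z) by rewrite derive1E; exact: derivableP.
  exact: (is_deriveZ e dz).
- have dx : is_derive x 1 (derive1 G) (derive1n 2 G x).
    by rewrite /= derive1E; exact: derivableP.
  exact: (is_deriveZ e dx).
- have := derivative_withinM (is_derive_exp tau t) dt.
  rewrite -/e; congr derivative_within.
  have -> : Gt = k x t * derive1n 2 G x - gamma * Gamma k Phi x t xi tau.
    by move: E; rewrite -/G => E; lra.
  by rewrite -/e; ring.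
Qed.


Lemma exp_mass_init tau (eta : R) : 0 < tau -> tau < T -> 0 < eta ->
  exists2 del : R, 0 < del & forall x t1, tau < t1 -> t1 < tau + del -> t1 <= T ->
    `|\int[mu]_xi u tau xi x t1 - 1| <= eta.
Proof.
move=> tau0 tauT eta0.
have [A A0 hA] := Gamma_mass_init adm hk.
(* With e the exponential and I the mass of [Gamma], eI - 1 = e(I - 1) + (e - 1); [F s] bounds this
   after an elapsed time s. *)
pose F (s : R) := expR (gamma * s) * (A * s `^ (1 / 4)) + `|expR (gamma * s) - 1|.
have cF : F s @[s --> 0^'+] --> 1 * (A * 0) + `|1 - 1|.
  have ce : expR (gamma * s) @[s --> 0^'+] --> (1 : R).
    rewrite -[X in _ --> X](@expR0 R) -[X in expR X](mulr0 gamma).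
    apply: cvg_at_right_filter.
    apply: (@continuous_comp _ _ _ (fun s : R => gamma * s) expR); last exact: continuous_expR.
    exact: mulrl_continuous.
  apply: cvgD.
    apply: cvgM; first exact: ce.
    apply: cvgM; first exact: cvg_cst.
    by apply: powR_cvg0; rewrite divr_gt0.
  by apply: cvg_norm; apply: cvgB => //; exact: cvg_cst.
rewrite subrr normr0 !mulr0 addr0 in cF.
have /cvgr0Pnorm_lt/(_ eta eta0) := cF.
rewrite /at_right /within /= => /nbhs_ballP[del /= del0 hd].
exists del => // x t1 t1tau t1del t1T.
have L0 : 0 < t1 - tau by rewrite subr_gt0.
have LT : t1 - tau <= T by lra.
have := hd (t1 - tau); rewrite /ball /= sub0r normrN ger0_norm ?(ltW L0) //.
move=> /(_ _ L0) hF.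
rewrite /u RintegralZl //; last exact: integrable_Gamma adm _ _ _ t1tau LT.
have := hA x t1 tau tau0 t1tau t1T; set I := \int[mu]_xi _; set e := expR _ => h1.
have e0 : 0 <= e by exact: expR_ge0.
have -> : e * I - 1 = e * (I - 1) + (e - 1) by ring.
apply: le_trans (ler_normD _ _) _; rewrite normrM (ger0_norm e0).
apply: le_trans (lerD (ler_wpM2l e0 h1) (lexx _)) _.
apply: le_trans (ler_norm _) _; apply: ltW; apply: hF; lra.
Qed.

(* The integral over [xi] cannot be differentiated under the sign with the
   available bounds, so it is replaced by a finite sum [S] of solutions, close
   to it at finitely many points by [finite_sampling], and the maximum principle
   is applied to [S - 1] and [1 - S]. *)
Lemma Gamma_mass x0 t0 tau : 0 < tau -> tau < t0 -> t0 <= T ->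
  \int[mu]_xi Gamma k Phi x0 t0 xi tau = expR (- (gamma * (t0 - tau))).
Proof.
move=> tau0 taut0 t0T.
have tauT : tau < T by exact: lt_le_trans t0T.
have LT0 : t0 - tau <= T by lra.
have iu x t : tau < t -> t <= T -> mu.-integrable setT (EFin \o (fun xi => u tau xi x t)).
  move=> h1 h2; have LT : t - tau <= T by lra.
  have := integrableZl measurableT (expR (gamma * (t - tau))) (integrable_Gamma adm x h1 LT).
  by apply: eq_integrable => // xi _; rewrite /= EFinM.
(* 7 = 4 (initial error of the sum) + 1 (barrier) + 1 (sampling) + 1 (tail), the last two at (x0,
   t0). *)
suff main eta : 0 < eta -> `|\int[mu]_xi u tau xi x0 t0 - 1| <= 7 * eta.
  have E1 : \int[mu]_xi u tau xi x0 t0 = 1.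
    apply/eqP; rewrite -subr_eq0 -normr_le0; apply/ler_addgt0Pl => e e0; rewrite addr0.
    by have := main (e / 7) (divr_gt0 e0 _); rewrite mulrC divfK //; apply.
  move: E1; rewrite /u RintegralZl //; last exact: integrable_Gamma adm _ _ _ taut0 LT0.
  move=> E1; rewrite expRN -[LHS](mulKf (lt0r_neq0 (expR_gt0 (gamma * (t0 - tau))))) E1 mulr1 //.
move=> eta0.
have [A1 A10 hA1] := Gamma_le adm.
have [A2 A20 hA2] := Gamma_lip adm.
have [A3 A30 hA3] := Gamma_tail adm.
have [del del0 hinit] := exp_mass_init tau0 tauT eta0.
(* Start strictly after tau, where [Gamma] is singular: on [t1, t0] it is bounded and Lipschitz in
   x, while the mass at t1 is already within eta of 1. *)
pose t1 := tau + Num.min del (t0 - tau) / 2.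
have mm0 : 0 < Num.min del (t0 - tau) by rewrite lt_min del0 subr_gt0.
have mm1 : Num.min del (t0 - tau) <= del by rewrite ge_min lexx.
have mm2 : Num.min del (t0 - tau) <= t0 - tau by rewrite ge_min lexx orbT.
have t1tau : tau < t1 by rewrite /t1; lra.
have t1t0 : t1 < t0 by rewrite /t1; lra.
have t1T : t1 <= T by lra.
have t1del : t1 < tau + del by rewrite /t1; lra.
have L1 : 0 < t1 - tau by rewrite subr_gt0.
pose E := expR (`|gamma| * T).
have E0 : 0 < E by exact: expR_gt0.
have Ele t : tau < t -> t <= T -> expR (gamma * (t - tau)) <= E.
  move=> h1 h2; rewrite ler_expR; apply: le_trans (ler_norm _) _.
  by rewrite normrM ler_wpM2l // ger0_norm; lra.
pose B1 := E * (A1 / Num.sqrt (t1 - tau)).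
have s10 : 0 < Num.sqrt (t1 - tau) by rewrite sqrtr_gt0.
have B10 : 0 <= B1 by rewrite mulr_ge0 ?(ltW E0) // divr_ge0 // ltW.
have c20 : 0 < c / 2 by rewrite divr_gt0.
have uB xi x t : t1 <= t <= t0 -> `|u tau xi x t| <= B1.
  move=> /andP[h1 h2].
  have h3 : tau < t by exact: lt_le_trans h1.
  have h4 : t <= T by exact: le_trans t0T.
  have h5 : 0 < t - tau by rewrite subr_gt0.
  rewrite normrM (ger0_norm (expR_ge0 _)); apply: ler_pM => //; first exact: Ele.
  apply: le_trans (hA1 _ _ _ _ h3 _) _; first by lra.
  rewrite -[leRHS]mulr1; apply: ler_pM; rewrite ?gauss_ge0 ?gauss_le1 ?(ltW c20) //.
    by rewrite divr_ge0 // sqrtr_ge0.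
  rewrite ler_wpM2l // lef_pV2 ?posrE ?sqrtr_gt0 // ler_wsqrtr //; lra.
pose Lip := E * (2 * A2 / (t1 - tau)).
have Lip0 : 0 <= Lip by rewrite mulr_ge0 ?(ltW E0) // divr_ge0 ?mulr_ge0 // ltW.
have uL xi x y t : t1 <= t <= t0 -> `|u tau xi x t - u tau xi y t| <= Lip * `|x - y|.
  move=> /andP[h1 h2].
  have h3 : tau < t by exact: lt_le_trans h1.
  have h4 : t <= T by exact: le_trans t0T.
  have h5 : 0 < t - tau by rewrite subr_gt0.
  rewrite -mulrBr normrM (ger0_norm (expR_ge0 _)) /Lip -mulrA.
  apply: ler_pM => //; first exact: Ele.
  apply: le_trans (hA2 _ _ _ _ _ h3 _) _; first by lra.
  apply: (@le_trans _ _ (A2 * `|x - y| / (t - tau) * 2)).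
    rewrite ler_wpM2l ?divr_ge0 ?mulr_ge0 ?(ltW h5) //.
    by apply: (@le_trans _ _ (1 + 1)) => //; apply: lerD; rewrite gauss_le1 // ltW.
  have -> : A2 * `|x - y| / (t - tau) * 2 = 2 * A2 * `|x - y| * (t - tau)^-1 by ring.
  have -> : 2 * A2 / (t1 - tau) * `|x - y| = 2 * A2 * `|x - y| * (t1 - tau)^-1 by ring.
  rewrite ler_wpM2l ?mulr_ge0 // lef_pV2 ?posrE //; lra.
have utail x t M : t1 <= t <= t0 -> 0 < M -> `|x| <= M / 2 ->
    `|\int[mu]_xi u tau xi x t - \int[mu]_(xi in `[- M, M]) u tau xi x t| <= E * (A3 / M).
  move=> /andP[h1 h2] M0 xM.
  have h3 : tau < t by exact: lt_le_trans h1.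
  have h4 : t <= T by exact: le_trans t0T.
  have LT : t - tau <= T by lra.
  have mI : measurable (`[- M, M]%classic : set (measurableTypeR R)) by exact: measurable_itv.
  have i1 := integrable_Gamma adm x h3 LT.
  have i2 := integrableS measurableT mI (@subsetT _ _) i1.
  rewrite /u !RintegralZl // -mulrBr normrM (ger0_norm (expR_ge0 _)).
  by apply: ler_pM => //; [exact: Ele|exact: hA3].
have kU0 : 0 <= kU.
  by have /andP[h1 h2] := kb 0 0; exact: le_trans (ltW kL0) (le_trans h1 h2).
pose Q := x0 ^+ 2 + (2 * kU + 1) * (t0 - t1).
have Q0 : 0 <= Q.
  rewrite addr_ge0 ?sqr_ge0 // mulr_ge0 ?subr_ge0 ?(ltW t1t0) // addr_ge0 // mulr_ge0 //.
(* [Q] is the value at (x0, t0) of the barrier without its factor, which thus costs at most eta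
   there. *)
pose eps := eta / (1 + Q).
have eps0 : 0 < eps by rewrite divr_gt0 // ltr_wpDr.
have epsQ : eps * Q <= eta.
  by rewrite /eps mulrAC ler_pdivrMr ?ltr_wpDr // ler_wpM2l ?(ltW eta0) // lerDr.
clearbody eps B1 Lip E t1.
(* The terms in turn give M >= 1, |x0| <= M/2, a tail of at most eta, and [MB]. The last is possible
   because the weights sum to 2M whatever the number of samples: the bound on the sum is linear in
   M, the barrier at |x| = M/2 quadratic. *)
pose M := 1 + 2 * `|x0| + E * A3 / eta + 4 * (2 * B1 + 1) / eps.
have EA : 0 <= E * A3 / eta by rewrite divr_ge0 ?mulr_ge0 // ltW.
have EB : 0 <= 4 * (2 * B1 + 1) / eps by apply: divr_ge0; [lra|exact: ltW].
have nx0 := normr_ge0 x0.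
have M1 : 1 <= M by rewrite /M; lra.
have M0 : 0 < M by exact: lt_le_trans M1.
have Mx0 : `|x0| <= M / 2 by rewrite /M; lra.
have MA : E * (A3 / M) <= eta.
  rewrite mulrA ler_pdivrMr // -ler_pdivrMl // mulrC /M; lra.
have MB : 2 * M * B1 + 1 <= eps * (M / 2) ^+ 2.
  have h1 : 2 * B1 + 1 <= eps * M / 4.
    rewrite ler_pdivlMr // -ler_pdivrMl // mulrC (mulrC _ 4) /M; lra.
  have -> : eps * (M / 2) ^+ 2 = (eps * M / 4) * M by field.
  apply: le_trans (ler_wpM2r (ltW M0) h1); rewrite mulrDl; lra.
clearbody M.
pose X := M / 2.
have X0 : 0 < X by rewrite divr_gt0.
(* 2M Lip is a Lipschitz constant of every sum of total weight 2M, so the net can be fixed before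
   the samples. *)
pose rho := eta / (2 * M * Lip + 1).
have ML0 : 0 <= 2 * M * Lip by exact: mulr_ge0 (mulr_ge0 (ler0n _ 2) (ltW M0)) Lip0.
have rho0 : 0 < rho by rewrite divr_gt0 // ltr_wpDl.
have [n [g [gX hg]]] := grid X0 rho0.
(* The integrals to be sampled simultaneously: those at the net points at time t1, and, for [None],
   the one at (x0, t0). *)
pose h (j : option 'I_n) (xi : R) :=
  if j is Some i then u tau xi (g i) t1 else u tau xi x0 t0.
pose D := (`[- M, M]%classic : set (measurableTypeR R)).
have mD : measurable D by exact: measurable_itv.
have muD : mu D = (2 * M)%:E.
  rewrite lebesgue_measure_itv /= lte_fin.
  have -> : - M < M by rewrite gtrN.
  by rewrite -EFinB; congr EFin; ring.
have mu_ x t : measurable_fun [set: R] (fun xi => u tau xi x t).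
  by apply: measurable_funM => //; exact: (measurable_Gamma_xi adm).
have e0 : 0 < eta / (2 * M) by rewrite divr_gt0 // mulr_gt0.
have MM0 : 0 < 2 * M by rewrite mulr_gt0.
have fD : fine (mu D) = 2 * M by rewrite muD.
have muDlt : (mu D < +oo)%E by rewrite muD ltry.
have [I [w [z [w0 Dz sw hw]]]] : exists (I : finType) (w : I -> R) (z : I -> R),
    [/\ forall i, 0 <= w i, forall i, D (z i), \sum_i w i = 2 * M &
        forall j, `|\int[mu]_(x in D) h j x - \sum_i w i * h j (z i)| <= eta].
  have := @finite_sampling _ _ R mu _ h D 0 B1 (eta / (2 * M)) mD _ _ _ _ e0.
  rewrite fD divfK ?gt_eqF //; apply.
  - exact: muDlt.
  - by rewrite /D /= in_itv /= oppr_le0 (ltW M0).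
  - by case=> [j|]; exact: mu_.
  - by case=> [j|] xi _; apply: uB; rewrite lexx ltW.
pose S x t := \sum_(i <- enum I) w i * u tau (z i) x t.
have SE x t : S x t = \sum_i w i * u tau (z i) x t by rewrite /S big_enum.
have SB x t : t1 <= t <= t0 -> `|S x t| <= 2 * M * B1.
  move=> ht; rewrite SE -sw mulr_suml; apply: le_trans (ler_norm_sum _ _ _) _.
  apply: ler_sum => i _; rewrite normrM ger0_norm // ler_wpM2l //; exact: uB.
have SL x y t : t1 <= t <= t0 -> `|S x t - S y t| <= 2 * M * Lip * `|x - y|.
  move=> ht; rewrite !SE -sumrB -sw -mulrA mulr_suml; apply: le_trans (ler_norm_sum _ _ _) _.
  by apply: ler_sum => i _; rewrite -mulrBr normrM ger0_norm // ler_wpM2l //; exact: uL.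
(* Four errors of size eta: from x to a net point, sampling, tail, and mass at short time. *)
have S1 x : `|x| <= X -> `|S x t1 - 1| <= 4 * eta.
  move=> xX; have [j hj] := hg x xX.
  have t11 : t1 <= t1 <= t0 by rewrite lexx ltW.
  have e1 : `|S x t1 - S (g j) t1| <= eta.
    apply: le_trans (SL _ _ _ t11) _; apply: le_trans (ler_wpM2l ML0 hj) _.
    rewrite /rho mulrA ler_pdivrMr ?ltr_wpDl // mulrC ler_wpM2l ?(ltW eta0) // lerDl //.
  have e2 := hw (Some j); rewrite /= -SE in e2.
  have e3 := le_trans (utail (g j) t1 M t11 M0 (gX j)) MA.
  have e4 := hinit (g j) t1 t1tau t1del t1T.
  rewrite -/D in e3.
  move: e1 e2 e3 e4; set a1 := S x t1; set a2 := S _ t1; set a3 := \int[mu]_(x in D) _.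
  by set a4 := \int[mu]_xi _; exact: dist_chain4.
have Aab s : t1 <= s <= t0 -> `]tau, T]%classic s.
  by move=> /andP[h1 h2]; rewrite /= in_itv /= (lt_le_trans t1tau h1) (le_trans h2 t0T).
have kab x t : t1 <= t <= t0 -> 0 <= k x t <= kU.
  by move=> _; have /andP[h1 h2] := kb x t; rewrite h2 (le_trans (ltW kL0)).
have calS x t : t1 <= t <= t0 -> caloric_at `]tau, T] k S x t.
  move=> /andP[h1 h2]; apply: caloric_at_sum => i _; apply: caloric_Gamma => //.
    exact: lt_le_trans h1.
  exact: le_trans h2 t0T.
clearbody S.
have cal1 x t : caloric_at `]tau, T] k (fun=> fun=> 1) x t by exact: caloric_at_cst.
have bnd v : (forall x t, t1 <= t <= t0 -> caloric_at `]tau, T] k v x t) ->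
    (forall x t, t1 <= t <= t0 -> `|v x t| <= 2 * M * B1 + 1) ->
    (forall x y t, t1 <= t <= t0 -> `|v x t - v y t| <= 2 * M * Lip * `|x - y|) ->
    (forall x, `|x| <= X -> `|v x t1| <= 4 * eta) -> v x0 t0 <= 5 * eta.
  move=> vcal vB vL v1.
  have h1 := @maximum_principle _ _ k v t1 t0 kU (2 * M * B1 + 1) (2 * M * Lip) (4 * eta) eps X
    X0 eps0 Aab kab vcal _ vL _ _ x0 t0 _.
  have h2 : v x0 t0 <= 4 * eta + eps * Q.
    apply: h1.
    - by move=> x t ht; exact: le_trans (ler_norm _) (vB x t ht).
    - by move=> x xX; exact: le_trans (ler_norm _) (v1 x xX).
    - apply: le_trans MB _; rewrite lerDr mulr_ge0 // ltW //.
    - by rewrite lexx andbT ltW.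
  apply: le_trans h2 _; have -> : 5 * eta = 4 * eta + eta by ring.
  by rewrite lerD2l.
have up : S x0 t0 - 1 <= 5 * eta.
  rewrite -(mulN1r 1).
  apply: (bnd (fun x t => S x t + (-1) * 1)).
  - by move=> x t ht; apply: caloric_atD; [exact: calS|exact: cal1].
  - move=> x t ht; rewrite mulN1r; apply: le_trans (ler_normB _ _) _.
    by rewrite normr1 lerD2r SB.
  - move=> x y t ht /=; rewrite opprD addrACA subrr addr0; exact: SL.
  - by move=> x xX; rewrite mulN1r; exact: S1.
have lo : 1 - S x0 t0 <= 5 * eta.
  rewrite -mulN1r.
  apply: (bnd (fun x t => 1 + (-1) * S x t)).
  - by move=> x t ht; apply: caloric_atD; [exact: cal1|exact: calS].
  - move=> x t ht; rewrite mulN1r; apply: le_trans (ler_normB _ _) _.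
    by rewrite normr1 addrC lerD2r SB.
  - move=> x y t ht /=; rewrite !mulN1r opprD addrACA subrr add0r opprK addrC distrC; exact: SL.
  - by move=> x xX; rewrite mulN1r distrC; exact: S1.
have e1 := hw None; rewrite /= -SE in e1.
have t00 : t1 <= t0 <= t0 by rewrite lexx andbT ltW.
have e2 := le_trans (utail x0 t0 M t00 M0 Mx0) MA.
rewrite -/D in e2.
move: e1 e2 up lo; set a1 := S _ _; set a2 := \int[mu]_(x in D) _; set a3 := \int[mu]_xi _.
exact: dist_chain7.
Qed.

End conservation.

(** * The spatial derivative of the fundamental solution *)

Section spatial_derivative.
Context {R : realType}.
Local Notation mu := (@lebesgue_measure R).

(** (r + h)^2 >= r^2/2 - h^2, the defect being (r + 2h)^2/2. One Gaussian thereby dominates all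
    small translates, as dominated convergence requires. *)
Lemma gauss_shift_le (e r h p : R) : 0 <= e -> 0 < p ->
  gauss e (r + h) p <= expR (e * h ^+ 2 / p) * gauss (e / 2) r p.
Proof.
move=> e0 p0; rewrite /gauss -expRD ler_expR.
have -> : e * h ^+ 2 / p + - (e / 2 * r ^+ 2 / p) =
  - (e * (r + h) ^+ 2 / p) + e / 2 * (r + 2 * h) ^+ 2 / p by field; rewrite gt_eqF.
rewrite lerDl; apply: divr_ge0; last exact: ltW.
by apply: mulr_ge0; [lra|exact: sqr_ge0].
Qed.

Lemma continuous_gauss (e p : R) : continuous (fun r : R => gauss e r p).
Proof.
move=> r; apply: (@continuous_comp _ _ _ (fun r : R => - (e * r ^+ 2 / p)) expR); last exact: continuous_expR.
apply: cvgN; apply: cvgM; last exact: cvg_cst.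
by apply: cvgM; [exact: cvg_cst|exact: exprn_continuous].
Qed.

Lemma cvg_invn : n.+1%:R^-1 @[n --> \oo] --> (0 : R).
Proof.
apply/cvgr0Pnorm_lt => e e0; have := near_infty_natSinv_lt (PosNum e0).
by apply: filterS => n /=; rewrite ger0_norm.
Qed.

Lemma cvg_quotient_invn (f : R -> R) (x l : R) : is_derive x 1 f l ->
  n.+1%:R * (f (x + n.+1%:R^-1) - f x) @[n --> \oo] --> l.
Proof.
move=> df; apply/cvgrPdist_lt => e e0.
have [del del0 hd] := is_derive1P df e0.
have := near_infty_natSinv_lt (PosNum del0).
apply: filterS => n /= hn; rewrite distrC.
have n0 : 0 < n.+1%:R^-1 :> R by rewrite invr_gt0.
have := hd (x + n.+1%:R^-1); rewrite (addrC x) addrK invrK mulrC.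
by apply; rewrite ?ger0_norm ?(ltW n0) // -subr_eq0 addrK gt_eqF.
Qed.

Context (T kL kU C c gamma : R) (k : R -> R -> R) (Phi : R -> R -> R -> R -> R).
Context (adm : admissible T kL kU C c k Phi).
Context (Ch : R) (hk : forall x y t, 0 < t -> t <= T -> `|k x t - k y t| <= Ch * `|x - y| `^ (1 / 2)).
Context (eqn : solves_equation T gamma k (Gamma k Phi)).

Let cpos : 0 < c. Proof. by case: adm => _ _ _ []. Qed.
Let c20 : 0 < c / 2. Proof. by rewrite divr_gt0. Qed.

Let q (n : nat) x t xi tau :=
  n.+1%:R * (Gamma k Phi (x + n.+1%:R^-1) t xi tau - Gamma k Phi x t xi tau).

Let q_cvg x t xi tau : 0 < tau -> tau < t -> t <= T ->
  q n x t xi tau @[n --> \oo] --> Gamma_x k Phi x t xi tau.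
Proof.
move=> tau0 taut tT; have [d1 _ _] := eqn xi x tau0 taut tT.
apply: (@cvg_quotient_invn (fun z => Gamma k Phi z t xi tau)).
by rewrite /Gamma_x derive1E; exact: derivableP.
Qed.

Let q_le : exists2 A : R, 0 <= A & forall n x t xi tau, tau < t -> t - tau <= T ->
  `|q n x t xi tau| <= A / (t - tau) *
    (gauss (c / 2) (x + n.+1%:R^-1 - xi) (t - tau) + gauss (c / 2) (x - xi) (t - tau)).
Proof.
have [A A0 hA] := Gamma_lip adm; exists A => // n x t xi tau taut LT.
rewrite normrM ger0_norm //.
apply: le_trans (ler_wpM2l _ (hA _ _ _ _ _ taut LT)) _ => //.
rewrite (addrC x) addrK ger0_norm ?invr_ge0 //.
rewrite le_eqVlt; apply/orP; left; apply/eqP; field.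
by rewrite gt_eqF ?subr_gt0 //= pnatr_eq0.
Qed.

(** A limit of measurable quotients, on the set where the equation guarantees the derivative. *)
Lemma measurable_Gamma_x : measurable_fun (@times_ordered R T)
  (fun z => Gamma_x k Phi z.1.1 z.1.2 z.2.1 z.2.2).
Proof.
apply: (@measurable_fun_cvg _ _ _ _ (fun n z => q n z.1.1 z.1.2 z.2.1 z.2.2)); last first.
  by move=> z [h1 [h2 h3]]; exact: q_cvg.
move=> n; apply: measurable_funTS.
have m11 : measurable_fun [set: (R * R) * (R * R)] (fun z => z.1.1) by exact: measurableT_comp.
have m12 : measurable_fun [set: (R * R) * (R * R)] (fun z => z.1.2) by exact: measurableT_comp.
have m21 : measurable_fun [set: (R * R) * (R * R)] (fun z => z.2.1) by exact: measurableT_comp.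
have m22 : measurable_fun [set: (R * R) * (R * R)] (fun z => z.2.2) by exact: measurableT_comp.
have mG := measurable_Gamma adm.
apply: measurable_funM => //; apply: measurable_funB.
  by apply: (@measurable_fun4 _ _ R (Gamma k Phi)) => //; exact: measurable_funD.
by apply: (@measurable_fun4 _ _ R (Gamma k Phi)).
Qed.

Lemma Gamma_x_le : exists2 A : R, 0 <= A & forall x t xi tau, 0 < tau -> tau < t -> t <= T ->
  `|Gamma_x k Phi x t xi tau| <= A / (t - tau) * gauss (c / 2) (x - xi) (t - tau).
Proof.
have [A A0 hA] := q_le; exists (A * 2); first by rewrite mulr_ge0.
move=> x t xi tau tau0 taut tT; have LT : t - tau <= T by lra.
have h1 : `|q n x t xi tau| @[n --> \oo] --> `|Gamma_x k Phi x t xi tau|.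
  by apply: cvg_norm; exact: q_cvg.
set g := gauss _ _ _.
have h2 : A / (t - tau) * (gauss (c / 2) (x + n.+1%:R^-1 - xi) (t - tau) + g) @[n --> \oo]
    --> A / (t - tau) * (gauss (c / 2) (x + 0 - xi) (t - tau) + g).
  apply: cvgM; first exact: cvg_cst.
  apply: cvgD; last exact: cvg_cst.
  have cx : x + n.+1%:R^-1 - xi @[n --> \oo] --> x + 0 - xi.
    by apply: cvgB; [apply: cvgD; [exact: cvg_cst|exact: cvg_invn]|exact: cvg_cst].
  exact: (cvg_comp _ _ cx (@continuous_gauss (c / 2) (t - tau) (x + 0 - xi))).
rewrite addr0 -/g in h2.
have := ler_cvg_to h1 h2; rewrite (_ : A * 2 / (t - tau) * g = A / (t - tau) * (g + g)); last by ring.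
by apply; apply: nearW => n; exact: hA.
Qed.

(** The mass given by [Gamma_mass] is independent of x, so every quotient has integral 0; dominated
    convergence carries this to the limit. *)
Lemma integral_Gamma_x0 x t tau : 0 < tau -> tau < t -> t <= T ->
  mu.-integrable setT (EFin \o (fun xi => Gamma_x k Phi x t xi tau)) /\
  \int[mu]_xi Gamma_x k Phi x t xi tau = 0.
Proof.
move=> tau0 taut tT; have LT : t - tau <= T by lra.
have L0 : 0 < t - tau by rewrite subr_gt0.
have [A A0 hA] := q_le.
(* The exponential bounds the translated Gaussian, the steps being at most 1; the + 1 is for the one
   at x itself. *)
pose K := expR (c / 2 * 1 ^+ 2 / (t - tau)) + 1.
pose g xi := A / (t - tau) * K * gauss (c / 2 / 2) (x - xi) (t - tau).
have K1 : 1 <= K by rewrite /K lerDr expR_ge0.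
have c40 : 0 < c / 2 / 2 by rewrite divr_gt0.
have qg n xi : `|q n x t xi tau| <= g xi.
  apply: le_trans (hA n x t xi tau taut LT) _.
  rewrite /g -(mulrA (A / (t - tau))) ler_wpM2l ?divr_ge0 ?(ltW L0) // /K mulrDl mul1r; apply: lerD.
    have -> : x + n.+1%:R^-1 - xi = (x - xi) + n.+1%:R^-1 by ring.
    apply: le_trans (gauss_shift_le _ _ (ltW c20) L0) _.
    rewrite ler_wpM2r ?gauss_ge0 // ler_expR ler_wpM2r ?invr_ge0 ?(ltW L0) //.
    rewrite ler_wpM2l ?(ltW c20) // lerXn2r ?nnegrE ?invr_ge0 //.
    by rewrite invf_le1 // ler1n.
  by apply: le_gauss => //; rewrite ler_pdivrMr // ler_peMr ?(ltW c20) // ler1n.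
have mq n : measurable_fun [set: R] (fun xi => q n x t xi tau).
  apply: measurable_funM => //.
  by apply: measurable_funB; exact: (measurable_Gamma_xi adm).
have mg : measurable_fun [set: R] g.
  by apply: measurable_funM => //; apply: measurable_gaussT => //; exact: measurable_funB.
have ig : mu.-integrable setT (EFin \o g).
  have [|//] := @gauss_dominated _ g (A / (t - tau) * K) x (t - tau) (c / 2 / 2) c40 L0 mg.
  move=> xi; rewrite ger0_norm // !mulr_ge0 ?gauss_ge0 ?invr_ge0 ?(ltW L0) //.
  exact: le_trans K1.
have qcv xi : (q n x t xi tau)%:E @[n --> \oo] --> (Gamma_x k Phi x t xi tau)%:E.
  by apply: cvg_EFin; [exact: nearW|exact: q_cvg].
have mGx : measurable_fun [set: R] (EFin \o (fun xi => Gamma_x k Phi x t xi tau)).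
  by apply/measurable_EFinP; apply: (measurable_fun_cvg mq) => xi _; exact: q_cvg.
have mqE n : measurable_fun [set: R] (fun xi => (q n x t xi tau)%:E) by exact/measurable_EFinP.
have [||i1 _ lim] := @dominated_convergence _ _ _ mu setT measurableT
  (fun n xi => (q n x t xi tau)%:E) (fun xi => (Gamma_x k Phi x t xi tau)%:E) (EFin \o g)
  mqE mGx _ ig _.
- by apply: aeW => xi _; exact: qcv.
- by apply: aeW => xi n _; rewrite lee_fin; exact: qg.
split => //.
have q0 n : (\int[mu]_xi (q n x t xi tau)%:E = 0)%E.
  have iG z := integrable_Gamma adm z taut LT.
  have iq : mu.-integrable setT (EFin \o (fun xi => q n x t xi tau)).
    apply: le_integrable ig => //; first exact: (mqE n).
    by move=> xi _; rewrite /= lee_fin (le_trans (qg n xi)) // ler_norm.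
  rewrite -(fineK (integrable_fin_num measurableT iq)) -[X in X%:E]/(\int[mu]_xi q n x t xi tau).
  rewrite RintegralZl //; last first.
    have := integrableB measurableT (iG (x + n.+1%:R^-1)) (iG x).
    by apply: eq_integrable => // xi _; rewrite /= EFinB.
  rewrite (RintegralB measurableT (iG (x + n.+1%:R^-1)) (iG x)).
  have m1 := Gamma_mass adm hk eqn (x + n.+1%:R^-1) tau0 taut tT.
  have m2 := Gamma_mass adm hk eqn x tau0 taut tT.
  set e := expR _ in m1 m2.
  rewrite [X in (_ * X)%:E](_ : _ = e - e); first by rewrite subrr mulr0.
  by congr (_ - _); [exact: m1|exact: m2].
have seq0 : [sequence (\int[mu]_xi (q n x t xi tau)%:E)%E]_n = (fun=> 0%E) by apply/funext.
have lim0 : (fun=> 0 : \bar R)%E @ \oo --> (\int[mu]_xi (Gamma_x k Phi x t xi tau)%:E)%E.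
  by rewrite -seq0; exact: lim.
have E : (\int[mu]_xi (Gamma_x k Phi x t xi tau)%:E = 0)%E.
  by apply/esym; apply: (cvg_unique _ _ lim0) => //; exact: cvg_cst.
by rewrite /Rintegral E.
Qed.

End spatial_derivative.

(** * L2 estimates for potentials *)

Section schur_test.
Context {R : realType}.

(** Obtained from |f| <= (lam + f^2/lam)/2, as the integrals may be infinite: lam = 1 shows the left
    one finite when the right one is, and lam = i/S, with i its value, is the choice that gives the
    product. *)
Lemma cauchy_schwarz_weighted d (U : measurableType d) (m : {measure set U -> \bar R})
    (K f : U -> R) (S : R) :
  measurable_fun [set: U] K -> measurable_fun [set: U] f ->
  (forall z, 0 <= K z) -> 0 < S -> (\int[m]_z (K z)%:E <= S%:E)%E ->
  ((\int[m]_z (K z * `|f z|)%:E) * (\int[m]_z (K z * `|f z|)%:E) <=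
    S%:E * \int[m]_z (K z * f z ^+ 2)%:E)%E.
Proof.
move=> mK mf K0 S0 KS.
have mKf : measurable_fun [set: U] (fun z => (K z * `|f z|)%:E).
  by apply/measurable_EFinP; apply: measurable_funM => //; exact: measurableT_comp.
have mKf2 : measurable_fun [set: U] (fun z => (K z * f z ^+ 2)%:E).
  by apply/measurable_EFinP; apply: measurable_funM => //; exact: measurable_funX.
have mKE : measurable_fun [set: U] (fun z => (K z)%:E) by exact/measurable_EFinP.
have Kf2 z : (0 <= (K z * f z ^+ 2)%:E)%E.
  by rewrite lee_fin; apply: mulr_ge0 => //; exact: sqr_ge0.
have I0 : (0 <= \int[m]_z (K z * `|f z|)%:E)%E.
  by apply: integral_ge0 => z _; rewrite lee_fin mulr_ge0.
have Q0 : (0 <= \int[m]_z (K z * f z ^+ 2)%:E)%E by exact: integral_ge0.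
have bound (lam : R) : 0 < lam -> (\int[m]_z (K z * `|f z|)%:E <=
    (lam / 2 * S)%:E + (lam^-1 / 2)%:E * \int[m]_z (K z * f z ^+ 2)%:E)%E.
  move=> lam0.
  have lam20 : 0 <= lam / 2 by rewrite divr_ge0 // ltW.
  have lamV0 : 0 <= lam^-1 / 2 by rewrite divr_ge0 // invr_ge0 ltW.
  apply: (@le_trans _ _ (\int[m]_z ((lam / 2)%:E * (K z)%:E + (lam^-1 / 2)%:E * (K z * f z ^+ 2)%:E))%E).
    apply: ge0_le_integral => //.
    - by move=> z _; rewrite lee_fin mulr_ge0.
    - by apply: emeasurable_funD; exact: measurable_funeM.
    - move=> z _; rewrite -!EFinM -EFinD lee_fin.
      have -> : lam / 2 * K z + lam^-1 / 2 * (K z * f z ^+ 2) =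
          K z * ((lam + lam^-1 * f z ^+ 2) / 2) by ring.
      rewrite ler_wpM2l // ler_pdivlMr //.
      have -> : lam + lam^-1 * f z ^+ 2 = `|f z| * 2 + lam^-1 * (lam - `|f z|) ^+ 2.
        by rewrite -(real_normK (num_real (f z))); field; rewrite gt_eqF.
      by rewrite lerDl; apply: mulr_ge0; [rewrite invr_ge0 ltW|exact: sqr_ge0].
  rewrite ge0_integralD //; last 4 first.
  - by move=> z _; rewrite -EFinM lee_fin mulr_ge0.
  - exact: measurable_funeM.
  - by move=> z _; rewrite mule_ge0 // lee_fin.
  - exact: measurable_funeM.
  rewrite !ge0_integralZl ?lee_fin //; last by move=> z _; rewrite lee_fin.
  by apply: leeD => //; rewrite (EFinM (lam / 2) S) lee_wpmul2l ?lee_fin.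
move: I0 Q0 bound; case: (\int[m]_z (K z * f z ^+ 2)%:E)%E => [q| |] // I0 Q0 bound; last first.
  by rewrite gt0_muley ?lte_fin // leey.
have : (\int[m]_z (K z * `|f z|)%:E < +oo)%E.
  by apply: le_lt_trans (bound 1 ltr01) _; rewrite -EFinM -EFinD ltry.
move: I0 bound; case: (\int[m]_z (K z * `|f z|)%:E)%E => [i| |] // I0 bound _.
rewrite -!EFinM lee_fin; rewrite lee_fin in I0 Q0.
have [i0|i0] := eqVneq i 0; first by rewrite i0 mul0r mulr_ge0 // ltW.
have {}i0 : 0 < i by rewrite lt_neqAle eq_sym i0.
have := bound (i / S) (divr_gt0 i0 S0); rewrite -EFinM -EFinD lee_fin.
have -> : i / S / 2 * S + (i / S)^-1 / 2 * q = i / 2 + S * q / i / 2.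
  by field; rewrite !gt_eqF.
move=> h; have {}h : i <= S * q / i by lra.
by rewrite -ler_pdivlMr.
Qed.

(** The column integrals are not assumed bounded, only integrated against f^2: in the application
    they depend on tau alone and blow up as tau tends to t, but remain integrable in time. *)
Lemma schur_test d (U : measurableType d) (m : {sigma_finite_measure set U -> \bar R})
    d' (V : measurableType d') (n : {sigma_finite_measure set V -> \bar R})
    (K : V -> U -> R) (f : U -> R) (S M : R) :
  measurable_fun [set: V * U] (fun z => K z.1 z.2) -> measurable_fun [set: U] f ->
  (forall x z, 0 <= K x z) -> 0 < S ->
  (forall x, \int[m]_z (K x z)%:E <= S%:E)%E ->
  (\int[m]_z ((f z ^+ 2)%:E * \int[n]_x (K x z)%:E) <= (S * M)%:E)%E ->
  (\int[n]_x ((\int[m]_z (K x z * `|f z|)%:E) * (\int[m]_z (K x z * `|f z|)%:E)) <=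
    (S * (S * M))%:E)%E.
Proof.
move=> mK mf K0 S0 KS KM.
have mKx x : measurable_fun [set: U] (K x).
  exact: (@measurableT_comp _ _ _ _ _ _ (fun z : V * U => K z.1 z.2) _ (pair x) mK (pair1_measurable x)).
have mKz z : measurable_fun [set: V] (fun x => K x z).
  exact: (@measurableT_comp _ _ _ _ _ _ (fun z : V * U => K z.1 z.2) _ (pair^~ z) mK (pair2_measurable z)).
have mf2 : measurable_fun [set: V * U] (fun w => f w.2) by exact: measurableT_comp.
have mI : measurable_fun [set: V] (fun x => \int[m]_z (K x z * `|f z|)%:E)%E.
  apply: (@measurable_fun_integral R _ _ _ _ m (fun w => (K w.1 w.2 * `|f w.2|)%:E)).
  by apply/measurable_EFinP; apply: measurable_funM => //; exact: measurableT_comp.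
have mKf2 : measurable_fun [set: V * U] (fun w => (K w.1 w.2 * f w.2 ^+ 2)%:E).
  by apply/measurable_EFinP; apply: measurable_funM => //; exact: measurable_funX.
have mJ : measurable_fun [set: V] (fun x => \int[m]_z (K x z * f z ^+ 2)%:E)%E.
  exact: (@measurable_fun_integral R _ _ _ _ m _ mKf2).
have Kf2 x z : (0 <= (K x z * f z ^+ 2)%:E)%E.
  by rewrite lee_fin; apply: mulr_ge0 => //; exact: sqr_ge0.
apply: (@le_trans _ _ (\int[n]_x (S%:E * \int[m]_z (K x z * f z ^+ 2)%:E))%E).
  apply: ge0_le_integral => //.
  - by move=> x _; rewrite mule_ge0 // integral_ge0 // => z _; rewrite lee_fin mulr_ge0.
  - exact: emeasurable_funM.
  - exact: measurable_funeM.
  - by move=> x _; exact: cauchy_schwarz_weighted.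
rewrite ge0_integralZl ?lee_fin ?(ltW S0) //; last by move=> x _; exact: integral_ge0.
rewrite EFinM lee_wpmul2l ?lee_fin ?(ltW S0) //.
rewrite (@fubini_tonelli _ _ _ _ _ n m (fun w => (K w.1 w.2 * f w.2 ^+ 2)%:E) mKf2) /=; last first.
  by move=> w; exact: Kf2.
apply: le_trans KM; rewrite le_eqVlt; apply/orP; left; apply/eqP.
apply: eq_integral => z _.
rewrite -ge0_integralZl //.
- by apply: eq_integral => x _; rewrite mulrC EFinM.
- exact/measurable_EFinP.
- by move=> x _; rewrite lee_fin.
- by rewrite lee_fin sqr_ge0.
Qed.

End schur_test.

(** * L2 norms on a strip and measurability of potentials *)

Section L2_norm.
Context {R : realType}.
Local Notation mu := (@lebesgue_measure R).

Lemma poweR2 (x : \bar R) : (0 <= x)%E -> (x `^ 2 = x * x)%E.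
Proof.
move=> x0; rewrite -[2]/((1 + 1)%R) poweRD ?poweRe1 //.
by apply: add_neq0_poweRD_def; rewrite gt_eqF.
Qed.

Lemma measurable_Omega_bar (del : R) : measurable (Omega_bar del).
Proof. by apply: measurableX => //; exact: measurable_itv. Qed.

Lemma L2_norm_leI (W : R -> R -> \bar R) (del K : R) : 0 <= K ->
  measurable_fun [set: R * R] (fun z => W z.1 z.2) ->
  (\int[mu]_(t in `[0%R, del]) \int[mu]_x (`|W x t| * `|W x t|) <= (K ^+ 2)%:E)%E ->
  L2_norm_le (Omega_bar del) W K.
Proof.
move=> K0 mW hW; split; first exact: measurable_funTS.
set F := _ \_ _.
have mD := measurable_Omega_bar del.
have mF : measurable_fun [set: R * R] F.
  exact: (iffLR (measurable_restrictT _ mD) (measurable_funTS mW)).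
have mF2 : measurable_fun [set: R * R] (fun z => `|F z| * `|F z|)%E.
  by apply: emeasurable_funM; exact: measurableT_comp.
have E : (\int[(mu \x mu)%E]_z (`|F z| `^ 2) <= (K ^+ 2)%:E)%E.
  under eq_integral do rewrite poweR2 ?abse_ge0 //.
  rewrite (@fubini_tonelli2 _ _ _ _ _ mu mu (fun z => `|F z| * `|F z|)%E mF2); last first.
    by move=> z; rewrite mule_ge0.
  apply: le_trans hW; rewrite [X in (_ <= X)%E]integral_mkcond.
  rewrite le_eqVlt; apply/orP; left; apply/eqP; apply: eq_integral => t _.
  rewrite /fubini_G patchE; case: ifPn => [|] ht.
    apply: eq_integral => x _; rewrite /F patchE mem_set //=.
    by split => //=; move: ht; rewrite inE.
  apply: integral0_eq => x _; rewrite /F patchE memNset ?abse0 ?mul0e //.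
  by move=> -[_ /=] h; move: ht; rewrite notin_setE /=.
rewrite unlock.
have -> : (K%:E = (K ^+ 2)%:E `^ 2^-1)%E.
  by rewrite poweR_EFin powR12_sqrt ?sqr_ge0 // sqrtr_sqr ger0_norm.
apply: gt0_ler_poweR => //; rewrite in_itv /= leey andbT.
- by apply: integral_ge0 => z _; exact: poweR_ge0.
- by rewrite lee_fin sqr_ge0.
Qed.

Lemma measurable_potential (N : R -> R -> R -> R -> R) (g : R -> R -> R) :
  measurable_fun [set: (R * R) * (R * R)] (fun z => N z.1.1 z.1.2 z.2.1 z.2.2) ->
  measurable_fun [set: R * R] (fun z => g z.1 z.2) ->
  measurable_fun [set: R * R] (fun z => potential N g z.1 z.2).
Proof.
move=> mN mg; pose V := ((R * R) * R)%type.
have mI : measurable_fun [set: V]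
    (fun w => \int[mu]_xi (N w.1.1 w.1.2 xi w.2 * g xi w.2)%:E)%E.
  apply: (@measurable_fun_integral R _ _ _ _ lebesgue_measure
    (fun w : V * R => (N w.1.1.1 w.1.1.2 w.2 w.1.2 * g w.2 w.1.2)%:E)).
  have n1 : measurable_fun [set: V * R] (fun w => w.1.1) by exact: measurableT_comp.
  have n2 : measurable_fun [set: V * R] (fun w => w.1.2) by exact: measurableT_comp.
  have n11 : measurable_fun [set: V * R] (fun w => w.1.1.1) by exact: measurableT_comp measurable_fst n1.
  have n12 : measurable_fun [set: V * R] (fun w => w.1.1.2) by exact: measurableT_comp measurable_snd n1.
  apply/measurable_EFinP; apply: measurable_funM; last exact: measurable_fun2.
  exact: measurable_fun4.
pose D : set V := [set w | 0 < w.2 < w.1.2].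
have mD : measurable D.
  have h : measurable_fun [set: V] (fun w : V => (0 < w.2) && (w.2 < w.1.2)).
    apply: measurable_and; apply: measurable_fun_ltr => //.
    exact: measurableT_comp measurable_snd measurable_fst.
  by have := h measurableT [set true]; rewrite setTI; exact.
have mID : measurable_fun [set: V]
    ((fun w => \int[mu]_xi (N w.1.1 w.1.2 xi w.2 * g xi w.2)%:E)%E \_ D).
  exact: (iffLR (measurable_restrictT _ mD) (measurable_funTS mI)).
have := @measurable_fun_integral R _ _ _ _ lebesgue_measure _ mID.
apply: eq_measurable_fun => z _; rewrite /potential [RHS]integral_mkcond.
apply: eq_integral => tau _; rewrite !patchE.
have -> : (tau \in `]0, z.2[%classic) = ((z, tau) \in D).
  by apply/idP/idP; rewrite !inE /D /= ?in_itv.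
by [].
Qed.

End L2_norm.

(** * Oscillation of the primitive of a nonnegative function *)

Section primitive.
Context {R : realType} (g G : R -> R).
Local Notation mu := (@lebesgue_measure R).
Context (g0 : forall z, 0 <= g z) (mg : measurable_fun [set: R] g).
Context (gG : forall x, ((G x)%:E = \int[mu]_(z in `]-oo, x]) (g z)%:E)%E).

Lemma integral_primitive_diff (a b : R) : a <= b ->
  (\int[mu]_(z in `]a, b]) (g z)%:E = (G b - G a)%:E)%E.
Proof.
move=> ab; have := gG b.
have -> : `]-oo, b]%classic = `]-oo, a] `|` `]a, b].
  by rewrite -itv_bndbnd_setU // bnd_simp.

rewrite ge0_integral_setU //=.
- rewrite -gG; case: (\int[mu]_(z in `]a, b]) (g z)%:E)%E => [r| |] //.
  by rewrite -EFinD => -[->]; congr (_%:E); ring.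
- by apply: measurable_funTS; exact/measurable_EFinP.
- by move=> z _; rewrite lee_fin.
- apply/disj_setPS => z /= []; rewrite !in_itv /= => h1 /andP[h2 _].
  by move: (lt_le_trans h2 h1); rewrite ltxx.
Qed.

Lemma primitive_le (M x : R) : (\int[mu]_z (g z)%:E <= M%:E)%E -> 0 <= G x <= M.
Proof.
move=> gM; rewrite -!lee_fin gG; apply/andP; split.
  by apply: integral_ge0 => z _; rewrite lee_fin.
apply: le_trans gM; apply: ge0_subset_integral => //.
- exact/measurable_EFinP.
- by move=> z _; rewrite lee_fin.
Qed.

(** For z between x and xi, (x - xi)^2 >= (x - z)^2 + (z - xi)^2, so the Gaussian splits with no
    loss of exponent or time. The integral is then enlarged to the whole line to make it a
    convolution. *)
Lemma gauss_primitive_le (e x xi p : R) : 0 < e -> 0 < p ->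
  ((gauss e (x - xi) p * `|G xi - G x|)%:E <=
     \int[mu]_z (gauss e (x - z) p * gauss e (z - xi) p * g z)%:E)%E.
Proof.
move=> e0 p0.
pose a := Num.min x xi; pose b := Num.max x xi.
have ab : a <= b by rewrite /a /b ge_min le_max lexx.
have -> : `|G xi - G x| = G b - G a.
  have nd : G a <= G b.
    rewrite -subr_ge0 -lee_fin -integral_primitive_diff //.
    by apply: integral_ge0 => z _; rewrite lee_fin.
  move: nd; rewrite /a /b; case: (leP x xi) => _ nd; first by rewrite ger0_norm ?subr_ge0.
  by rewrite distrC ger0_norm // subr_ge0.
have mgE : measurable_fun [set: R] (fun z => (g z)%:E) by exact/measurable_EFinP.
rewrite EFinM -integral_primitive_diff // -ge0_integralZl ?lee_fin ?gauss_ge0 //; last 2 first.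
- exact: measurable_funTS.
- by move=> z _; rewrite lee_fin.
have mP : measurable_fun [set: R] (fun z => (gauss e (x - z) p * gauss e (z - xi) p * g z)%:E).
  apply/measurable_EFinP; apply: measurable_funM => //; apply: measurable_funM;
    by apply: measurable_gaussT => //; exact: measurable_funB.
have P0 z : (0 <= (gauss e (x - z) p * gauss e (z - xi) p * g z)%:E)%E.
  by rewrite lee_fin !mulr_ge0 ?gauss_ge0.
apply: (@le_trans _ _ (\int[mu]_(z in `]a, b])
    (gauss e (x - z) p * gauss e (z - xi) p * g z)%:E)%E); last first.
  exact: ge0_subset_integral.
apply: ge0_le_integral => //.
- by move=> z _; rewrite mule_ge0 ?lee_fin ?gauss_ge0.
- by apply: measurable_funeM; exact: measurable_funTS.
- exact: measurable_funTS.
move=> z; rewrite /= in_itv /= => /andP[az zb].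
have h : 0 <= (x - z) * (z - xi).
  move: az zb; rewrite /a /b; case: (leP x xi) => _ az zb.
    by rewrite mulr_le0 // subr_le0 // ltW.
  by rewrite mulr_ge0 // subr_ge0 // ltW.
rewrite -EFinM lee_fin ler_wpM2r // /gauss -expRD ler_expR -opprD lerN2 -mulrDl.
rewrite ler_pM2r ?invr_gt0 // -mulrDr ler_pM2l //.
have -> : x - xi = (x - z) + (z - xi) by ring.
by move: h; set u := x - z; set v := z - xi; nra.
Qed.

End primitive.

Section plane_measure.
Context {R : realType}.
Local Notation mu := (@lebesgue_measure R).

(* Type inference does not find the structure of sigma-finite measure on
   [mu \x mu] itself. *)
Definition plane_measure : set (measurableTypeR R * measurableTypeR R)%type -> \bar R :=
  (mu \x mu)%E.

HB.instance Definition _ := Measure.on plane_measure.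

Lemma sigma_finite_plane_measure : sigma_finite setT plane_measure.
Proof.
by case: (lebesgue_integral_fubini.measure_function_Measure_isSigmaFinite__to__measure_function_isSigmaFinite mu mu).
Qed.

HB.instance Definition _ := Measure_isSigmaFinite.Build _ _ _
  plane_measure sigma_finite_plane_measure.

End plane_measure.

(** * Potentials at a fixed time *)

Section potential_estimates.
Context {R : realType} (T A e : R) (N : R -> R -> R -> R -> R).
Local Notation mu := (@lebesgue_measure R).
Context (T0 : 0 < T) (A0 : 0 < A) (e0 : 0 < e).
Context (mN : measurable_fun [set: (R * R) * (R * R)] (fun z => N z.1.1 z.1.2 z.2.1 z.2.2)).
Context (NA : forall x t xi tau, 0 < tau -> tau < t -> t <= T ->
  `|N x t xi tau| <= A / (t - tau) * gauss e (x - xi) (t - tau)).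

(** Bound on the space-time mass of the majorant of [N]: its mass in space, of order (t -
    tau)^(-1/2), is weakened to T^(1/4) (t - tau)^(-3/4), whose time integral is at most 4 T^(1/4)
    times a constant. *)
Definition potential_const : R :=
  A * Num.sqrt (pi / e) * T `^ (1 / 4) * (4 * T `^ (1 / 4)).
Local Notation S := potential_const.

Lemma potential_const_gt0 : 0 < S.
Proof.
by rewrite !mulr_gt0 ?powR_gt0 ?sqrtr_gt0 ?divr_gt0 ?pi_gt0.
Qed.

Section fixed_time.
Context (t : R) (t0 : 0 < t) (tT : t <= T).

(** Cut off outside ]0, t[ so that the majorant is nonnegative and measurable on the whole plane;
    [kap] is its mass in either space variable. *)
Let rho : R -> R := (fun tau => A / (t - tau)) \_ `]0, t[.
Let kap tau := rho tau * Num.sqrt (pi * (t - tau) / e).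

Let rhoE tau : 0 < tau < t -> rho tau = A / (t - tau).
Proof. by move=> h; rewrite /rho patchE mem_set // /= in_itv. Qed.

Let rho0 tau : ~~ (0 < tau < t) -> rho tau = 0.
Proof. by move=> h; rewrite /rho patchE memNset // /= in_itv; apply/negP. Qed.

Let rho_ge0 tau : 0 <= rho tau.
Proof.
have [h|/rho0-> //] := boolP (0 < tau < t).
by rewrite rhoE // divr_ge0 ?(ltW A0) // subr_ge0; case/andP: h => _ /ltW.
Qed.

Let kap_ge0 tau : 0 <= kap tau.
Proof. by rewrite mulr_ge0 // sqrtr_ge0. Qed.

Let mrho : measurable_fun [set: R] rho.
Proof.
apply: (iffLR (measurable_restrictT _ _)); first exact: measurable_itv.
apply: measurable_funTS; apply: measurable_funM => //.
by apply: (measurableT_comp measurable_invr); exact: measurable_funB.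
Qed.

Let mkap : measurable_fun [set: R] kap.
Proof.
apply: measurable_funM => //; apply: (measurableT_comp measurable_sqrtr).
by apply: measurable_funM => //; apply: measurable_funM => //; exact: measurable_funB.
Qed.

Let integral_rho_gauss x tau : (\int[mu]_xi (rho tau * gauss e (x - xi) (t - tau))%:E = (kap tau)%:E)%E.
Proof.
rewrite /kap; have [h|/rho0->] := boolP (0 < tau < t); last first.
  by rewrite mul0r; apply: integral0_eq => xi _; rewrite mul0r.
under eq_integral do rewrite EFinM.
rewrite ge0_integralZl ?lee_fin //.
- by rewrite integral_gaussC // subr_gt0; case/andP: h.
- by apply/measurable_EFinP; apply: measurable_gaussT => //; exact: measurable_funB.
- by move=> xi _; rewrite lee_fin gauss_ge0.
Qed.

Let integral_rho_gauss' xi tau : (\int[mu]_x (rho tau * gauss e (x - xi) (t - tau))%:E = (kap tau)%:E)%E.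
Proof.
rewrite -(integral_rho_gauss xi tau); apply: eq_integral => x _.
by rewrite gaussB.
Qed.

Let integral_kap : (\int[mu]_tau (kap tau)%:E <= S%:E)%E.
Proof.
have t4 : t `^ (1 / 4) <= T `^ (1 / 4) by rewrite ge0_ler_powR // nnegrE // ltW.
pose c1 := A * Num.sqrt (pi / e) * T `^ (1 / 4).
have c10 : 0 <= c1 by rewrite !mulr_ge0 ?powR_ge0 ?sqrtr_ge0 // ltW.
have -> : (\int[mu]_tau (kap tau)%:E = \int[mu]_(tau in `]0%R, t[) (kap tau)%:E)%E.
  rewrite [RHS]integral_mkcond; apply: eq_integral => tau _; rewrite patchE.
  case: ifPn => // h; rewrite /kap rho0 ?mul0r //.
  by apply: contra h => h; rewrite inE /= in_itv.
have m2 : measurable_fun [set: R] (fun s => (t - s) `^ (- (3 / 4))).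
  apply: (@measurableT_comp _ _ _ _ _ _ (fun r : R => r `^ (- (3 / 4)))).
    exact: measurable_powR.
  exact: measurable_funB.
apply: (@le_trans _ _ (\int[mu]_(tau in `]0%R, t[) (c1%:E * ((t - tau) `^ (- (3 / 4)))%:E))%E).
  apply: ge0_le_integral => //.
  - by move=> tau _; rewrite lee_fin.
  - by apply: measurable_funTS; exact/measurable_EFinP.
  - by apply: measurable_funTS; apply: measurable_funeM; exact/measurable_EFinP.
  - move=> tau; rewrite /= in_itv /= => h; rewrite -EFinM lee_fin /kap rhoE //.
    have L0 : 0 < t - tau by rewrite subr_gt0; case/andP: h.
    have LT : t - tau <= T by apply: le_trans tT; rewrite gerBl ltW //; case/andP: h.
    have -> : pi * (t - tau) / e = pi / e * (t - tau) by ring.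
    rewrite sqrtrM ?divr_ge0 ?pi_ge0 ?(ltW e0) // /c1 powR_3quarterN //.
    have -> : A / (t - tau) * (Num.sqrt (pi / e) * Num.sqrt (t - tau)) =
      A * Num.sqrt (pi / e) * (Num.sqrt (t - tau) / (t - tau)) by ring.
    rewrite -(mulrA (A * Num.sqrt (pi / e))) ler_wpM2l ?mulr_ge0 ?sqrtr_ge0 ?(ltW A0) // mulrA.
    rewrite ler_wpM2r ?invr_ge0 ?(ltW L0) // sqrt_quarter ?(ltW L0) // expr2.
    by rewrite ler_wpM2r ?powR_ge0 // ge0_ler_powR // nnegrE ltW.
rewrite ge0_integralZl ?lee_fin //; last 2 first.
- by apply: measurable_funTS; exact/measurable_EFinP.
- by move=> tau _; rewrite lee_fin powR_ge0.
rewrite /potential_const -/c1 (EFinM c1) lee_wpmul2l ?lee_fin //.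
apply: le_trans (integral_subr_powR t0) _.
by rewrite lee_fin subr0 ler_wpM2l.
Qed.

(** [z] is (tau, xi), time first, so that Tonelli puts the time integral outside. *)
Let K x (z : R * R) := rho z.1 * gauss e (x - z.2) (t - z.1).

Let K_ge0 x z : 0 <= K x z.
Proof. by rewrite mulr_ge0 ?gauss_ge0. Qed.

Let mK : measurable_fun [set: R * (R * R)] (fun w => K w.1 w.2).
Proof.
have n21 : measurable_fun [set: R * (R * R)] (fun w => w.2.1) by exact: measurableT_comp.
have n22 : measurable_fun [set: R * (R * R)] (fun w => w.2.2) by exact: measurableT_comp.
apply: measurable_funM; first exact: (measurableT_comp mrho).
by apply: measurable_gaussT; exact: measurable_funB.
Qed.

Let mKx x : measurable_fun [set: R * R] (K x).
Proof.
exact: (@measurableT_comp _ _ _ _ _ _ (fun w : R * (R * R) => K w.1 w.2) _ (pair x) mK (pair1_measurable x)).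
Qed.

(** Schur test from functions of (tau, xi) to functions of x: the row integrals are at most S, the
    column integrals are [kap tau], and integrating [kap] against the bound M costs another S. *)
Lemma potential_section_sqr_le (f : R -> R -> R) (M : R) : 0 <= M ->
  measurable_fun [set: R * R] (fun z => f z.1 z.2) ->
  {ae mu, forall tau, 0 < tau <= T -> (\int[mu]_xi (f xi tau ^+ 2)%:E <= M%:E)%E} ->
  (\int[mu]_x (`|potential N f x t| * `|potential N f x t|) <= (S * (S * M))%:E)%E.
Proof.
move=> M0 mf fM.
pose F (z : R * R) := f z.2 z.1.
have mF : measurable_fun [set: R * R] F by exact: measurable_fun2.
have Wle x : (`|potential N f x t| <= \int[plane_measure]_z (K x z * `|F z|)%:E)%E.
  have mKF : measurable_fun [set: R * R] (fun z => (K x z * `|F z|)%:E).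
    by apply/measurable_EFinP; apply: measurable_funM => //; exact: measurableT_comp.
  rewrite (@fubini_tonelli1 _ _ _ _ _ mu mu (fun z => (K x z * `|F z|)%:E) mKF); last first.
    by move=> z; rewrite lee_fin mulr_ge0.
  have mNf : measurable_fun [set: R * R] (fun z : R * R => (N x t z.2 z.1 * f z.2 z.1)%:E).
    apply/measurable_EFinP; apply: measurable_funM => //.
    by apply: measurable_fun4.
  have mI : measurable_fun [set: R] (fun tau => \int[mu]_xi (N x t xi tau * f xi tau)%:E)%E.
    exact: (@measurable_fun_integral R _ _ _ _ lebesgue_measure _ mNf).
  have mJ : measurable_fun [set: R] (fun tau => \int[mu]_xi (K x (tau, xi) * `|F (tau, xi)|)%:E)%E.
    exact: (@measurable_fun_integral R _ _ _ _ lebesgue_measure _ mKF).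
  apply: (@le_trans _ _ (\int[mu]_(tau in `]0%R, t[) \int[mu]_xi (K x (tau, xi) * `|F (tau, xi)|)%:E)%E); last first.
    apply: ge0_subset_integral => //.
    by move=> tau _; apply: integral_ge0 => xi _; rewrite lee_fin mulr_ge0.
  apply: le_trans (le_abse_integral _ _ _) _ => //; first exact: measurable_funTS.
  apply: ge0_le_integral => //.
  - by apply: measurable_funTS; exact: measurableT_comp.
  - exact: measurable_funTS.
  - move=> tau; rewrite /= in_itv /= => h.
    have mNft : measurable_fun [set: R] (fun xi => (N x t xi tau * f xi tau)%:E).
      exact: (@measurableT_comp _ _ _ _ _ _ (fun z : R * R => (N x t z.2 z.1 * f z.2 z.1)%:E) _
        (pair tau) mNf (pair1_measurable tau)).
    have mKFt : measurable_fun [set: R] (fun xi => (K x (tau, xi) * `|F (tau, xi)|)%:E).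
      exact: (@measurableT_comp _ _ _ _ _ _ (fun z : R * R => (K x z * `|F z|)%:E) _
        (pair tau) mKF (pair1_measurable tau)).
    apply: le_trans (le_abse_integral _ _ _) _ => //.
    apply: ge0_le_integral => //.
    + exact: measurableT_comp.
    + move=> xi _; rewrite /= lee_fin normrM /F /= ler_wpM2r //.
      by rewrite /K /= rhoE //; case/andP: h => h1 h2; exact: NA.
have mW : measurable_fun [set: R] (fun x => potential N f x t).
  exact: (@measurableT_comp _ _ _ _ _ _ (fun z : R * R => potential N f z.1 z.2) _
        (pair^~ t) (measurable_potential mN mf) (pair2_measurable t)).
have mKF2 : measurable_fun [set: R] (fun x => \int[plane_measure]_z (K x z * `|F z|)%:E)%E.
  have mm : measurable_fun [set: R * (R * R)] (fun w => (K w.1 w.2 * `|F w.2|)%:E).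
    apply/measurable_EFinP; apply: measurable_funM => //; apply: measurableT_comp => //.
    exact: measurableT_comp.
  exact: (@measurable_fun_integral R _ _ _ _ (plane_measure : {sigma_finite_measure set _ -> \bar _}) _ mm).
apply: (@le_trans _ _ (\int[mu]_x ((\int[plane_measure]_z (K x z * `|F z|)%:E) *
    (\int[plane_measure]_z (K x z * `|F z|)%:E)))%E).
  apply: ge0_le_integral => //.
  - by apply: emeasurable_funM; exact: measurableT_comp.
  - exact: emeasurable_funM.
  - by move=> x _; apply: lee_pmul.
apply: (@schur_test R _ _ (plane_measure : {sigma_finite_measure set _ -> \bar _}) _ _ lebesgue_measure) => //;
  first exact: potential_const_gt0.
- move=> x; rewrite (@fubini_tonelli1 _ _ _ _ _ mu mu (fun z => (K x z)%:E)).
  + apply: le_trans integral_kap; rewrite le_eqVlt; apply/orP; left; apply/eqP.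
    by apply: eq_integral => tau _; exact: integral_rho_gauss.
  + by apply/measurable_EFinP; exact: mKx.
  + by move=> z; rewrite lee_fin.
have E : (\int[plane_measure]_z ((F z ^+ 2)%:E * \int[mu]_x (K x z)%:E) =
    \int[plane_measure]_z ((F z ^+ 2)%:E * (kap z.1)%:E))%E.
  by apply: eq_integral => -[tau xi] _; rewrite integral_rho_gauss'.
rewrite E (@fubini_tonelli1 _ _ _ _ _ mu mu (fun z => ((F z ^+ 2)%:E * (kap z.1)%:E)%E)); last 2 first.
- apply/measurable_EFinP; apply: measurable_funM; first exact: measurable_funX.
  exact: (measurableT_comp mkap).
- by move=> z; rewrite -EFinM lee_fin; apply: mulr_ge0 => //; exact: sqr_ge0.
have mF2 : measurable_fun [set: R * R] (fun z => (F z ^+ 2)%:E).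
  by apply/measurable_EFinP; exact: measurable_funX.
have mF2i : measurable_fun [set: R] (fun tau => \int[mu]_xi (F (tau, xi) ^+ 2)%:E)%E.
  exact: (@measurable_fun_integral R _ _ _ _ lebesgue_measure _ mF2).
have E2 tau : (fubini_F mu (fun z => (F z ^+ 2)%:E * (kap z.1)%:E) tau =
    (kap tau)%:E * \int[mu]_xi (F (tau, xi) ^+ 2)%:E)%E.
  rewrite (_ : fubini_F _ _ _ =
    \int[mu]_xi ((F (tau, xi) ^+ 2)%:E * (kap tau)%:E))%E // ge0_integralZr ?lee_fin //;
    first by rewrite muleC.
  - exact: (@measurableT_comp _ _ _ _ _ _ (fun z : R * R => (F z ^+ 2)%:E) _
        (pair tau) mF2 (pair1_measurable tau)).
  - by move=> xi _; rewrite lee_fin sqr_ge0.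
apply: (@le_trans _ _ (\int[mu]_tau ((kap tau)%:E * \int[mu]_xi (F (tau, xi) ^+ 2)%:E))%E).
  by rewrite le_eqVlt; apply/orP; left; apply/eqP; apply: eq_integral => tau _; exact: E2.
have F2i tau : (0 <= \int[mu]_xi (F (tau, xi) ^+ 2)%:E)%E.
  by apply: integral_ge0 => xi _; rewrite lee_fin sqr_ge0.
apply: (@le_trans _ _ (\int[mu]_tau ((kap tau)%:E * M%:E))%E); last first.
  rewrite ge0_integralZr ?lee_fin //; last 2 first.
  - exact/measurable_EFinP.
  - by move=> tau _; rewrite lee_fin.
  by rewrite EFinM lee_wpmul2r ?lee_fin.
apply: ae_ge0_le_integral => //.
- by move=> tau _; rewrite mule_ge0 ?lee_fin.
- by apply: emeasurable_funM => //; exact/measurable_EFinP.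
- by move=> tau _; rewrite -EFinM lee_fin mulr_ge0.
- by apply: emeasurable_funM => //; exact/measurable_EFinP.
apply: (@filterS _ _ (ae_filter_ringOfSetsType mu) _ _ _ fM) => tau {}fM _.
have [/andP[h1 h2]|h] := boolP (0 < tau < t); last by rewrite /kap rho0 // mul0r !mul0e.
by rewrite lee_wpmul2l ?lee_fin //; apply: fM; rewrite h1 (le_trans (ltW h2)).
Qed.

(* The zero mass of [N] replaces [G xi] by [G xi - G x], the integral of [g]
   between [x] and [xi], and the Gaussian of [x - xi] splits at every
   intermediate point: [potential N G] is bounded, and integrable in [x]. *)
Lemma potential_section_sqr_le_primitive (G g : R -> R -> R) (M : R) : 0 <= M ->
  (forall z tau, 0 <= g z tau) ->
  measurable_fun [set: R * R] (fun z => g z.1 z.2) ->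
  measurable_fun [set: R * R] (fun z => G z.1 z.2) ->
  (forall x tau, 0 < tau < t -> \int[mu]_xi N x t xi tau = 0) ->
  {ae mu, forall tau, 0 < tau <= T ->
    (forall x, ((G x tau)%:E = \int[mu]_(z in `]-oo, x]) (g z tau)%:E)%E) /\
    (\int[mu]_z (g z tau)%:E <= M%:E)%E} ->
  (\int[mu]_x (`|potential N G x t| * `|potential N G x t|) <=
    (S * M * (S * (M * Num.sqrt (pi * T / e))))%:E)%E.
Proof.
move=> M0 g0 mg mG N0 gM.
(* What is left once xi is integrated out: the Gaussian in z - xi turns into [kap], the one in x - z
   stays. *)
pose P (w : (R * R) * R) := kap w.1.2 * gauss e (w.1.1 - w.2) (t - w.1.2) * g w.2 w.1.2.
have P0 w : 0 <= P w by rewrite !mulr_ge0 ?gauss_ge0.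
have n1 : measurable_fun [set: (R * R) * R] (fun w => w.1.1) by exact: measurableT_comp.
have n2 : measurable_fun [set: (R * R) * R] (fun w => w.1.2) by exact: measurableT_comp.
have mP : measurable_fun [set: (R * R) * R] (fun w => (P w)%:E).
  apply/measurable_EFinP; apply: measurable_funM; last exact: measurable_fun2.
  apply: measurable_funM; first exact: (measurableT_comp mkap).
  by apply: measurable_gaussT; exact: measurable_funB.
pose B (v : R * R) := (\int[mu]_z (P (v, z))%:E)%E.
have mB : measurable_fun [set: R * R] B.
  exact: (@measurable_fun_integral R _ _ _ _ lebesgue_measure _ mP).
have B0 v : (0 <= B v)%E by apply: integral_ge0 => z _; rewrite lee_fin.
have mgt tau : measurable_fun [set: R] (fun z => g z tau).
  exact: (@measurableT_comp _ _ _ _ _ _ (fun z : R * R => g z.1 z.2) _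
    (pair^~ tau) mg (pair2_measurable tau)).
have mGt tau : measurable_fun [set: R] (fun z => G z tau).
  exact: (@measurableT_comp _ _ _ _ _ _ (fun z : R * R => G z.1 z.2) _
    (pair^~ tau) mG (pair2_measurable tau)).
have mgtE tau : measurable_fun [set: R] (fun z => (g z tau)%:E) by exact/measurable_EFinP.
have mNt x tau : measurable_fun [set: R] (fun xi => N x t xi tau).
  by apply: measurable_fun4.
have ker x tau : 0 < tau < t ->
    (forall x, ((G x tau)%:E = \int[mu]_(z in `]-oo, x]) (g z tau)%:E)%E) /\
    (\int[mu]_z (g z tau)%:E <= M%:E)%E ->
    (`|\int[mu]_xi (N x t xi tau * G xi tau)%:E| <= B (x, tau))%E.
  move=> /andP[h1 h2] [Gg gMt]; have L0 : 0 < t - tau by rewrite subr_gt0.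
  have NK xi : `|N x t xi tau| <= A / (t - tau) * gauss e (x - xi) (t - tau) by exact: NA.
  have GM xi := primitive_le (fun z => g0 z tau) (mgt tau) Gg xi gMt.
  have [iN _] := gauss_dominated e0 L0 (mNt x tau) NK.
  have mNG : measurable_fun [set: R] (fun xi => N x t xi tau * G xi tau) by exact: measurable_funM.
  have mND : measurable_fun [set: R] (fun xi => N x t xi tau * (G xi tau - G x tau)).
    by apply: measurable_funM => //; exact: measurable_funB.
  have dM xi : `|G xi tau - G x tau| <= M.
    have /andP[a1 a2] := GM xi; have /andP[b1 b2] := GM x.
    by rewrite ler_norml; apply/andP; split; lra.
  have [iND _] : mu.-integrable setT (EFin \o (fun xi => N x t xi tau * (G xi tau - G x tau))) /\ True.
    split=> //; have [//|//] := @gauss_dominated R _ (M * (A / (t - tau))) x (t - tau) e e0 L0 mND.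
    move=> xi; rewrite normrM mulrC -(mulrA M).
    by apply: ler_pM => //; exact: dM.
  have -> : (\int[mu]_xi (N x t xi tau * G xi tau)%:E =
      \int[mu]_xi (N x t xi tau * (G xi tau - G x tau))%:E)%E.
    have iNc : mu.-integrable setT (fun xi => (G x tau)%:E * (N x t xi tau)%:E)%E by exact: integrableZl.
    transitivity (\int[mu]_xi ((N x t xi tau * (G xi tau - G x tau))%:E + (G x tau)%:E * (N x t xi tau)%:E))%E.
      by apply: eq_integral => xi _; rewrite -EFinM -EFinD; congr (_%:E); ring.
    rewrite integralD // integralZl // -[X in (_ + _ * X)%E]fineK; last exact: integrable_fin_num.
    rewrite -/(Rintegral mu setT (fun xi => N x t xi tau)) N0 ?h1 // mule0 adde0 //.
  apply: le_trans (le_abse_integral _ _ _) _ => //; first exact/measurable_EFinP.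
  pose Q (w : R * R) := rho tau * (gauss e (x - w.2) (t - tau) * gauss e (w.2 - w.1) (t - tau) * g w.2 tau).
  have Q0 w : 0 <= Q w by rewrite !mulr_ge0 ?gauss_ge0.
  have mQ : measurable_fun [set: R * R] (fun w => (Q w)%:E).
    apply/measurable_EFinP; apply: measurable_funM => //.
    apply: measurable_funM; last exact: (measurableT_comp (mgt tau)).
    by apply: measurable_funM; apply: measurable_gaussT => //; exact: measurable_funB.
  have mQ1 : measurable_fun [set: R] (fun xi => \int[mu]_z (Q (xi, z))%:E)%E.
    exact: (@measurable_fun_integral R _ _ _ _ lebesgue_measure _ mQ).
  apply: (@le_trans _ _ (\int[mu]_xi \int[mu]_z (Q (xi, z))%:E)%E).
    apply: ge0_le_integral => //.
    - by apply: measurableT_comp => //; exact/measurable_EFinP.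
    - move=> xi _; rewrite /= normrM.
      apply: (@le_trans _ _ ((rho tau)%:E * (gauss e (x - xi) (t - tau) * `|G xi tau - G x tau|)%:E)%E).
        by rewrite -EFinM lee_fin (mulrA (rho tau)) ler_wpM2r // rhoE ?h1.
      rewrite /Q; under eq_integral do rewrite EFinM.
      rewrite ge0_integralZl ?lee_fin //; last 2 first.
      + rewrite /=; apply/measurable_EFinP; apply: measurable_funM; last exact: mgt.
        by apply: measurable_funM; apply: measurable_gaussT => //; exact: measurable_funB.
      + by move=> z _; rewrite lee_fin !mulr_ge0 ?gauss_ge0.
      rewrite lee_wpmul2l ?lee_fin //.
      exact: (@gauss_primitive_le R (g^~ tau) (G^~ tau)).
  rewrite (@fubini_tonelli _ _ _ _ _ mu mu (fun w => (Q w)%:E) mQ) //.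
  rewrite le_eqVlt; apply/orP; left; apply/eqP; apply: eq_integral => z _.
  transitivity (\int[mu]_xi ((gauss e (x - z) (t - tau) * g z tau)%:E * (rho tau * gauss e (z - xi) (t - tau))%:E))%E.
    by apply: eq_integral => xi _; rewrite -EFinM; congr (_%:E); rewrite /Q /=; ring.
  rewrite ge0_integralZl ?lee_fin ?mulr_ge0 ?gauss_ge0 //; last 2 first.
  - apply/measurable_EFinP; apply: measurable_funM => //.
    by apply: measurable_gaussT => //; exact: measurable_funB.
  - by move=> xi _; rewrite lee_fin mulr_ge0 ?gauss_ge0.
  by rewrite integral_rho_gauss -EFinM; congr (_%:E); rewrite /P /=; ring.
pose w x := (\int[mu]_tau B (x, tau))%E.
have w0 x : (0 <= w x)%E by exact: integral_ge0.
have mw : measurable_fun [set: R] w.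
  exact: (@measurable_fun_integral R _ _ _ _ lebesgue_measure _ mB).
have mBx x : measurable_fun [set: R] (fun tau => B (x, tau)).
  exact: (@measurableT_comp _ _ _ _ _ _ B _ (pair x) mB (pair1_measurable x)).
have Ww x : (`|potential N G x t| <= w x)%E.
  have mNG : measurable_fun [set: R * R] (fun z : R * R => (N x t z.2 z.1 * G z.2 z.1)%:E).
    apply/measurable_EFinP; apply: measurable_funM; last exact: measurable_fun2.
    by apply: measurable_fun4.
  have mI : measurable_fun [set: R] (fun tau => \int[mu]_xi (N x t xi tau * G xi tau)%:E)%E.
    exact: (@measurable_fun_integral R _ _ _ _ lebesgue_measure _ mNG).
  apply: (@le_trans _ _ (\int[mu]_(tau in `]0%R, t[) B (x, tau))%E); last first.
    by apply: ge0_subset_integral => //; exact: mBx.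
  apply: le_trans (le_abse_integral _ _ _) _ => //; first exact: measurable_funTS.
  apply: ae_ge0_le_integral => //.
  - by apply: measurable_funTS; exact: measurableT_comp.
  - apply: measurable_funTS; exact: mBx.
  apply: (@filterS _ _ (ae_filter_ringOfSetsType mu) _ _ _ gM) => tau {}gM.
  rewrite /= in_itv /= => h; apply: ker => //; apply: gM.
  by case/andP: h => h1 h2; rewrite h1 (le_trans (ltW h2)).
have mkapE : measurable_fun [set: R] (fun tau => (kap tau)%:E) by exact/measurable_EFinP.
have kapM (a : R) : 0 <= a -> (\int[mu]_tau ((kap tau)%:E * a%:E) <= (S * a)%:E)%E.
  move=> a0; rewrite ge0_integralZr ?lee_fin //; last by move=> tau _; rewrite lee_fin.
  by rewrite EFinM lee_wpmul2r ?lee_fin.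
have ae_kap (h : R -> \bar R) (a : R) : 0 <= a -> measurable_fun [set: R] h ->
    (forall tau, 0 <= h tau)%E ->
    (forall tau, ~~ (0 < tau < t) -> (h tau <= 0)%E) ->
    (forall tau, 0 < tau < t -> (\int[mu]_z (g z tau)%:E <= M%:E)%E -> (h tau <= (kap tau)%:E * a%:E)%E) ->
    (\int[mu]_tau h tau <= (S * a)%:E)%E.
  move=> a0 mh h0 h1 h2; apply: le_trans (kapM a a0).
  apply: ae_ge0_le_integral => //.
  - by move=> tau _; rewrite -EFinM lee_fin mulr_ge0.
  - exact: emeasurable_funM.
  apply: (@filterS _ _ (ae_filter_ringOfSetsType mu) _ _ _ gM) => tau {}gM _.
  have [ht|ht] := boolP (0 < tau < t); last by rewrite (le_trans (h1 _ ht)) // -EFinM lee_fin mulr_ge0.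
  by apply: h2 => //; apply gM; case/andP: ht => h3 h4; rewrite h3 (le_trans (ltW h4)).
have kapP tau : ~~ (0 < tau < t) -> kap tau = 0 by move=> h; rewrite /kap rho0 // mul0r.
have gauss1 x tau : 0 < tau < t -> gauss e x (t - tau) <= 1.
  by case/andP=> _ h; rewrite gauss_le1 ?(ltW e0) // subr_gt0.
(* Bound in the supremum norm: the Gaussian in x - z is at most 1 and g has mass at most M. *)
have wM x : (w x <= (S * M)%:E)%E.
  apply: ae_kap => // [tau h|tau h gMt].
    by rewrite /B integral0_eq // => z _; rewrite /P /= kapP // !mul0r.
  apply: (@le_trans _ _ (\int[mu]_z ((kap tau)%:E * (g z tau)%:E))%E).
    apply: ge0_le_integral => //.
    - by move=> z _; rewrite lee_fin.
    - exact: (@measurableT_comp _ _ _ _ _ _ (fun z : (R * R) * R => (P z)%:E) _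
        (pair (x, tau)) mP (pair1_measurable (x, tau))).
    - by apply: measurable_funeM; exact: mgtE.
    - move=> z _; rewrite -EFinM lee_fin /P /= ler_wpM2r //.
      by rewrite ler_piMr // gauss1.
  rewrite ge0_integralZl ?lee_fin //; [|exact: mgtE|by move=> z _; rewrite lee_fin].
  by rewrite lee_wpmul2l ?lee_fin.
have mB2 : measurable_fun [set: R] (fun tau => \int[mu]_x B (x, tau))%E.
  apply: (@measurable_fun_integral R _ _ _ _ lebesgue_measure (fun z : R * R => B (z.2, z.1))).
  apply: (@measurableT_comp _ _ _ _ _ _ B _ (fun z : R * R => (z.2, z.1)) mB).
  exact: measurable_fun_pair measurable_snd measurable_fst.
pose c := M * Num.sqrt (pi * T / e).
have c0 : 0 <= c by rewrite mulr_ge0 // sqrtr_ge0.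
(* Bound in L1: integrating in x first replaces that Gaussian by its mass, at most sqrt(pi T/e). *)
have wS : (\int[mu]_x w x <= (S * c)%:E)%E.
  rewrite /w (@fubini_tonelli _ _ _ _ _ mu mu B mB) //.
  apply: ae_kap => // [tau|tau h|tau h gMt].
  - exact: integral_ge0.
  - rewrite integral0_eq // => x _; rewrite /B integral0_eq // => z _.
    by rewrite /P /= kapP // !mul0r.
  have L0 : 0 < t - tau by rewrite subr_gt0; case/andP: h.
  have mPt : measurable_fun [set: R * R] (fun v => (P ((v.1, tau), v.2))%:E).
    apply: (@measurableT_comp _ _ _ _ _ _ (fun z : (R * R) * R => (P z)%:E) _
        (fun v : R * R => ((v.1, tau), v.2)) mP).
    apply: measurable_fun_pair measurable_snd.
    by apply: measurable_fun_pair => //; exact: measurable_fst.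
  rewrite /B (@fubini_tonelli _ _ _ _ _ mu mu (fun v => (P ((v.1, tau), v.2))%:E) mPt) //=; last first.
    by move=> v; rewrite lee_fin.
  apply: (@le_trans _ _ (\int[mu]_z ((kap tau * Num.sqrt (pi * T / e))%:E * (g z tau)%:E))%E).
    apply: ge0_le_integral => //.
    - by move=> z _; apply: integral_ge0 => x _; rewrite lee_fin.
    - apply: (@measurable_fun_integral R _ _ _ _ lebesgue_measure (fun v : R * R => (P ((v.2, tau), v.1))%:E)).
      apply: (@measurableT_comp _ _ _ _ _ _ (fun z : R * R => (P ((z.1, tau), z.2))%:E) _
          (fun v : R * R => (v.2, v.1)) mPt).
      exact: measurable_fun_pair measurable_snd measurable_fst.
    - by apply: measurable_funeM; exact: mgtE.
    - move=> z _.
      have -> : (\int[mu]_x (P ((x, tau), z))%:E =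
          \int[mu]_x ((kap tau * g z tau)%:E * (gauss e (x - z) (t - tau))%:E))%E.
        by apply: eq_integral => x _; rewrite -EFinM; congr (_%:E); rewrite /P /=; ring.
      rewrite ge0_integralZl ?lee_fin ?mulr_ge0 //; last 2 first.
      + by apply/measurable_EFinP; apply: measurable_gaussT => //; exact: measurable_funB.
      + by move=> x _; rewrite lee_fin gauss_ge0.
      rewrite integral_gauss // -!EFinM lee_fin mulrAC ler_wpM2r // ler_wpM2l //.
      rewrite ler_wsqrtr // ler_wpM2r ?invr_ge0 ?(ltW e0) // ler_wpM2l ?pi_ge0 //.
      by case/andP: h => h1 h2; apply: le_trans tT; rewrite gerBl ltW.
  rewrite ge0_integralZl ?lee_fin ?mulr_ge0 ?sqrtr_ge0 //; [|exact: mgtE|by move=> z _; rewrite lee_fin].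
  apply: (@le_trans _ _ ((kap tau * Num.sqrt (pi * T / e))%:E * M%:E)%E).
    by rewrite lee_wpmul2l ?lee_fin ?mulr_ge0 ?sqrtr_ge0.
  by rewrite -!EFinM lee_fin /c (mulrC M) (mulrA (kap tau)).
have mW : measurable_fun [set: R] (fun x => potential N G x t).
  exact: (@measurableT_comp _ _ _ _ _ _ (fun z : R * R => potential N G z.1 z.2) _
        (pair^~ t) (measurable_potential mN mG) (pair2_measurable t)).
clearbody w.
(* The square is at most the supremum times the function. *)
apply: (@le_trans _ _ (\int[mu]_x ((S * M)%:E * w x))%E).
  apply: ge0_le_integral => //.
  - by apply: emeasurable_funM; exact: measurableT_comp.
  - exact: measurable_funeM.
  - move=> x _; apply: lee_pmul => //.
    exact: le_trans (Ww x) (wM x).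
have SM0 : 0 <= S * M by rewrite mulr_ge0 // ltW // potential_const_gt0.
rewrite ge0_integralZl ?lee_fin //.
by rewrite (EFinM (S * M)) lee_wpmul2l ?lee_fin.
Qed.

End fixed_time.
End potential_estimates.

(** * Functions on the strip and norms over a short time *)

Section strip.
Context {R : realType}.
Local Notation mu := (@lebesgue_measure R).

Lemma measurable_Omega (T : R) : measurable (Omega T).
Proof. by apply: measurableX => //; exact: measurable_itv. Qed.

(* [u z < a] iff [u q + C * |z - q|^(1/2) < a] for some rational point [q]. *)
Lemma measurable_holder (T : R) (u : R -> R -> R) : holder_on (Omega T) (1 / 2) u ->
  measurable_fun (Omega T) (fun z => u z.1 z.2).
Proof.
move=> [C0 hC0]; pose C := `|C0|.
have hC z w : Omega T z -> Omega T w -> `|u z.1 z.2 - u w.1 w.2| <=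
    C * (`|z.1 - w.1| `^ (1 / 2) + `|z.2 - w.2| `^ (1 / 2)).
  move=> hz hw; apply: le_trans (hC0 _ _ hz hw) _.
  by rewrite ler_wpM2r ?addr_ge0 ?powR_ge0 // ler_norm.
have C_ge0 : 0 <= C by exact: normr_ge0.
have mOm := measurable_Omega T.
move=> _; apply: (measurability _ (RGenInftyO.measurableE R)) => //.
move=> _ [_ [a ->] <-].
pose V (p q : rat) := [set z : R * R | (0 < (ratr q : R)) && ((ratr q : R) <= T) &&
  (u (ratr p) (ratr q) + C * (`|z.1 - ratr p| `^ (1 / 2) + `|z.2 - ratr q| `^ (1 / 2)) < a)].
rewrite (_ : _ `&` _ = Omega T `&` \bigcup_p \bigcup_q V p q).
  apply: measurableI => //; apply: bigcupT_measurable_rat => p.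
  apply: bigcupT_measurable_rat => q.
  have [h|h] := boolP ((0 < (ratr q : R)) && ((ratr q : R) <= T)); last first.
    by rewrite (_ : V p q = set0) // -subset0 => z /=; rewrite /V /= (negbTE h).
  have mp (g : R * R -> R) : measurable_fun [set: R * R] g ->
      measurable_fun [set: R * R] (fun z => `|g z| `^ (1 / 2)).
    move=> mg; apply: (@measurableT_comp _ _ _ _ _ _ (fun r : R => r `^ (1 / 2))).
      exact: measurable_powR.
    exact: measurableT_comp.
  have m1 : measurable_fun [set: R * R] (fun z => u (ratr p) (ratr q) +
      C * (`|z.1 - ratr p| `^ (1 / 2) + `|z.2 - ratr q| `^ (1 / 2)) < a).
    apply: measurable_fun_ltr => //; apply: measurable_funD => //.
    apply: measurable_funM => //; apply: measurable_funD; apply: mp;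
      exact: measurable_funB.
  have := m1 measurableT [set true]; rewrite setTI => m2.
  rewrite (_ : V p q = (fun z : R * R => u (ratr p) (ratr q) +
      C * (`|z.1 - ratr p| `^ (1 / 2) + `|z.2 - ratr q| `^ (1 / 2)) < a) @^-1` [set true]).
    exact: m2.
  by apply/seteqP; split=> z; rewrite /V /= h.
apply/seteqP; split=> -[x t] [hz]; rewrite /= ?in_itv /= => h; split=> //.
  have t0 : 0 < t by move: hz => [_] /=; rewrite in_itv /= => /andP[].
  have tT : t <= T by move: hz => [_] /=; rewrite in_itv /= => /andP[].
  (* The Holder bound is paid twice, in passing from u at z to u at the rational point and in the
     added term; each payment is at most 2Cr, and 4Cr < a - u x t. *)
  pose r := (a - u x t) / (4 * C + 1).
  have r0 : 0 < r by rewrite divr_gt0 ?subr_gt0 // ltr_wpDl // mulr_ge0.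
  have rE : (4 * C + 1) * r = a - u x t by rewrite /r mulrC divfK // gt_eqF // ltr_wpDl // mulr_ge0.
  have r20 : 0 < r ^+ 2 by rewrite exprn_gt0.
  have near (y s : R) : y - r ^+ 2 < s -> s < y -> `|y - s| `^ (1 / 2) <= r.
    move=> h1 h2; have -> : r = (r ^+ 2) `^ (1 / 2).
      by rewrite div1r powR12_sqrt ?(ltW r20) // sqrtr_sqr gtr0_norm.
    rewrite ge0_ler_powR ?nnegrE ?(ltW r20) // gtr0_norm ?subr_gt0 // ltW //.
    by rewrite ltrBlDr -ltrBlDl.
  have [p] : exists p : rat, ratr p \in `]x - r ^+ 2, x[%R.
    by apply/rat_in_itvoo; rewrite ltrBlDr ltrDl.
  rewrite in_itv /= => /andP[p1 p2].
  (* Approximating from below keeps the rational time in ]0, T], also for t = T. *)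
  have [q] : exists q : rat, ratr q \in `]Num.max 0 (t - r ^+ 2), t[%R.
    by apply/rat_in_itvoo; rewrite gt_max t0 ltrBlDr ltrDl.
  rewrite in_itv /= gt_max => /andP[/andP[q0 q1] q2].
  have hq : Omega T (ratr p, ratr q).
    by split => //=; rewrite in_itv /= q0 (le_trans (ltW q2)).
  exists p => //; exists q => //; rewrite /V /= q0 (le_trans (ltW q2)) //=.
  have n1 := near _ _ p1 p2; have n2 := near _ _ q1 q2.
  have := hC _ _ hq hz; rewrite /= (distrC (ratr q)) (distrC (ratr p)).
  move: n1 n2; set d1 := _ `^ _; set d2 := _ `^ _ => n1 n2.
  rewrite ler_norml => /andP[_ h2].
  have h3 : C * (d1 + d2) <= C * (r + r) by rewrite ler_wpM2l // lerD.
  lra.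
case: h => p _ [q _]; rewrite /V /= => /andP[/andP[q0 q1]]; apply: le_lt_trans.
have hq : Omega T (ratr p, ratr q) by split => //=; rewrite in_itv /= q0.
by have := hC _ _ hz hq; rewrite /= ler_norml => /andP[_]; rewrite lerBlDl.
Qed.

Lemma L2_norm_le_small_time (W : R -> R -> \bar R) (T C K : R) :
  measurable_fun [set: R * R] (fun z => W z.1 z.2) -> 0 <= C -> 0 < K ->
  (forall x, W x 0 = 0%E) ->
  (forall t, 0 < t <= T -> (\int[mu]_x (`|W x t| * `|W x t|) <= C%:E)%E) ->
  exists2 d : R, 0 < d & forall del, 0 <= del -> del <= d -> del <= T ->
    L2_norm_le (Omega_bar del) W K.
Proof.
(* The squared norm is at most C times the length of the time interval; the + 1 allows C = 0. *)
move=> mW C0 K0 W0 hW; exists (K ^+ 2 / (C + 1)).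
  by rewrite divr_gt0 ?exprn_gt0 // ltr_wpDl.
move=> del del0 deld delT; apply: L2_norm_leI => //; first exact: ltW.
have mW2 : measurable_fun [set: R * R] (fun z => `|W z.2 z.1| * `|W z.2 z.1|)%E.
  have mWs : measurable_fun [set: R * R] (fun z : R * R => W z.2 z.1).
    apply: (@measurableT_comp _ _ _ _ _ _ (fun z : R * R => W z.1 z.2) _
      (fun z : R * R => (z.2, z.1)) mW).
    exact: measurable_fun_pair measurable_snd measurable_fst.
  by apply: emeasurable_funM; exact: measurableT_comp.
apply: (@le_trans _ _ (\int[mu]_(t in `[0%R, del]) (cst C%:E t))%E).
  apply: ge0_le_integral => //.
  - by move=> t _; apply: integral_ge0 => x _; rewrite mule_ge0.
  - apply: measurable_funTS.
    exact: (@measurable_fun_integral R _ _ _ _ lebesgue_measure _ mW2).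
  - move=> t; rewrite /= in_itv /= => /andP[t0 tdel].
    have [->|t00] := eqVneq t 0.
      by rewrite integral0_eq ?lee_fin // => x _; rewrite W0 abse0 mule0.
    by apply: hW; rewrite lt_neqAle eq_sym t00 t0 (le_trans tdel).
rewrite integral_cst //= lebesgue_measure_itv /= lte_fin.
case: ifPn => _; last by rewrite mule0 lee_fin sqr_ge0.
rewrite -EFinD -EFinM lee_fin subr0.
apply: (@le_trans _ _ (C * (K ^+ 2 / (C + 1)))); first by rewrite ler_wpM2l.
rewrite mulrA ler_pdivrMr ?ltr_wpDl // mulrC ler_wpM2l ?sqr_ge0 // lerDl //.
Qed.

Lemma eq_L2_norm_le (W W' : R -> R -> \bar R) (del K : R) :
  (forall x t, 0 <= t <= del -> W x t = W' x t) ->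
  L2_norm_le (Omega_bar del) W K -> L2_norm_le (Omega_bar del) W' K.
Proof.
move=> WW' [mW nW]; have E z : Omega_bar del z -> W z.1 z.2 = W' z.1 z.2.
  by move=> [_ /=]; rewrite in_itv /=; exact: WW'.
split; first by apply: eq_measurable_fun mW => z /set_mem; exact: E.
rewrite (_ : _ \_ _ = (fun z => W z.1 z.2) \_ (Omega_bar del)) //.
by apply/funext => z; rewrite !patchE; case: ifPn => // /set_mem /E.
Qed.

Lemma eq_potential (N N' : R -> R -> R -> R -> R) (g g' : R -> R -> R) (x t : R) :
  (forall xi tau, 0 < tau < t -> N x t xi tau = N' x t xi tau) ->
  (forall xi tau, 0 < tau < t -> g xi tau = g' xi tau) ->
  potential N g x t = potential N' g' x t.
Proof.
move=> NN' gg'; apply: eq_integral => tau; rewrite inE /= in_itv /= => h.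
by apply: eq_integral => xi _; rewrite NN' // gg'.
Qed.

Lemma potential_at0 (N : R -> R -> R -> R -> R) (g : R -> R -> R) (x : R) :
  potential N g x 0 = 0%E.
Proof. by rewrite /potential set_itvoo0 integral_set0. Qed.

Lemma Linfty_L2_bound (T : R) (f : R -> R -> R) : Linfty_Lp T 2%:E f ->
  exists2 M : R, 0 <= M & {ae mu, forall tau, 0 < tau <= T ->
    (\int[mu]_xi (f xi tau ^+ 2)%:E <= M%:E)%E}.
Proof.
move=> [_]; have muT : (0 < mu [set: R])%E by rewrite -set_itvNyy lebesgue_measure_itv //= ltry.
set h := (X in 'N[_]__[X]%E); have -> : ('N[mu]_+oo[h] = ess_sup mu (abse \o h))%E.
  by rewrite unlock muT.
set E := ess_sup _ _ => Efin.
have hE : \forall t \ae mu, (`|h t| <= E)%E by exact: ess_sup_ge.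
exists ((fine E) ^+ 2); first exact: sqr_ge0.
apply: (@filterS _ _ (ae_filter_ringOfSetsType mu) _ _ _ hE) => tau htau /andP[tau0 tauT].
have N0 : (0 <= 'N[mu]_2%:E [EFin \o f ^~ tau])%E by exact: Lnorm_ge0.
have hN : ('N[mu]_2%:E [EFin \o f ^~ tau] <= E)%E.
  have hm : `[0, T]%classic tau by rewrite /= in_itv /= (ltW tau0).
  by move: htau; rewrite /h patchE mem_set // gee0_abs.
have Er : E = (fine E)%:E.
  by rewrite fineK // ge0_fin_numE // (le_trans N0).
rewrite Er in hN.
have -> : (\int[mu]_xi (f xi tau ^+ 2)%:E = 'N[mu]_2%:E [EFin \o f ^~ tau] `^ 2)%E.
  rewrite poweR_Lnorm //; apply: eq_integral => xi _.
  by rewrite poweR2 ?abse_ge0 //= -EFinM -expr2 real_normK ?num_real.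
by rewrite poweR2 // expr2 EFinM lee_pmul.
Qed.

End strip.

(** * Extension of the data and conclusion *)

Section extension.
Context {R : realType}.
Local Notation mu := (@lebesgue_measure R).
Implicit Types (T kL : R) (k u : R -> R -> R) (Phi N : R -> R -> R -> R -> R).

(** The outer value is a parameter: the coefficient needs one in [kL, kU] to stay elliptic
    everywhere, [f] and [G] are extended by 0. *)
Definition extend (D : set (R * R)) (u0 : R) u (x t : R) : R :=
  if (x, t) \in D then u x t else u0.

Definition extend_ordered T N (x t xi tau : R) : R :=
  if ((x, t), (xi, tau)) \in times_ordered T then N x t xi tau else 0.

Lemma in_Omega T (x t : R) : ((x, t) \in Omega T) = (0 < t <= T).
Proof.
apply/idP/idP; rewrite inE; first by case=> _ /=; rewrite in_itv.
by move=> h; split => //=; rewrite in_itv.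
Qed.

Lemma in_Omega_bar T (x t : R) : ((x, t) \in Omega_bar T) = (0 <= t <= T).
Proof.
apply/idP/idP; rewrite inE; first by case=> _ /=; rewrite in_itv.
by move=> h; split => //=; rewrite in_itv.
Qed.

Lemma extend_orderedE T N (x t xi tau : R) : 0 < tau -> tau < t -> t <= T ->
  extend_ordered T N x t xi tau = N x t xi tau.
Proof. by move=> h1 h2 h3; rewrite /extend_ordered mem_set. Qed.

Lemma measurable_times_ordered T : measurable (@times_ordered R T).
Proof.
have m12 : measurable_fun [set: (R * R) * (R * R)] (fun z => z.1.2) by exact: measurableT_comp.
have m22 : measurable_fun [set: (R * R) * (R * R)] (fun z => z.2.2) by exact: measurableT_comp.
have h : measurable_fun [set: (R * R) * (R * R)]
    (fun z : (R * R) * (R * R) => (0 < z.2.2) && ((z.2.2 < z.1.2) && (z.1.2 <= T))).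
  apply: measurable_and; first exact: measurable_fun_ltr.
  apply: measurable_and; first exact: measurable_fun_ltr.
  exact: measurable_fun_ler.
have := h measurableT [set true]; rewrite setTI.
rewrite (_ : _ @^-1` _ = times_ordered T); first exact.
apply/seteqP; split=> z; rewrite /times_ordered /=.
  by case/and3P.
by case=> h1 [h2 h3]; apply/and3P.
Qed.

Lemma measurable_extend (D : set (R * R)) (u0 : R) u : measurable D ->
  measurable_fun D (fun z => u z.1 z.2) ->
  measurable_fun [set: R * R] (fun z => extend D u0 u z.1 z.2).
Proof.
move=> mD mu0; pose v := (fun z => u z.1 z.2 - u0) \_ D.
have mv : measurable_fun [set: R * R] v.
  by apply: (iffLR (measurable_restrictT _ mD)); exact: measurable_funB.
have : measurable_fun [set: R * R] (fun z => v z + u0) by exact: measurable_funD.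
apply: eq_measurable_fun => z _; rewrite /v patchE /extend -surjective_pairing.
by case: ifPn => _; [rewrite subrK|rewrite add0r].
Qed.

Lemma measurable_extend_ordered T N :
  measurable_fun (@times_ordered R T) (fun z => N z.1.1 z.1.2 z.2.1 z.2.2) ->
  measurable_fun [set: (R * R) * (R * R)]
    (fun z => extend_ordered T N z.1.1 z.1.2 z.2.1 z.2.2).
Proof.
move=> /(iffLR (measurable_restrictT _ (measurable_times_ordered T))).
apply: eq_measurable_fun => z _; rewrite patchE /extend_ordered.
by rewrite -!surjective_pairing.
Qed.

Lemma eq_derivative_within (A : set R) (g h : R -> R) (t l : R) : A t ->
  (forall s, A s -> g s = h s) -> derivative_within A g t l -> derivative_within A h t l.
Proof.
move=> At gh; rewrite /derivative_within; apply: cvg_trans; apply: near_eq_cvg.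
by rewrite near_withinE; near=> s => As; rewrite !gh.
Unshelve. all: by end_near.
Qed.

(** The equation only sees the strip: x-derivatives involve a single time, and the time derivative
    is taken within ]tau, T]. *)
Lemma eq_solves_equation T gamma k k' N N' :
  (forall x t, 0 < t -> t <= T -> k x t = k' x t) ->
  (forall x t xi tau, 0 < tau -> tau < t -> t <= T -> N x t xi tau = N' x t xi tau) ->
  solves_equation T gamma k N -> solves_equation T gamma k' N'.
Proof.
move=> kk' NN' eqn xi tau x t tau0 taut tT.
have [d1 d2 [Gt [dt eqt]]] := eqn xi tau x t tau0 taut tT.
have E : (fun z => N z t xi tau) = (fun z => N' z t xi tau) by apply/funext => z; exact: NN'.
rewrite -E -(NN' _ _ _ _ tau0 taut tT) -(kk' _ _ (lt_trans tau0 taut) tT).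
split; [exact: d1|exact: d2|]; exists Gt; split; last exact: eqt.
apply: eq_derivative_within dt.
  by rewrite /= in_itv /= taut.
by move=> s; rewrite /= in_itv /= => /andP[h1 h2]; exact: NN'.
Qed.

Section Gamma.
Context (T kL : R) (k : R -> R -> R) (Phi : R -> R -> R -> R -> R).
Local Notation k' := (extend (Omega T) kL k).
Local Notation Phi' := (extend_ordered T Phi).

Lemma extend_Omega (x t : R) : 0 < t -> t <= T -> k' x t = k x t.
Proof. by move=> h1 h2; rewrite /extend in_Omega h1 h2. Qed.

(** All times occurring in [Gamma] lie between tau and t, hence in ]0, T]. *)
Lemma Gamma_extend (x t xi tau : R) : 0 < tau -> tau < t -> t <= T ->
  Gamma k' Phi' x t xi tau = Gamma k Phi x t xi tau.
Proof.
move=> tau0 taut tT.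
have tauE := extend_Omega xi tau0 (le_trans (ltW taut) tT).
rewrite /Gamma /frozen_heat tauE.
congr (_ + _); apply: eq_Rintegral => s; rewrite inE /= in_itv /= => /andP[h1 h2].
have sT := le_trans (ltW h2) tT.
apply: eq_Rintegral => y _.
by rewrite (extend_Omega y (lt_trans tau0 h1) sT) (extend_orderedE _ _ _ tau0 h1 sT).
Qed.

Lemma Gamma_extend_fun (t xi tau : R) : 0 < tau -> tau < t -> t <= T ->
  (fun z => Gamma k' Phi' z t xi tau) = (fun z => Gamma k Phi z t xi tau).
Proof. by move=> tau0 taut tT; apply/funext => x; exact: Gamma_extend. Qed.

Lemma Gamma_x_extend (x t xi tau : R) : 0 < tau -> tau < t -> t <= T ->
  Gamma_x k' Phi' x t xi tau = Gamma_x k Phi x t xi tau.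
Proof. by move=> tau0 taut tT; rewrite /Gamma_x (Gamma_extend_fun _ tau0 taut tT). Qed.

Lemma solves_equation_extend (gamma : R) : solves_equation T gamma k (Gamma k Phi) ->
  solves_equation T gamma k' (Gamma k' Phi').
Proof.
apply: eq_solves_equation => *; first by rewrite extend_Omega.
by rewrite Gamma_extend.
Qed.

Lemma admissible_extend (kU gamma : R) : 0 < T -> 0 < kL -> kL <= kU ->
  holder_on (Omega T) (1 / 2) k -> (forall x t, Omega T (x, t) -> kL <= k x t <= kU) ->
  parametrix_density T gamma k Phi -> exists C c : R, admissible T kL kU C c k' Phi'.
Proof.
move=> T0 kL0 kLU hk kb [mPhi [C [d [C0 d0 PhiC]]] _].
(* d/4 is the exponent in the bound on [Phi] written as a [gauss]; the minimum lets the heat kernels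
   share it. *)
exists C, (Num.min (8 * kU)^-1 (d / 4)).
have kU0 : 0 < kU by exact: lt_le_trans kLU.
have kU80 : 0 < 8 * kU by rewrite mulr_gt0.
split => //.
- split; last exact: measurable_extend_ordered.
  by apply: measurable_extend; [exact: measurable_Omega|exact: measurable_holder].
- split => // x t; rewrite /extend; case: ifPn => [/set_mem /kb //|_].
  by rewrite lexx kLU.
- split; last exact: ltW.
    by rewrite lt_min invr_gt0 kU80 divr_gt0.
  by rewrite ge_min lexx.
- move=> y s xi tau taus; rewrite /extend_ordered; case: ifPn => [|_]; last first.
    by rewrite normr0 !mulr_ge0 ?powR_ge0 ?gauss_ge0 // ltW.
  rewrite inE => -[/= h1 [_ h2]]; apply: le_trans (PhiC _ _ _ _ h1 taus h2) _.
  have L0 : 0 < s - tau by rewrite subr_gt0.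
  rewrite powRN ler_wpM2l ?divr_ge0 ?powR_ge0 ?(ltW C0) //.
  have -> : expR (- (d * (y - xi) ^+ 2 / (4 * (s - tau)))) = gauss (d / 4) (y - xi) (s - tau).
    by rewrite /gauss; congr (expR (- _)); field; rewrite gt_eqF.
  by apply: le_gauss => //; rewrite ge_min lexx orbT.
Qed.

End Gamma.
End extension.

Theorem proposition1p2 (R : realType) (T gamma kL kU : R)
    (k f G : R -> R -> R) (Phi : R -> R -> R -> R -> R) :
  0 < T -> 0 < kL -> 0 < kU ->
  holder_on (Omega T) (1 / 2) k ->
  (exists kx : R -> R -> R, weak_derivative_x T k kx /\ Linfty_Lp T 2%:E kx) ->
  (forall x t, Omega T (x, t) -> kL <= k x t <= kU) ->
  Linfty_Lp T 2%:E f ->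
  (forall x t, Omega_bar T (x, t) ->
    ((G x t)%:E
       = \int[@lebesgue_measure R]_(z in `]-oo, x]) ((f z t) ^+ 2)%:E)%E) ->
  Linfty_C T G ->
  Linfty_on (Omega T) G ->
  (exists Gx : R -> R -> R, weak_derivative_x T G Gx /\ Linfty_Lp T 1%:E Gx) ->
  (* Gamma k Phi is the fundamental solution *)
  parametrix_density T gamma k Phi ->
  forall K : R, 0 < K ->
  exists delta : R,
    [/\ 0 < delta, delta <= T &
    [/\ L2_norm_le (Omega_bar delta) (potential (Gamma k Phi) f) K,
        L2_norm_le (Omega_bar delta) (potential (Gamma_x k Phi) f) K &
        L2_norm_le (Omega_bar delta) (potential (Gamma_x k Phi) G) K]].
Proof.
move=> T0 kL0 _ hk _ kb hf hG _ [mG _] _ hPhi K K0.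
have kLU : kL <= kU.
  have /kb : Omega T (0, T) by rewrite /Omega /=; split => //=; rewrite in_itv /= T0 lexx.
  by case/andP; exact: le_trans.
have [C [c adm]] := admissible_extend T0 kL0 kLU hk kb hPhi.
have [_ _ /(@solves_equation_extend R T kL) eqn] := hPhi.
set k' := extend _ _ _ in adm eqn; set Phi' := extend_ordered _ _ in adm eqn.
have [Ch hk'] : exists Ch : R, forall x y t, 0 < t -> t <= T ->
    `|k' x t - k' y t| <= Ch * `|x - y| `^ (1 / 2).
  have [Ch hCh] := hk; exists Ch => x y t t0 tT.
  have h (z : R) : Omega T (z, t) by rewrite /Omega /=; split => //=; rewrite in_itv /= t0.
  rewrite /k' !extend_Omega //; apply: le_trans (hCh _ _ (h x) (h y)) _.
  by rewrite /= subrr normr0 powR0 ?addr0 // gt_eqF // divr_gt0.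
have [A1 A10 Gamma_b] := Gamma_le adm.
have [A2 A20 Gamma_xb] := Gamma_x_le adm eqn.
have [_ _ _ [c0 _ _] _] := adm.
have e0 : 0 < c / 2 by rewrite divr_gt0.
(* [Gamma] of the extended data is globally measurable, whereas [Gamma_x] is known to be so only for
   ordered times and is extended once more. *)
pose N1 := Gamma k' Phi'; pose N2 := extend_ordered T (Gamma_x k' Phi').
have mN1 : measurable_fun [set: (R * R) * (R * R)] (fun z => N1 z.1.1 z.1.2 z.2.1 z.2.2).
  exact: measurable_Gamma adm.
have mN2 : measurable_fun [set: (R * R) * (R * R)] (fun z => N2 z.1.1 z.1.2 z.2.1 z.2.2).
  by apply: measurable_extend_ordered; exact: measurable_Gamma_x adm eqn.
(* One constant for both kernels: sqrt T weakens (t - tau)^(-1/2) to (t - tau)^(-1), and the 1 makes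
   it positive. *)
pose A := A1 * Num.sqrt T + A2 + 1.
have A1T : 0 <= A1 * Num.sqrt T by rewrite mulr_ge0 ?sqrtr_ge0.
have A0 : 0 < A by rewrite ltr_wpDl ?addr_ge0.
have N1A x t xi tau : 0 < tau -> tau < t -> t <= T ->
    `|N1 x t xi tau| <= A / (t - tau) * gauss (c / 2) (x - xi) (t - tau).
  move=> tau0 taut tT; have L0 : 0 < t - tau by rewrite subr_gt0.
  have LT : t - tau <= T by rewrite (le_trans _ tT) // gerBl ltW.
  apply: le_trans (Gamma_b _ _ _ _ taut LT) _; rewrite ler_wpM2r ?gauss_ge0 //.
  rewrite ler_pdivlMr // mulrAC -(mulrA A1).
  have -> : (t - tau) / Num.sqrt (t - tau) = Num.sqrt (t - tau).
    by rewrite -{1}(sqr_sqrtr (ltW L0)) expr2 mulfK // gt_eqF ?sqrtr_gt0.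
  apply: (@le_trans _ _ (A1 * Num.sqrt T)); first by rewrite ler_wpM2l // ler_wsqrtr.
  by rewrite /A -addrA lerDl addr_ge0.
have N2A x t xi tau : 0 < tau -> tau < t -> t <= T ->
    `|N2 x t xi tau| <= A / (t - tau) * gauss (c / 2) (x - xi) (t - tau).
  move=> tau0 taut tT; have L0 : 0 < t - tau by rewrite subr_gt0.
  rewrite /N2 extend_orderedE //; apply: le_trans (Gamma_xb _ _ _ _ tau0 taut tT) _.
  rewrite ler_wpM2r ?gauss_ge0 // ler_wpM2r ?invr_ge0 ?(ltW L0) //.
  by rewrite /A addrAC lerDr addr_ge0.
have N20 t x tau : t <= T -> 0 < tau < t -> \int[lebesgue_measure]_xi N2 x t xi tau = 0.
  move=> tT /andP[tau0 taut].
  rewrite -[RHS](integral_Gamma_x0 adm hk' eqn x tau0 taut tT).2.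
  by apply: eq_Rintegral => xi _; rewrite /N2 extend_orderedE.
(* [G] is measurable on [Omega T] by hypothesis, [f] on [Omega_bar T]; the potentials only use times
   in ]0, t[. *)
pose f' := extend (Omega_bar T) 0 f; pose G' := extend (Omega T) 0 G.
have f'E (x t : R) : 0 < t -> t <= T -> f' x t = f x t.
  by move=> t0 tT; rewrite /f' /extend in_Omega_bar (ltW t0) tT.
have G'E (x t : R) : 0 < t -> t <= T -> G' x t = G x t.
  by move=> t0 tT; rewrite /G' /extend in_Omega t0 tT.
have mf' : measurable_fun [set: R * R] (fun z => f' z.1 z.2).
  by apply: measurable_extend; [exact: measurable_Omega_bar|case: hf].
have mG' : measurable_fun [set: R * R] (fun z => G' z.1 z.2).
  by apply: measurable_extend => //; exact: measurable_Omega.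
have mf2 : measurable_fun [set: R * R] (fun z => f' z.1 z.2 ^+ 2) by exact: measurable_funX.
have [M M0 fM] := Linfty_L2_bound hf.
have fM' : {ae lebesgue_measure, forall tau : R, 0 < tau <= T ->
    (\int[lebesgue_measure]_xi (f' xi tau ^+ 2)%:E <= M%:E)%E}.
  apply: (@filterS _ _ (ae_filter_ringOfSetsType lebesgue_measure) _ _ _ fM) => tau {}fM h.
  by under eq_integral do rewrite f'E ?(andP h).1 ?(andP h).2 //; exact: fM.
have GM' : {ae lebesgue_measure, forall tau : R, 0 < tau <= T ->
    (forall x, ((G' x tau)%:E = \int[lebesgue_measure]_(z in `]-oo, x]) (f' z tau ^+ 2)%:E)%E) /\
    (\int[lebesgue_measure]_xi (f' xi tau ^+ 2)%:E <= M%:E)%E}.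
  apply: (@filterS _ _ (ae_filter_ringOfSetsType lebesgue_measure) _ _ _ fM') => tau {}fM h.
  split; last exact: fM.
  have /andP[h1 h2] := h; move=> x; rewrite G'E // hG; last first.
    by rewrite /Omega_bar /=; split => //=; rewrite in_itv /= (ltW h1).
  by apply: eq_integral => z _; rewrite f'E.
have S0 := ltW (potential_const_gt0 T0 A0 e0).
have [d1 d10 h1] : exists2 d : R, 0 < d & forall del, 0 <= del -> del <= d -> del <= T ->
    L2_norm_le (Omega_bar del) (potential N1 f') K.
  apply: (L2_norm_le_small_time _ _ K0 (potential_at0 N1 f')
    (fun t ht => potential_section_sqr_le T0 A0 e0 mN1 N1A (andP ht).1 (andP ht).2 M0 mf' fM')).
    exact: measurable_potential.
  exact: mulr_ge0 S0 (mulr_ge0 S0 M0).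
have [d2 d20 h2] : exists2 d : R, 0 < d & forall del, 0 <= del -> del <= d -> del <= T ->
    L2_norm_le (Omega_bar del) (potential N2 f') K.
  apply: (L2_norm_le_small_time _ _ K0 (potential_at0 N2 f')
    (fun t ht => potential_section_sqr_le T0 A0 e0 mN2 N2A (andP ht).1 (andP ht).2 M0 mf' fM')).
    exact: measurable_potential.
  exact: mulr_ge0 S0 (mulr_ge0 S0 M0).
have [d3 d30 h3] : exists2 d : R, 0 < d & forall del, 0 <= del -> del <= d -> del <= T ->
    L2_norm_le (Omega_bar del) (potential N2 G') K.
  apply: (L2_norm_le_small_time _ _ K0 (potential_at0 N2 G')
    (fun t ht => @potential_section_sqr_le_primitive R T A (c / 2) N2 T0 A0 e0 mN2 N2A
       t (andP ht).1 (andP ht).2 G' (fun z tau => f' z tau ^+ 2) M M0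
       (fun z tau => sqr_ge0 _) mf2 mG' (fun x tau => N20 t x tau (andP ht).2) GM')).
    exact: measurable_potential.
  exact: mulr_ge0 (mulr_ge0 S0 M0) (mulr_ge0 S0 (mulr_ge0 M0 (sqrtr_ge0 _))).
pose delta := Num.min T (Num.min d1 (Num.min d2 d3)).
have [dT dd1 dd2 dd3] : [/\ delta <= T, delta <= d1, delta <= d2 & delta <= d3].
  by rewrite /delta !ge_min !lexx !orbT.
have delta0 : 0 < delta by rewrite /delta !lt_min T0 d10 d20 d30.
exists delta; split; [exact: delta0|exact: dT|].
have le_T (t tau : R) : 0 <= t <= delta -> 0 < tau < t ->
    [/\ 0 < tau, tau < t, t <= T & tau <= T].
  case/andP=> _ td /andP[tau0 taut]; have tT := le_trans td dT.
  by split => //; exact: le_trans (ltW taut) tT.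
split.
- apply: eq_L2_norm_le (h1 _ (ltW delta0) dd1 dT) => x t ht.
  apply: eq_potential => xi tau /(le_T _ _ ht)[? ? ? ?]; last exact: f'E.
  exact: Gamma_extend.
- apply: eq_L2_norm_le (h2 _ (ltW delta0) dd2 dT) => x t ht.
  apply: eq_potential => xi tau /(le_T _ _ ht)[? ? ? ?]; last exact: f'E.
  transitivity (Gamma_x k' Phi' x t xi tau); first exact: extend_orderedE.
  exact: Gamma_x_extend.
- apply: eq_L2_norm_le (h3 _ (ltW delta0) dd3 dT) => x t ht.
  apply: eq_potential => xi tau /(le_T _ _ ht)[? ? ? ?]; last exact: G'E.
  transitivity (Gamma_x k' Phi' x t xi tau); first exact: extend_orderedE.
  exact: Gamma_x_extend.
Qed.
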